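(* Let $(s^0,x^0)\in\mathbb K^r\times\mathbb K^n$ be a nondegenerate point (see context) which is a solution of the system of Bethe ansatz equations $$\kappa^p\prod_{i=1}^n\frac{h_p(s_l)-h_p(x_i)+h_p(\Lambda_i)}{h_p(s_l)-h_p(x_i)}\cdot\prod_{j\ne l}\frac{h_p(s_l)-h_p(s_j)-h_p(1)}{h_p(s_l)-h_p(s_j)+h_p(1)}=1,\qquad l=1,\dots,r,$$ where $h_p(y)=y^p-a^{p-1}y$. Define the vector in $V_{\mathbb K}$ $$J(s^0,x^0)=\sum_{i_1,\dots,i_r=0}^{p-1}W(s^0+a(i_1e_1+\dots+i_re_r),x^0)\prod_{l=1}^r\prod_{d_l=0}^{i_l-1}\Phi_l\bigl(s^0+a(i_1e_1+\dots+i_{l-1}e_{l-1}+d_le_l),x^0\bigr).$$ Then $J(s^0,x^0)$, if nonzero, is an eigenvector of the $p$-curvature operators $\tilde K_m(x^0)$, $m=1,\dots,n$, with respective eigenvalues $$\prod_{l=1}^r\frac{h_p(s_l^0)-h_p(x_m^0)}{h_p(s_l^0)-h_p(x_m^0)+h_p(\Lambda_m)}.$$ Moreover, the function $I:\mathbb Z^n\to V_{\mathbb K}$ obtained from $J(s^0,x^0)$ by parallel transport along the orbit of $x^0$, i.e. determined by $I(0)=J(s^0,x^0)$ and $I(k+f_m)=K_m(x^0+ak)I(k)$ for all $k\in\mathbb Z^n$, $m=1,\dots,n$, is, if nonzero, an eigensection of the $p$-curvature functions: $\tilde K_m(x^0+ak)I(k)=\lambda_m I(k)$ for all $k\in\mathbb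 Z^n$, where $\lambda_m$ is the eigenvalue displayed above.
   Context: Let $\mathbb K$ be a field of characteristic $p>2$ with prime subfield $\mathbb F_p$, let $n,r\ge1$ be integers, $a,\kappa\in\mathbb K^\times$, $\Lambda_1,\dots,\Lambda_n\in\mathbb K$. Let $e_1,\dots,e_r$ and $f_1,\dots,f_n$ be the standard basis vectors of $\mathbb Z^r$ and $\mathbb Z^n$, $s=(s_1,\dots,s_r)$, $x=(x_1,\dots,x_n)$; $s+ae_i$ (resp. $x+af_i$) is $s$ (resp. $x$) with $i$-th coordinate increased by $a$. Fiber. $\mathfrak{gl}_2$ over $\mathbb K$ has standard generators $e_{ij}$; set $e=e_{12}$, $f=e_{21}$, $h_1=e_{11}$, $h_2=e_{22}$. $M_\Lambda$ is the Verma module with basis $f^kv_\Lambda$, $k\ge0$, where $ev_\Lambda=0$, $h_1v_\Lambda=\Lambda v_\Lambda$, $h_2v_\Lambda=0$. $V_{\mathbb K}$ is the subspace of $M_{\Lambda_1}\otimes\dots\otimes M_{\Lambda_n}$ with basis $f^{\vec r}=f^{r_1}v_{\Lambda_1}\otimes\dots\otimes f^{r_n}v_{\Lambda_n}$, $\vec r=(r_1,\dots,r_n)\in\mathbb Z_{\ge0}^n$, $r_1+\dots+r_n=r$. $R$-matrix. $R_{\Lambda_1,\Lambda_2}(x)\in\mathrm{End}(M_{\Lambda_1}\otimes M_{\Lambda_2})(x)$ is the unique operator, rational in $x$, with $R(x)(f\otimes1+1\otimes f)=(f\otimes1+1\otimes f)R(x)$, $R(x)(f\otimes h_2+(h_1-x)\otimes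 f)=(f\otimes h_1+(h_2-x)\otimes f)R(x)$, $R(x)\,v_{\Lambda_1}\otimes v_{\Lambda_2}=v_{\Lambda_1}\otimes v_{\Lambda_2}$ (here $R=R_{\Lambda_1,\Lambda_2}$). It preserves weight subspaces. $R^{(i,j)}_{\Lambda_i,\Lambda_j}$ denotes its action on the $i$-th and $j$-th tensor factors (first factor of $R$ on the $i$-th). Also $\kappa^{h_2^{(m)}}f^{\vec r}=\kappa^{r_m}f^{\vec r}$. qKZ functions on $V_{\mathbb K}$: $$K_m(x)=R^{(m,m-1)}_{\Lambda_m,\Lambda_{m-1}}(x_m-x_{m-1}+a)\cdots R^{(m,1)}_{\Lambda_m,\Lambda_1}(x_m-x_1+a)\,\kappa^{h_2^{(m)}}\,R^{(m,n)}_{\Lambda_m,\Lambda_n}(x_m-x_n)\cdots R^{(m,m+1)}_{\Lambda_m,\Lambda_{m+1}}(x_m-x_{m+1}).$$ They satisfy $K_m(x+af_l)K_l(x)=K_l(x+af_m)K_m(x)$. The $p$-curvature functions are $\tilde K_m(x)=K_m(x+(p-1)af_m)\cdots K_m(x+af_m)K_m(x)$. Rank-one functions: $$\Phi_l(s,x)=\kappa\prod_{i=1}^n\frac{s_l-x_i+\Lambda_i}{s_l-x_i+a}\prod_{j\ne l}\frac{(s_l-s_j+a)(s_l-s_j-1)}{(s_l-s_j)(s_l-s_j+1+a)},\quad l=1,\dots,r.$$ Weight function: $W(s,x)=\sum_{\vec r}W_{\vec r}(s,x)f^{\vec r}$, where $$W_{\vec r}=\frac1{r_1!\cdots r_n!}\sum_{\sigma\in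 S_r}\Bigl[\prod_{i=1}^n\ \prod_{j=r_1+\dots+r_{i-1}+1}^{r_1+\dots+r_i}\Bigl(\prod_{i'<i}(s_j-x_{i'}+\Lambda_{i'})\prod_{i''>i}(s_j-x_{i''})\Bigr)\prod_{1\le j'<j''\le r}\frac{s_{j'}-s_{j''}+1}{s_{j'}-s_{j''}}\Bigr]_{s_j\mapsto s_{\sigma(j)}};$$ computed over $\mathbb Q$ this is a polynomial in $s,x,\Lambda$ with integer coefficients, which is then reduced modulo $p$. Nondegenerate point: $(s^0,x^0)$ is called nondegenerate if for all $c\in\mathbb F_p$ the following elements of $\mathbb K$ are nonzero: $s^0_k-x^0_i+ca$ and $s^0_k-x^0_i+\Lambda_i+ca$ (all $k,i$); $s^0_k-s^0_j+ca$ and $s^0_k-s^0_j+1+ca$ (all $k\neq j$); $x^0_i-x^0_m-\Lambda_i+b+ca$ (all $i\ne m$ and $b=0,\dots,r-1$). This guarantees that all functions above are regular, $\Phi_l$ nonzero and $K_m$ invertible, on the $a\mathbb Z^{r+n}$-orbit of $(s^0,x^0)$. *)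

(* Defs.v *)
From HB Require Import structures.
From mathcomp Require Import all_boot all_order all_algebra perm.
From mathcomp.multinomials Require Import mpoly.
Set Implicit Arguments.
Unset Strict Implicit.
Unset Printing Implicit Defensive.
Import GRing.Theory.
Local Open Scope ring_scope.

(* M_(Lambda_1) (x) ... (x) M_(Lambda_n) over E has the basis
   f^(r_1) v (x) ... (x) f^(r_n) v indexed by (r_1, ..., r_n) : 'X_{1..n}; it is
   modelled, as an E-module, by {mpoly E[n]}, this basis vector being 'X_[r].
   The weight subspace r_1 + ... + r_n = r is then the subspace of
   r.-homog elements for mdeg. The multiplication of {mpoly E[n]} is not used.
   The action of e = e_12 does not enter the definitions below. *)

Definition ext_basis (E : nzRingType) (n : nat)
    (g : 'X_{1..n} -> {mpoly E[n]}) (v : {mpoly E[n]}) : {mpoly E[n]} :=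
  \sum_(q <- msupp v) v@_q *: g q.

Definition f_at (E : nzRingType) (n : nat) (i : 'I_n) :=
  @ext_basis E n (fun q => 'X_[q + U_(i)]).

(* h_1 f^k v = (Lambda - k) f^k v,  h_2 f^k v = k f^k v *)
Definition h1_at (E : nzRingType) (n : nat) (Lambda : E) (i : 'I_n) :=
  @ext_basis E n (fun q => (Lambda - (q i)%:R) *: 'X_[q]).

Definition h2_at (E : nzRingType) (n : nat) (i : 'I_n) :=
  @ext_basis E n (fun q => (q i)%:R *: 'X_[q]).

(* K(z)-linear endomorphisms of K(z) (x) M (x) M; the spectral parameter of R
   is the indeterminate z := tofrac 'X. *)
Definition tensor2_end (K : fieldType) :=
  {linear {mpoly {fraction {poly K}}[2]} -> {mpoly {fraction {poly K}}[2]}}.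

Definition is_Rmatrix (K : fieldType) (L1 L2 : K) (R : tensor2_end K) : Prop :=
  let F := {fraction {poly K}} in
  let z : F := tofrac 'X in
  let l1 : F := tofrac L1%:P in
  let l2 : F := tofrac L2%:P in
  let i1 : 'I_2 := ord0 in
  let i2 : 'I_2 := ord_max in
  [/\ forall v, R (f_at i1 v + f_at i2 v) = f_at i1 (R v) + f_at i2 (R v),
      forall v,
        R (f_at i1 (h2_at i2 v) + f_at i2 (h1_at l1 i1 v - z *: v))
        = f_at i1 (h1_at l2 i2 (R v)) + f_at i2 (h2_at i1 (R v) - z *: R v)
    & R 'X_[0%MM] = 'X_[0%MM]].

(* Value of a rational function at c, computed from a fraction in lowest
   terms (junk at a pole). *)
Definition frac_eval (K : fieldType) (q : {fraction {poly K}}) (c : K) : K :=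
  let u := \n_(repr q) in
  let w := \d_(repr q) in
  (u %/ gcdp u w).[c] / (w %/ gcdp u w).[c].

(* R(c) acting on the i-th and j-th tensor factors, the first factor of R
   being the i-th one. *)
Definition R_at (K : fieldType) (n : nat) (R : tensor2_end K) (i j : 'I_n)
    (c : K) : {mpoly K[n]} -> {mpoly K[n]} :=
  ext_basis (fun q =>
    let u := R 'X_[U_(ord0) *+ q i + U_(ord_max) *+ q j] in
    \sum_(t <- msupp u)
      frac_eval u@_t c *:
        'X_[[multinom (if k == i then t ord0
                       else if k == j then t ord_max else q k) | k < n]]).

Definition kappa_h2 (K : fieldType) (n : nat) (kappa : K) (m : 'I_n) :=
  @ext_basis K n (fun q => kappa ^+ q m *: 'X_[q]).

(* Both products of R-matrices are applied in the order of increasing j. *)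
Definition qKZ (K : fieldType) (n : nat) (a kappa : K) (Lambda : 'rV[K]_n)
    (R : K -> K -> tensor2_end K) (m : 'I_n) (x : 'rV[K]_n)
    (v : {mpoly K[n]}) : {mpoly K[n]} :=
  let Rm j c := R_at (R (Lambda 0 m) (Lambda 0 j)) m j c in
  let v1 := foldl (fun w j => Rm j (x 0 m - x 0 j) w) v
                  [seq j : 'I_n <- enum 'I_n | (m < j)%N] in
  foldl (fun w j => Rm j (x 0 m - x 0 j + a) w) (kappa_h2 kappa m v1)
        [seq j : 'I_n <- enum 'I_n | (j < m)%N].

Definition p_curvature (K : fieldType) (n p : nat) (a kappa : K)
    (Lambda : 'rV[K]_n) (R : K -> K -> tensor2_end K) (m : 'I_n)
    (x : 'rV[K]_n) (v : {mpoly K[n]}) : {mpoly K[n]} :=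
  foldl (fun w c => qKZ a kappa Lambda R m
                        (x + (a * c%:R) *: delta_mx 0 m) w)
        v (iota 0 p).

Definition Phi (K : fieldType) (n r : nat) (a kappa : K) (Lambda : 'rV[K]_n)
    (l : 'I_r) (s : 'rV[K]_r) (x : 'rV[K]_n) : K :=
  kappa
  * (\prod_(i < n) ((s 0 l - x 0 i + Lambda 0 i) / (s 0 l - x 0 i + a)))
  * \prod_(j < r | j != l)
      (((s 0 l - s 0 j + a) * (s 0 l - s 0 j - 1))
       / ((s 0 l - s 0 j) * (s 0 l - s 0 j + 1 + a))).

(* With 0-based indices, j runs over the block r_1 + ... + r_(i-1) <= j
   < r_1 + ... + r_i. *)
Definition weight_coef (E : fieldType) (n r : nat) (s : 'I_r -> E)
    (x Lambda : 'I_n -> E) (q : 'X_{1..n}) : E :=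
  (\prod_(i < n) ((q i)`!)%:R)^-1 *
  \sum_(sigma : 'S_r)
    ((\prod_(i < n)
       \prod_(j < r | (\sum_(k < n | (k < i)%N) q k <= j
                       < \sum_(k < n | (k <= i)%N) q k)%N)
         ((\prod_(k < n | (k < i)%N) (s (sigma j) - x k + Lambda k))
          * \prod_(k < n | (i < k)%N) (s (sigma j) - x k)))
     * \prod_(j < r) \prod_(k < r | (j < k)%N)
         ((s (sigma j) - s (sigma k) + 1) / (s (sigma j) - s (sigma k)))).

(* W q is the polynomial with integer coefficients, in the r + (n + n)
   variables s, x, Lambda (in this order), equal to weight_coef over the field
   Q(s, x, Lambda). *)
Definition is_weight_poly (n r : nat)
    (W : 'X_{1..n} -> {mpoly int[r + (n + n)]}) : Prop :=
  let var (k : 'I_(r + (n + n))) : {fraction {mpoly rat[r + (n + n)]}} :=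
    tofrac 'X_k in
  forall q : 'X_{1..n}, mdeg q = r ->
    tofrac (map_mpoly intr (W q))
    = weight_coef (fun j : 'I_r => var (lshift (n + n) j))
                  (fun i : 'I_n => var (rshift r (lshift n i)))
                  (fun i : 'I_n => var (rshift r (rshift n i))) q.

(* mmap intr reduces the coefficients modulo p, i.e. maps them to K. *)
Definition weight_fun (K : fieldType) (n r : nat)
    (W : 'X_{1..n} -> {mpoly int[r + (n + n)]}) (Lambda : 'rV[K]_n)
    (s : 'rV[K]_r) (x : 'rV[K]_n) : {mpoly K[n]} :=
  \sum_(q : 'X_{1..n < r.+1} | mdeg q == r)
    mmap intr (fun k => row_mx s (row_mx x Lambda) 0 k) (W q) *: 'X_[q].

(* c%:R, for c : nat, runs over the prime subfield. *)
Definition nondegenerate_point (K : fieldType) (n r : nat) (a : K)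
    (Lambda : 'rV[K]_n) (s : 'rV[K]_r) (x : 'rV[K]_n) : Prop :=
  forall c : nat,
  [/\ forall k i, s 0 k - x 0 i + c%:R * a != 0,
      forall k i, s 0 k - x 0 i + Lambda 0 i + c%:R * a != 0,
      forall k j, k != j -> s 0 k - s 0 j + c%:R * a != 0,
      forall k j, k != j -> s 0 k - s 0 j + 1 + c%:R * a != 0
    & forall i m, i != m -> forall b : nat, (b < r)%N ->
        x 0 i - x 0 m - Lambda 0 i + b%:R + c%:R * a != 0].

Definition h_p (K : fieldType) (p : nat) (a y : K) : K :=
  y ^+ p - a ^+ p.-1 * y.

Definition Bethe_equations (K : fieldType) (n r p : nat) (a kappa : K)
    (Lambda : 'rV[K]_n) (s : 'rV[K]_r) (x : 'rV[K]_n) : Prop :=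
  let h := h_p p a in
  forall l : 'I_r,
    kappa ^+ p
    * (\prod_(i < n)
         ((h (s 0 l) - h (x 0 i) + h (Lambda 0 i)) / (h (s 0 l) - h (x 0 i))))
    * (\prod_(j < r | j != l)
         ((h (s 0 l) - h (s 0 j) - h 1) / (h (s 0 l) - h (s 0 j) + h 1)))
    = 1.

Definition Jvec (K : fieldType) (n r p : nat) (a kappa : K)
    (Lambda : 'rV[K]_n) (W : 'X_{1..n} -> {mpoly int[r + (n + n)]})
    (s : 'rV[K]_r) (x : 'rV[K]_n) : {mpoly K[n]} :=
  \sum_(i : {ffun 'I_r -> 'I_p})
    (\prod_(l < r) \prod_(d < i l)
       Phi a kappa Lambda l
         (s + a *: (\sum_(k < r | (k < l)%N) (i k)%:R *: delta_mx 0 k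
                    + d%:R *: delta_mx 0 l)) x)
    *: weight_fun W Lambda (s + a *: \sum_(k < r) (i k)%:R *: delta_mx 0 k) x.

Definition curv_eigenvalue (K : fieldType) (n r p : nat) (a : K)
    (Lambda : 'rV[K]_n) (s : 'rV[K]_r) (x : 'rV[K]_n) (m : 'I_n) : K :=
  let h := h_p p a in
  \prod_(l < r)
    ((h (s 0 l) - h (x 0 m)) / (h (s 0 l) - h (x 0 m) + h (Lambda 0 m))).

(* x + a k, for k in Z^n *)
Definition lattice_shift (K : fieldType) (n : nat) (a : K) (x : 'rV[K]_n)
    (k : 'rV[int]_n) : 'rV[K]_n :=
  x + a *: map_mx intr k.

Definition is_parallel_transport (K : fieldType) (n r : nat) (a kappa : K)
    (Lambda : 'rV[K]_n) (R : K -> K -> tensor2_end K) (x : 'rV[K]_n)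
    (J : {mpoly K[n]}) (I : 'rV[int]_n -> {mpoly K[n]}) : Prop :=
  [/\ forall k, I k \is r.-homog for mdeg,
      I 0 = J
    & forall k m, I (k + delta_mx 0 m)
                  = qKZ a kappa Lambda R m (lattice_shift a x k) (I k)].

(* Main.v *)
(* The functions Phi_l, together with the ratios Psi_m of the master function
   along the x-directions, form a flat rank-one connection on the (s,x)-lattice.
   The Bethe equations say that the products of Phi_l over p consecutive shifts
   of s_l are 1; a flat section along the s-lattice is therefore p-periodic and J
   is the sum of the section times W over (Z/p)^r. In such a periodic sum one may
   shift the variables in each term separately.

   W is a sum over the maps g sending each variable to a tensor factor. The
   R-matrices of K_m to the right of kappa^(h_2) move the factor m to the last
   position in the order defining W, those to the left move it from the first
   position back to its place: the R-matrix exchanges the weight functions of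
   adjacent factors since both are built by creation operators that it
   intertwines. In between, for each g, kappa^(h_2) is absorbed by shifting the
   variables with g = m, and x_m becomes x_m + a while the section is multiplied
   by Psi_m. After p steps x is back and the section has been multiplied by
   prod_c Psi_m(s, x + c a f_m), which is the eigenvalue.

   For the parallel transport, the section extends to Z^n by integer products of
   Psi_m, and uniqueness follows from R_21(-c) R_12(c) = 1. *)
Require Import Defs.
From HB Require Import structures.
From mathcomp Require Import all_boot all_order all_algebra perm.
From mathcomp Require Import ring zify.
From mathcomp.multinomials Require Import ssrcomplements mpoly.
Set Implicit Arguments.
Unset Strict Implicit.
Unset Printing Implicit Defensive.
Import GRing.Theory.
Local Open Scope ring_scope.

(** * Partial fractions *)

(** No formula for the R-matrix is used: it is known only through intertwining relations over K(z),
    whereas the qKZ operators need its values at points of K. The relations yield a recursion on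
    basis vectors that divides only by Lambda_1 - b - z, with b below the number of lowering
    operators, at most r. This is the origin of the last nondegeneracy condition, and the reason why
    statements about R are restricted to degrees bounded by some N. The second obstacle is the
    division by r_1! ... r_n!, which may vanish in K. The sum over permutations is compared with the
    sum over maps in characteristic 0; the equality is multiplied by the differences s_j - s_k,
    descends to integer coefficients, and is mapped to K only then. Both the exchange relation and
    the disappearance of the factorials rest on one identity: the sum over j of prod_(k != j) (1 + e
    / (s_j - s_k)) is the number of points, for every e. *)

Section PartialFractions.
Variables (K : fieldType) (I : eqType) (s : I -> K) (e : K).

(** Induction on the poles. The hypothesis is used at [z] and also at [z = s t], where it supplies
    the residue at the new pole. *)
Lemma partial_fraction_prod (S : seq I) (z : K) :
  uniq S -> {in S &, injective s} -> {in S, forall j, z != s j} ->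
  \prod_(j <- S) (1 + e / (z - s j)) =
  1 + \sum_(j <- S) e / (z - s j) *
        \prod_(k <- S | k != j) (1 + e / (s j - s k)).
Proof.
elim: S z => [|t S IH] z; first by rewrite !big_nil addr0.
move=> /= /andP[tS uS] injs zS.
have injS : {in S &, injective s}.
  by move=> i j iS jS; apply: injs; rewrite inE ?iS ?jS orbT.
have tsS : {in S, forall j, s t != s j}.
  move=> j jS; apply: contraNneq tS => stj.
  by rewrite (injs t j) ?inE ?eqxx ?jS ?orbT.
have zt : z - s t != 0 by rewrite subr_eq0 zS // inE eqxx.
rewrite !big_cons eqxx /= (IH z) //; last first.
  by move=> j jS; apply: zS; rewrite inE jS orbT.
have -> : \prod_(k <- S | k != t) (1 + e / (s t - s k)) =
          \prod_(k <- S) (1 + e / (s t - s k)).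
  rewrite [LHS]big_mkcond; apply: eq_big_seq => k kS.
  by case: eqP => // kt; rewrite -kt kS in tS.
rewrite (IH (s t)) //.
rewrite mulrDr mulr1 mulrDr mulr1 -!addrA; congr (_ + (_ + _)).
rewrite !mulr_sumr -big_split /=; apply: eq_big_seq => j jS.
have zj : z - s j != 0 by rewrite subr_eq0 zS // inE jS orbT.
have tj : s t - s j != 0 by rewrite subr_eq0 tsS.
have jt : s j - s t != 0 by rewrite -opprB oppr_eq0.
have tj' : t != j by apply: contraNneq tS => ->.
rewrite big_cons tj'.
set c := \prod_(_ <- _ | _) _.
by field; rewrite zt zj tj jt.
Qed.

(** Conceptually, both sides are the coefficient of e/z at infinity in the partial fraction
    expansion. In the induction, the terms with 1/(s t - s j) from the new summand cancel the
    changes with 1/(s j - s t) in the old ones. *)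
Lemma sum_prod_ratio (S : seq I) :
  uniq S -> {in S &, injective s} ->
  \sum_(j <- S) \prod_(k <- S | k != j) (1 + e / (s j - s k)) = (size S)%:R.
Proof.
elim: S => [|t S IH]; first by rewrite !big_nil.
move=> /= /andP[tS uS] injs.
have injS : {in S &, injective s}.
  by move=> i j iS jS; apply: injs; rewrite inE ?iS ?jS orbT.
have tsS : {in S, forall j, s t != s j}.
  move=> j jS; apply: contraNneq tS => stj.
  by rewrite (injs t j) ?inE ?eqxx ?jS ?orbT.
rewrite !big_cons eqxx /=.
have -> : \prod_(k <- S | k != t) (1 + e / (s t - s k)) =
          \prod_(k <- S) (1 + e / (s t - s k)).
  rewrite [LHS]big_mkcond; apply: eq_big_seq => k kS.
  by case: eqP => // kt; rewrite -kt kS in tS.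
rewrite partial_fraction_prod // -natr1 -IH // addrC addrA addrAC; congr (_ + 1).
rewrite addrC -big_split /=; apply: eq_big_seq => j jS.
have tj : s t - s j != 0 by rewrite subr_eq0 tsS.
have jt : s j - s t != 0 by rewrite -opprB oppr_eq0.
have tj' : t != j by apply: contraNneq tS => ->.
rewrite big_cons tj'.
set c := \prod_(_ <- _ | _) _.
by field; rewrite tj jt.
Qed.

End PartialFractions.

Section PartialFractionsSet.
Variables (K : fieldType) (I : finType) (s : I -> K) (e : K).

Lemma partial_fraction_prod_set (A : {set I}) (z : K) :
  injective s -> {in A, forall j, z != s j} ->
  \prod_(j in A) (1 + e / (z - s j)) =
  1 + \sum_(j in A) e / (z - s j) *
        \prod_(k in A :\ j) (1 + e / (s j - s k)).
Proof.
move=> injs zA; rewrite -big_enum partial_fraction_prod ?enum_uniq //.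
- rewrite big_enum; congr (1 + _); apply: eq_bigr => j jA.
  by rewrite big_enum_cond; congr (_ * _); apply: eq_bigl => k; rewrite !inE andbC.
- by move=> i j _ _; apply: injs.
by move=> j; rewrite mem_enum; apply: zA.
Qed.

Lemma sum_prod_ratio_set (A : {set I}) : injective s ->
  \sum_(j in A) \prod_(k in A :\ j) (1 + e / (s j - s k)) = #|A|%:R.
Proof.
move=> injs; rewrite cardE -(@sum_prod_ratio K I s e) ?enum_uniq //; last first.
  by move=> i j _ _; apply: injs.
rewrite big_enum; apply: eq_bigr => j jA.
by rewrite big_enum_cond; apply: eq_bigl => k; rewrite !inE andbC.
Qed.

End PartialFractionsSet.


Lemma big_subsetU1 (V : nmodType) (I : finType) (b : I) (B : {set I})
    (F : {set I} -> V) : b \notin B ->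
  \sum_(A : {set I} | A \subset b |: B) F A =
  \sum_(A : {set I} | A \subset B) (F (b |: A) + F A).
Proof.
move=> bB; rewrite (bigID (fun A : {set I} => b \in A)) /= big_split /=.
congr (_ + _); last first.
  by apply: eq_bigl => A; rewrite -subsetD1 setU1K.
rewrite (reindex_onto (fun A => b |: A) (fun A => A :\ b)) /=; last first.
  by move=> A /andP[_ bA]; rewrite setD1K.
apply: eq_bigl => A; rewrite setU11 andbT -{2}(setU1K bB) subsetD1.
case: (boolP (b \in A)) => bA.
  rewrite andbF; apply/negbTE; apply: contraTN isT => /andP[_ /eqP E].
  by move: bA; rewrite -E !inE eqxx.
by rewrite setU1K // eqxx !andbT subUset sub1set setU11.
Qed.

(** * Two tensor factors *)

Definition pair_factor (K : fieldType) (y z : K) : K := (y - z + 1) / (y - z).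

(** Moving [j] into [A] is a bijection between the two index sets. It serves to cancel polar
    parts. *)
Lemma sum_subset_exchange (V : nmodType) (I : finType) (B : {set I})
    (F G : {set I} -> I -> V) :
  (forall (A : {set I}) j, A \subset B -> j \in B :\: A ->
     F A j = G (j |: A) j) ->
  \sum_(A : {set I} | A \subset B) \sum_(j in B :\: A) F A j =
  \sum_(A : {set I} | A \subset B) \sum_(j in A) G A j.
Proof.
move=> FG; rewrite (pair_big_dep _ _ F) (pair_big_dep _ _ G) /=.
rewrite [RHS](reindex_onto (fun u => (u.2 |: u.1, u.2))
                           (fun u => (u.1 :\ u.2, u.2))) /=; last first.
  by case=> A j /= /andP[_ jA]; rewrite setD1K.
apply: eq_big => [[A j]|[A j] /andP[]] /=; last exact: FG.
rewrite !inE eqxx orTb andbT subUset sub1set xpair_eqE eqxx andbT.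
case: (boolP (j \in A)) => jA /=; last by rewrite setU1K // eqxx andbT andbC.
rewrite andbF; apply/esym/negbTE; apply: contraTN isT => /andP[_ /eqP E].
by move: jA; rewrite -E !inE eqxx.
Qed.

Section TwoSites.
Variables (K : fieldType) (V : lmodType K) (I : finType) (s : I -> K).
Hypothesis injs : injective s.

(** The variables in [A] sit at the first site. Only the zeros [al], [be] of the linear factors are
    kept, so that both orders of sites i and j are instances: (x j, x i - L i) with i first, (x i, x
    j - L j) with j first. *)
Definition two_site_term (al be : K) (B A : {set I}) : K :=
  (\prod_(i in A) (s i - al)) * (\prod_(j in B :\: A) (s j - be))
  * \prod_(i in A) \prod_(j in B :\: A) pair_factor (s i) (s j).

Definition two_site_sum (al be : K) (B : {set I}) (e : nat -> nat -> V) : V :=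
  \sum_(A : {set I} | A \subset B)
    two_site_term al be B A *: e #|A| #|B :\: A|.

Lemma pair_factorE (y z : K) : y != z -> pair_factor y z = 1 + 1 / (y - z).
Proof. by move=> yz; rewrite /pair_factor; field; rewrite subr_eq0. Qed.

Lemma pair_factorE' (y z : K) : y != z -> pair_factor y z = 1 + -1 / (z - y).
Proof. by move=> yz; rewrite /pair_factor; field; rewrite !subr_eq0 yz eq_sym yz. Qed.

(* Adding a variable b amounts to applying the operator
   (s b - al) (f (x) 1 + 1 (x) f) + ..., the algebraic Bethe ansatz recursion.
   Both cases, b at the first or at the second site, are expanded in partial
   fractions in s b; the polar parts cancel after moving the variable j from one
   site to the other. *)
Lemma two_site_sum_setU1 (al be : K) (b : I) (B : {set I})
    (e : nat -> nat -> V) : b \notin B ->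
  two_site_sum al be (b |: B) e =
  two_site_sum al be B (fun k l => (s b - al + l%:R) *: e k.+1 l
                                   + (s b - be - k%:R) *: e k l.+1).
Proof.
move=> bB; rewrite /two_site_sum big_subsetU1 //.
(* [c] and [d] are the residue products at s b = s j, for [b] at the first and at the second site;
   [F] and [G] are the resulting polar parts. *)
pose c (A : {set I}) j := \prod_(k in (B :\: A) :\ j) (1 + 1 / (s j - s k)).
pose d (A : {set I}) j := \prod_(k in A :\ j) (1 + -1 / (s j - s k)).
pose F (A : {set I}) j := (two_site_term al be B A * (c A j * ((s j - al) / (s b - s j))))
   *: e #|A|.+1 #|B :\: A|.
pose G (A : {set I}) j := (two_site_term al be B A * (d A j * ((s j - be) / (s b - s j))))
   *: e #|A| #|B :\: A|.+1.
have neb (j : I) : j \in B -> s b != s j.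
  by move=> jB; apply: contraNneq bB => /injs ->.
have FG (A : {set I}) j : A \subset B -> j \in B :\: A -> F A j = G (j |: A) j.
  move=> AB jBA; rewrite /F /G /c /d /two_site_term.
  have jA : j \notin A by move: jBA; rewrite inE => /andP[].
  have BjA : B :\: (j |: A) = (B :\: A) :\ j by rewrite setUC setDDl.
  rewrite BjA (setU1K jA) cardsU1 jA add1n (cardsD1 j (B :\: A)) jBA add1n.
  congr (_ *: _).
  rewrite !(big_setU1 _ jA) /= !(big_setD1 j jBA) /=.
  have -> : \prod_(i in A) \prod_(k in B :\: A) pair_factor (s i) (s k) =
     (\prod_(i in A) (1 + -1 / (s j - s i))) *
     \prod_(i in A) \prod_(k in (B :\: A) :\ j) pair_factor (s i) (s k).
    rewrite -big_split /=; apply: eq_bigr => i iA.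
    rewrite (big_setD1 j jBA) pair_factorE' //.
    by apply: contraNneq jA => /injs <-.
  have -> : \prod_(k in (B :\: A) :\ j) (1 + 1 / (s j - s k)) =
      \prod_(k in (B :\: A) :\ j) pair_factor (s j) (s k).
    apply: eq_bigr => k; rewrite !inE => /andP[kj _].
    by rewrite pair_factorE // (inj_eq injs) eq_sym.
  ring.
have X (A : {set I}) : A \subset B ->
   two_site_term al be (b |: B) (b |: A) *: e #|b |: A| #|(b |: B) :\: (b |: A)|
   = two_site_term al be B A *: ((s b - al + #|B :\: A|%:R) *: e #|A|.+1 #|B :\: A|)
     + \sum_(j in B :\: A) F A j.
  move=> AB; have bA : b \notin A by apply: contraNN bB; apply: (subsetP AB).
  have DE : (b |: B) :\: (b |: A) = B :\: A.
    rewrite setDUl -setDDl setDv set0D set0U setUC -setDDl.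
    by apply/setP => k; rewrite !inE; case: eqP => // ->; rewrite (negbTE bB) !andbF.
  rewrite -scaler_suml DE cardsU1 bA add1n scalerA -scalerDl; congr (_ *: _).
  rewrite /two_site_term DE !(big_setU1 _ bA) /=.
  have -> : \prod_(j in B :\: A) pair_factor (s b) (s j) =
            \prod_(j in B :\: A) (1 + 1 / (s b - s j)).
    by apply: eq_bigr => j /setDP[jB _]; rewrite pair_factorE ?neb.
  rewrite partial_fraction_prod_set //; last by move=> j /setDP[jB _]; apply: neb.
  (* The integer is turned into the sum of the [c A j], to be matched term by term with (s b - al) /
     (s b - s j) = 1 + (s j - al) / (s b - s j). *)
  rewrite -(@sum_prod_ratio_set _ _ s 1) //.
  set P1 := \prod_(i in A) (s i - al); set P2 := \prod_(j in _) _.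
  set P3 := \prod_(i in A) \prod_(_ in _) _.
  rewrite -mulr_sumr.
  transitivity (P1 * P2 * P3 * ((s b - al) * (1 +
    \sum_(j in B :\: A) 1 / (s b - s j) * c A j))); first by rewrite /c; ring.
  rewrite -mulrDr; congr (_ * _).
  rewrite mulrDr mulr1 -[RHS]addrA; congr (_ + _).
  rewrite mulr_sumr -big_split /=; apply: eq_bigr => j /setDP[jB _].
  rewrite /c; set cc := \prod_(_ in _) _; field.
  by rewrite subr_eq0 neb.
have Y (A : {set I}) : A \subset B ->
   two_site_term al be (b |: B) A *: e #|A| #|(b |: B) :\: A|
   = two_site_term al be B A *: ((s b - be - #|A|%:R) *: e #|A| #|B :\: A|.+1)
     - \sum_(j in A) G A j.
  move=> AB; have bA : b \notin A by apply: contraNN bB; apply: (subsetP AB).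
  have bBA : b \notin B :\: A by rewrite inE (negbTE bB) andbF.
  have DE : (b |: B) :\: A = b |: (B :\: A).
    rewrite setDUl; congr (_ :|: _).
    by apply/setP => k; rewrite !inE; case: eqP => [->|]; rewrite ?bA ?andbF.
  rewrite -scaler_suml DE cardsU1 bBA add1n scalerA -scalerBl; congr (_ *: _).
  rewrite /two_site_term DE !(big_setU1 _ bBA) /=.
  have -> : \prod_(i in A) \prod_(j in b |: (B :\: A)) pair_factor (s i) (s j)
          = (\prod_(i in A) (1 + -1 / (s b - s i))) *
            \prod_(i in A) \prod_(j in B :\: A) pair_factor (s i) (s j).
    rewrite -big_split; apply: eq_bigr => i iA; rewrite big_setU1 //=.
    by rewrite pair_factorE' // eq_sym neb // (subsetP AB).
  rewrite partial_fraction_prod_set //; last first.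
    by move=> j jA; apply: neb; apply: (subsetP AB).
  rewrite -(@sum_prod_ratio_set _ _ s (-1)) //.
  set P1 := \prod_(i in A) (s i - al); set P2 := \prod_(j in _) (s j - be).
  set P3 := \prod_(i in A) \prod_(j in B :\: A) pair_factor (s i) (s j).
  rewrite -mulr_sumr.
  transitivity (P1 * P2 * P3 * ((s b - be) * (1 +
    \sum_(j in A) -1 / (s b - s j) * d A j))); first by  rewrite /d; ring.
  rewrite -mulrBr; congr (_ * _).
  rewrite mulrDr mulr1 -[RHS]addrA; congr (_ + _).
  rewrite mulr_sumr -opprD -big_split -sumrN /=; apply: eq_bigr => j jA.
  rewrite /d; set cc := \prod_(_ in _) _; field.
  by rewrite subr_eq0 neb // (subsetP AB).
under eq_bigr => A AB do rewrite X // Y // addrACA -scalerDr.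
rewrite big_split /= sumrB (sum_subset_exchange FG) subrr addr0.
by [].
Qed.

End TwoSites.

(** * Values of rational functions *)

Lemma frac_reprE (D : idomainType) (q : {fraction D}) :
  q * tofrac \d_(repr q) = tofrac \n_(repr q).
Proof.
have d0 : \d_(repr q) != 0 := denom_ratioP _.
rewrite -{1}[q]reprK; unlock FracField.tofrac.
rewrite -[LHS]FracField.pi_mul /FracField.mulf.
apply/eqmodP => /=.
by rewrite FracField.equivfE !numden_Ratio ?mulr1 ?oner_neq0 // mulrC.
Qed.

Section FracEval.
Variables (K : fieldType) (c : K).
Local Notation F := {fraction {poly K}}.

(* q is regular at c and takes the value v there. *)
Definition frac_value (q : F) (v : K) : Prop :=
  exists u w : {poly K}, [/\ w.[c] != 0, q * tofrac w = tofrac u & v * w.[c] = u.[c]].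

(** The denominator in lowest terms divides every denominator of [q], by coprimality, so it cannot
    vanish at [c] if some denominator does not. *)
Lemma frac_valueE (q : F) (v : K) : frac_value q v -> frac_eval q c = v.
Proof.
case=> a [b [bc qE vE]]; rewrite /frac_eval.
have := frac_reprE q; have := denom_ratioP (repr q).
set d := \d_(repr q); set m := \n_(repr q) => d0 qdE.
have E : m * b = a * d.
  by apply/eqP; rewrite -tofrac_eq !tofracM -qdE -qE mulrAC.
set g := gcdp m d.
have g0 : g != 0 by rewrite gcdp_eq0 negb_and d0 orbT.
have mE : m = m %/ g * g by rewrite divpK // dvdp_gcdl.
have dE : d = d %/ g * g by rewrite divpK // dvdp_gcdr.
have cop : coprimep (m %/ g) (d %/ g).
  by apply: coprimep_div_gcd; rewrite d0 orbT.
have E' : m %/ g * b = a * (d %/ g).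
  by apply: (mulIf g0); rewrite mulrAC -mE -mulrA -dE.
have db : d %/ g %| b.
  have <- : (d %/ g %| m %/ g * b) = (d %/ g %| b).
    by apply: Gauss_dvdpr; rewrite coprimep_sym.
  by rewrite E' dvdp_mull.
have dc : (d %/ g).[c] != 0.
  have /dvdpP[h bE] := db.
  by move: bc; rewrite bE hornerM mulf_eq0 negb_or => /andP[].
apply: (mulIf dc); rewrite divfK //; apply: (mulIf bc).
by rewrite -hornerM E' hornerM -vE mulrAC.
Qed.

Lemma frac_valueD q1 v1 q2 v2 :
  frac_value q1 v1 -> frac_value q2 v2 -> frac_value (q1 + q2) (v1 + v2).
Proof.
move=> [u1 [w1 [c1 E1 F1]]] [u2 [w2 [c2 E2 F2]]].
exists (u1 * w2 + u2 * w1), (w1 * w2); split.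
- by rewrite hornerM mulf_neq0.
- by rewrite tofracD !tofracM -E1 -E2; ring.
by rewrite ?hornerD !hornerM -F1 -F2; ring.
Qed.

Lemma frac_valueM q1 v1 q2 v2 :
  frac_value q1 v1 -> frac_value q2 v2 -> frac_value (q1 * q2) (v1 * v2).
Proof.
move=> [u1 [w1 [c1 E1 F1]]] [u2 [w2 [c2 E2 F2]]].
exists (u1 * u2), (w1 * w2); split.
- by rewrite hornerM mulf_neq0.
- by rewrite !tofracM -E1 -E2; ring.
by rewrite ?hornerD !hornerM -F1 -F2; ring.
Qed.

Lemma frac_value_poly (u : {poly K}) : frac_value (tofrac u) u.[c].
Proof.
by exists u, 1; split; rewrite ?tofrac1 -?polyC1 ?hornerC ?mulr1 ?oner_neq0.
Qed.

Lemma frac_valueV q v : v != 0 -> frac_value q v -> frac_value q^-1 v^-1.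
Proof.
move=> v0 [u [w [wc E Fv]]].
have uc : u.[c] != 0 by rewrite -Fv mulf_neq0.
have u0 : tofrac u != 0.
  by rewrite tofrac_eq0; apply: contraNneq uc => ->; rewrite horner0.
have q0 : q != 0 by apply: contraNneq u0 => q0; rewrite -E q0 mul0r.
by exists w, u; split; rewrite -?E -?Fv ?mulKf ?mulf_neq0.
Qed.

Lemma frac_valueX : frac_value (tofrac 'X) c.
Proof. by have := frac_value_poly 'X; rewrite hornerX. Qed.

Lemma frac_valueC (a : K) : frac_value (tofrac a%:P) a.
Proof. by have := frac_value_poly a%:P; rewrite hornerC. Qed.

Lemma frac_value_nat (k : nat) : frac_value k%:R k%:R.
Proof.
have := frac_valueC k%:R; by rewrite polyC_natr rmorph_nat.
Qed.

Lemma frac_value0 : frac_value 0 0.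
Proof. exact: (frac_value_nat 0). Qed.

Lemma frac_valueN q v : frac_value q v -> frac_value (- q) (- v).
Proof.
rewrite -(mulN1r q) -(mulN1r v); apply: frac_valueM.
have := frac_valueC (-1); by rewrite polyCN polyC1 rmorphN rmorph1.
Qed.

End FracEval.

(** * Linear maps given on the monomial basis *)

Section LinExt.
Variables (E : nzRingType) (n : nat) (V : lmodType E).

(** Same formula as [ext_basis] with an arbitrary target, so that it also covers maps from two
    tensor factors to n. *)
Definition lin_ext (g : 'X_{1..n} -> V) (v : {mpoly E[n]}) : V :=
  \sum_(q <- msupp v) v@_q *: g q.

Lemma lin_extwE (g : 'X_{1..n} -> V) d (v : {mpoly E[n]}) :
  (msize v <= d)%N -> lin_ext g v = \sum_(q : 'X_{1..n < d}) v@_q *: g q.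
Proof.
move=> le_pk; rewrite /lin_ext; pose I := 'X_{1..n < d}.
rewrite (big_mksub I) /=; first last.
- by move=> x /msize_mdeg_lt /leq_trans; apply.
- by rewrite msupp_uniq.
by rewrite big_rmcond //= => j /memN_msupp_eq0 ->; rewrite scale0r.
Qed.

Lemma lin_ext_is_linear (g : 'X_{1..n} -> V) : linear (lin_ext g).
Proof.
move=> a u v; pose d := maxn (msize (a *: u + v)) (maxn (msize u) (msize v)).
rewrite !(@lin_extwE g d) /d ?leq_max ?leqnn ?orbT //.
rewrite scaler_sumr -big_split; apply: eq_bigr => q _ /=.
by rewrite mcoeffD mcoeffZ scalerDl scalerA.
Qed.

HB.instance Definition _ (g : 'X_{1..n} -> V) :=
  GRing.isLinear.Build E {mpoly E[n]} V _ (lin_ext g) (lin_ext_is_linear g).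

Lemma lin_extX (g : 'X_{1..n} -> V) q : lin_ext g 'X_[q] = g q.
Proof. by rewrite /lin_ext msuppX big_seq1 mcoeffX eqxx scale1r. Qed.

(** Testing only on the support lets a homogeneous [v] pass its degree bound on to the monomials, as
    needed for relations valid in bounded degree. *)
Lemma mpoly_linear_ext (f g : {linear {mpoly E[n]} -> V}) (v : {mpoly E[n]}) :
  (forall q, q \in msupp v -> f 'X_[q] = g 'X_[q]) -> f v = g v.
Proof.
move=> fg; rewrite (mpolyE v) !linear_sum big_seq [RHS]big_seq.
by apply: eq_bigr => q qv; rewrite !linearZ /= fg.
Qed.

End LinExt.

Section Basis.
Variables (E : nzRingType) (n : nat).
Implicit Types (g : 'X_{1..n} -> {mpoly E[n]}) (v : {mpoly E[n]}) (q : 'X_{1..n}).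

HB.instance Definition _ g :=
  GRing.isLinear.Build E {mpoly E[n]} {mpoly E[n]} _ (ext_basis g)
    (lin_ext_is_linear g).

Lemma ext_basisX g q : ext_basis g 'X_[q] = g q.
Proof. exact: lin_extX. Qed.

HB.instance Definition _ (i : 'I_n) := GRing.Linear.copy (@f_at E n i)
  (ext_basis (fun q => 'X_[q + U_(i)])).
HB.instance Definition _ (L : E) (i : 'I_n) := GRing.Linear.copy (@h1_at E n L i)
  (ext_basis (fun q => (L - (q i)%:R) *: 'X_[q])).
HB.instance Definition _ (i : 'I_n) := GRing.Linear.copy (@h2_at E n i)
  (ext_basis (fun q => (q i)%:R *: 'X_[q])).

Lemma f_atX i q : f_at i 'X_[E, q] = 'X_[q + U_(i)].
Proof. exact: ext_basisX. Qed.
Lemma h1_atX L i q : h1_at L i 'X_[E, q] = (L - (q i)%:R) *: 'X_[q].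
Proof. exact: ext_basisX. Qed.
Lemma h2_atX i q : h2_at i 'X_[E, q] = (q i)%:R *: 'X_[q].
Proof. exact: ext_basisX. Qed.

Lemma mcoeff_diag (g : 'X_{1..n} -> E) v q :
  (ext_basis (fun q => g q *: 'X_[q]) v)@_q = v@_q * g q.
Proof.
rewrite /ext_basis raddf_sum /=.
under eq_bigr => m _ do rewrite !mcoeffZ mcoeffX.
have [qv|qv] := boolP (q \in msupp v).
  rewrite (bigD1_seq q) ?msupp_uniq //= eqxx mulr1 big1 ?addr0 // => m /negbTE ->.
  by rewrite !mulr0.
rewrite big_seq big1; last first.
  by move=> m mv; case: eqP mv => [->|_ _]; rewrite ?(negbTE qv) // !mulr0.
by rewrite (memN_msupp_eq0 qv) mul0r.
Qed.

Lemma mcoeff_h1 L i v q : (h1_at L i v)@_q = v@_q * (L - (q i)%:R).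
Proof. exact: mcoeff_diag. Qed.

Lemma mcoeff_h2 i v q : (h2_at i v)@_q = v@_q * (q i)%:R.
Proof. exact: mcoeff_diag. Qed.

Lemma mcoeff_f i v q :
  (f_at i v)@_q = if (0 < q i)%N then v@_(q - U_(i)) else 0.
Proof.
rewrite [in LHS](mpolyE v) [f_at i _]linear_sum raddf_sum /=.
under eq_bigr => m _ do rewrite [f_at i _]linearZ /= f_atX mcoeffZ mcoeffX.
case: ltnP => qi.
  have qE : q = (q - U_(i) + U_(i))%MM.
    by rewrite submK //; apply/mnm_lepP => k; rewrite mnm1E; case: eqP => // <-.
  rewrite [in RHS](mpolyE v) raddf_sum /=; apply: eq_bigr => m _.
  rewrite mcoeffZ mcoeffX {1}qE; congr (_ * (nat_of_bool _)%:R).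
  by apply/eqP/eqP => [/addIm|->].
rewrite big1 // => m _; case: eqP => [mq|_]; last by rewrite mulr0.
by move: qi; rewrite -mq mnmDE mnm1E eqxx addn1.
Qed.

End Basis.

(** * The intertwining relations of the R-matrix *)

Section Generators.
Variables (E : comNzRingType) (n : nat).
Implicit Types (v : {mpoly E[n]}) (q : 'X_{1..n}).

Definition f_sum (i j : 'I_n) v : {mpoly E[n]} := f_at i v + f_at j v.
(* f_in and f_out are the two sides of the second intertwining relation of
   R_(L_i, L_j)(c); f_in takes L := L_i and f_out takes L := L_j. *)
Definition f_in (L c : E) (i j : 'I_n) v : {mpoly E[n]} :=
  f_at i (h2_at j v) + f_at j (h1_at L i v - c *: v).
Definition f_out (L c : E) (i j : 'I_n) v : {mpoly E[n]} :=
  f_at i (h1_at L j v) + f_at j (h2_at i v - c *: v).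

Lemma f_sum_is_linear i j : linear (f_sum i j).
Proof. by move=> a u v; rewrite /f_sum !linearP /= !scalerDr addrACA. Qed.
HB.instance Definition _ i j :=
  GRing.isLinear.Build E {mpoly E[n]} {mpoly E[n]} _ (f_sum i j) (f_sum_is_linear i j).

Lemma f_in_is_linear L c i j : linear (f_in L c i j).
Proof.
pose h : {linear {mpoly E[n]} -> {mpoly E[n]}} :=
  (f_at i \o h2_at j) \+ (f_at j \o (h1_at L i \- (c \*: idfun))).
exact: (linearP h).
Qed.
HB.instance Definition _ L c i j :=
  GRing.isLinear.Build E {mpoly E[n]} {mpoly E[n]} _ (f_in L c i j) (f_in_is_linear L c i j).

Lemma f_out_is_linear L c i j : linear (f_out L c i j).
Proof.
pose h : {linear {mpoly E[n]} -> {mpoly E[n]}} :=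
  (f_at i \o h1_at L j) \+ (f_at j \o (h2_at i \- (c \*: idfun))).
exact: (linearP h).
Qed.
HB.instance Definition _ L c i j :=
  GRing.isLinear.Build E {mpoly E[n]} {mpoly E[n]} _ (f_out L c i j) (f_out_is_linear L c i j).

Lemma f_sumX i j q : f_sum i j 'X_[E, q] = 'X_[q + U_(i)] + 'X_[q + U_(j)].
Proof. by rewrite /f_sum !f_atX. Qed.

Lemma f_inX L c i j q : f_in L c i j 'X_[E, q] =
  (q j)%:R *: 'X_[q + U_(i)] + (L - (q i)%:R - c) *: 'X_[q + U_(j)].
Proof.
by rewrite /f_in h2_atX h1_atX -scalerBl !linearZ /= !f_atX.
Qed.

Lemma f_outX L c i j q : f_out L c i j 'X_[E, q] =
  (L - (q j)%:R) *: 'X_[q + U_(i)] + ((q i)%:R - c) *: 'X_[q + U_(j)].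
Proof.
by rewrite /f_out h2_atX h1_atX -scalerBl !linearZ /= !f_atX.
Qed.

End Generators.

Lemma frac_value_inj (K : fieldType) (c : K) (q : {fraction {poly K}}) v w :
  frac_value c q v -> frac_value c q w -> v = w.
Proof. by move=> /frac_valueE <- /frac_valueE <-. Qed.

Section Homog.
Variables (E : comNzRingType) (n : nat).

Lemma dhomog_f_at d i (v : {mpoly E[n]}) :
  v \is d.-homog for mdeg -> f_at i v \is d.+1.-homog for mdeg.
Proof.
move=> /dhomogP hv; rewrite /f_at /ext_basis big_seq; apply: rpred_sum => q qv.
by apply: rpredZ; rewrite dhomogX /= mdegD mdeg1 addn1 (hv q).
Qed.

Lemma dhomog_ext_basis d (g : 'X_{1..n} -> {mpoly E[n]}) (v : {mpoly E[n]}) :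
  (forall q, mdeg q = d -> g q \is d.-homog for mdeg) ->
  v \is d.-homog for mdeg -> ext_basis g v \is d.-homog for mdeg.
Proof.
move=> hg /dhomogP hv; rewrite /ext_basis big_seq; apply: rpred_sum => q qv.
by apply: rpredZ; apply: hg; apply: hv.
Qed.

Lemma dhomog_h1_at d L i (v : {mpoly E[n]}) :
  v \is d.-homog for mdeg -> h1_at L i v \is d.-homog for mdeg.
Proof.
by apply: dhomog_ext_basis => q qd; apply: rpredZ; rewrite dhomogX /= qd.
Qed.

Lemma dhomog_h2_at d i (v : {mpoly E[n]}) :
  v \is d.-homog for mdeg -> h2_at i v \is d.-homog for mdeg.
Proof.
by apply: dhomog_ext_basis => q qd; apply: rpredZ; rewrite dhomogX /= qd.
Qed.

Lemma dhomog_f_sum d i j (v : {mpoly E[n]}) :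
  v \is d.-homog for mdeg -> f_sum i j v \is d.+1.-homog for mdeg.
Proof. by move=> hv; rewrite rpredD ?dhomog_f_at. Qed.

Lemma dhomog_f_out d L c i j (v : {mpoly E[n]}) :
  v \is d.-homog for mdeg -> f_out L c i j v \is d.+1.-homog for mdeg.
Proof.
by move=> hv; rewrite rpredD ?dhomog_f_at ?rpredB ?rpredZ ?dhomog_h1_at ?dhomog_h2_at.
Qed.

End Homog.

(** * Regularity and values of the R-matrix at a point *)

Section Evaluation.
Variables (K : fieldType) (L1 L2 c : K) (R : tensor2_end K).
Hypothesis hR : is_Rmatrix L1 L2 R.
Variable N : nat.
Hypothesis hc : forall b : nat, (b < N)%N -> L1 - b%:R - c != 0.
Local Notation F := {fraction {poly K}}.
Local Notation i1 := (ord0 : 'I_2).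
Local Notation i2 := (ord_max : 'I_2).
Local Notation z := (tofrac 'X : F).
Local Notation l1 := (tofrac L1%:P : F).
Local Notation l2 := (tofrac L2%:P : F).

Definition vec_value (u : {mpoly F[2]}) (v : {mpoly K[2]}) : Prop :=
  forall t, frac_value c u@_t v@_t.

Lemma vec_valueD u1 v1 u2 v2 :
  vec_value u1 v1 -> vec_value u2 v2 -> vec_value (u1 + u2) (v1 + v2).
Proof. by move=> h1 h2 t; rewrite !mcoeffD; apply: frac_valueD. Qed.

Lemma vec_valueZ a b u v :
  frac_value c a b -> vec_value u v -> vec_value (a *: u) (b *: v).
Proof. by move=> h1 h2 t; rewrite !mcoeffZ; apply: frac_valueM. Qed.

Lemma vec_valueB u1 v1 u2 v2 :
  vec_value u1 v1 -> vec_value u2 v2 -> vec_value (u1 - u2) (v1 - v2).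
Proof.
by move=> h1 h2 t; rewrite !mcoeffB; apply/frac_valueD/frac_valueN.
Qed.

Lemma vec_value_f i u v : vec_value u v -> vec_value (f_at i u) (f_at i v).
Proof.
by move=> h t; rewrite !mcoeff_f; case: ifP => _ //; apply: frac_value0.
Qed.

Lemma vec_value_h1 i a b u v : frac_value c a b ->
  vec_value u v -> vec_value (h1_at a i u) (h1_at b i v).
Proof.
move=> h1 h2 t; rewrite !mcoeff_h1; apply: frac_valueM => //.
by apply/frac_valueD/frac_valueN/frac_value_nat.
Qed.

Lemma vec_value_h2 i u v : vec_value u v -> vec_value (h2_at i u) (h2_at i v).
Proof.
by move=> h t; rewrite !mcoeff_h2; apply: frac_valueM => //; apply: frac_value_nat.
Qed.

Lemma vec_value_f_sum i j u v :
  vec_value u v -> vec_value (f_sum i j u) (f_sum i j v).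
Proof. by move=> h; apply: vec_valueD; apply: vec_value_f. Qed.

Lemma vec_value_f_out i j u v :
  vec_value u v -> vec_value (f_out l2 z i j u) (f_out L2 c i j v).
Proof.
move=> h; apply: vec_valueD; apply: vec_value_f.
  by apply: vec_value_h1 => //; apply: frac_valueC.
apply: vec_valueB; first exact: vec_value_h2.
by apply: vec_valueZ => //; apply: frac_valueX.
Qed.

Definition weight2 k l : 'X_{1..2} := (U_(i1) *+ k + U_(i2) *+ l)%MM.

Lemma weight2_1 k l : (weight2 k l + U_(i1))%MM = weight2 k.+1 l.
Proof. by apply/mnmP => i; rewrite !(mnmDE, mulmnE, mnm1E) mulnS; lia. Qed.
Lemma weight2_2 k l : (weight2 k l + U_(i2))%MM = weight2 k l.+1.
Proof. by apply/mnmP => i; rewrite !(mnmDE, mulmnE, mnm1E) mulnS; lia. Qed.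
Lemma weight2E1 k l : weight2 k l i1 = k.
Proof. by rewrite !(mnmDE, mulmnE, mnm1E) /=; lia. Qed.
Lemma weight2E2 k l : weight2 k l i2 = l.
Proof. by rewrite !(mnmDE, mulmnE, mnm1E) /=; lia. Qed.

Let u k l : {mpoly F[2]} := R 'X_[weight2 k l].

Definition Rvec k l : {mpoly K[2]} :=
  \sum_(t <- msupp (u k l)) frac_eval (u k l)@_t c *: 'X_[t].

Lemma R_f_sum k l : u k.+1 l + u k l.+1 = f_sum i1 i2 (u k l).
Proof.
case: hR => + _ _ => /(_ 'X_[weight2 k l]).
by rewrite !f_atX weight2_1 weight2_2 raddfD.
Qed.

Lemma R_f_in k l :
  l%:R *: u k.+1 l + (l1 - k%:R - z) *: u k l.+1 = f_out l2 z i1 i2 (u k l).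
Proof.
case: hR => _ + _ => /(_ 'X_[weight2 k l]).
rewrite -[X in R X]/(f_in l1 z i1 i2 _) f_inX weight2_1 weight2_2 weight2E1 weight2E2.
by rewrite linearD !(linearZZ R).
Qed.

(* This recursion determines R, and shows that its only possible poles are at
   z = L1 - b. *)
Lemma R_step k l : (l1 - (k + l)%:R - z) *: u k l.+1 =
  f_out l2 z i1 i2 (u k l) - l%:R *: f_sum i1 i2 (u k l).
Proof.
rewrite -R_f_in -R_f_sum scalerDr opprD addrACA subrr add0r -scalerBl.
by congr (_ *: _); rewrite natrD; ring.
Qed.

Lemma frac_value_den b :
  frac_value c (l1 - b%:R - z) (L1 - b%:R - c).
Proof.
apply/frac_valueD/frac_valueN/frac_valueX.
by apply/frac_valueD/frac_valueN/frac_value_nat; apply: frac_valueC.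
Qed.

Lemma frac_den_neq0 b : (b < N)%N -> l1 - b%:R - z != 0.
Proof.
move=> /hc; apply: contraNneq => E; have := frac_value_den b; rewrite E => h.
apply/eqP; exact: frac_value_inj h (frac_value0 c).
Qed.

(** [R_step] raises the second index and divides by a function not vanishing at [c]; the relation
    for [f_sum] then gives the vectors with second index 0. *)
Lemma R_value_exists k l : (k + l <= N)%N ->
  exists2 v, vec_value (u k l) v & v \is (k + l).-homog for mdeg.
Proof.
have [d] := ubnP (k + l); elim: d k l => // d IH k l; rewrite ltnS => kld klN.
(* Isolated because the case (k + 1, 0) also needs the vector (k, 1) of the same total degree, which
   the induction hypothesis does not reach. *)
have step k' l' : (k' + l' < N)%N -> (k' + l' < d)%N ->
  exists2 v, vec_value (u k' l'.+1) v & v \is (k' + l').+1.-homog for mdeg.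
  move=> kN kd; have [v hv dv] := IH k' l' kd (ltnW kN).
  exists ((L1 - (k' + l')%:R - c)^-1 *: (f_out L2 c i1 i2 v - l'%:R *: f_sum i1 i2 v)).
    rewrite -[u k' _](scalerK (frac_den_neq0 kN)) R_step.
    apply: vec_valueZ; first by apply: frac_valueV; [exact: hc | exact: frac_value_den].
    apply: vec_valueB; first exact: vec_value_f_out.
    by apply: vec_valueZ; [exact: frac_value_nat | exact: vec_value_f_sum].
  by rewrite rpredZ // rpredB ?rpredZ ?dhomog_f_out ?dhomog_f_sum.
case: l => [|l] in kld klN *; last first.
  by rewrite addnS in kld klN *; apply: step.
case: k => [|k] in kld klN *.
  exists 'X_[0%MM]; last by rewrite dhomogX /= mdeg0.
  have -> : u 0 0 = 'X_[0%MM].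
    case: hR => _ _; rewrite /u; congr (R 'X_[_] = _).
    by apply/mnmP => i; rewrite !(mnmDE, mulmnE, mnm0E) !muln0.
  move=> t; rewrite !mcoeffX; exact: frac_value_nat.
rewrite addn0 in kld klN *.
have [v hv dv] := IH k 0%N ltac:(lia) ltac:(lia).
have [w hw dw] := step k 0%N ltac:(lia) ltac:(lia).
rewrite addn0 in dv dw; exists (f_sum i1 i2 v - w).
  have -> : u k.+1 0 = f_sum i1 i2 (u k 0) - u k 1 by rewrite -R_f_sum addrK.
  by apply: vec_valueB => //; apply: vec_value_f_sum.
by rewrite rpredB ?dhomog_f_sum.
Qed.

(** Relations over K(z) pass to values this way: both sides are values of the same vector. *)
Lemma vec_value_inj w v v' : vec_value w v -> vec_value w v' -> v = v'.
Proof. by move=> h h'; apply/mpolyP => t; apply: frac_value_inj (h t) (h' t). Qed.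

Lemma Rvec_spec k l : (k + l <= N)%N ->
  vec_value (u k l) (Rvec k l) /\ Rvec k l \is (k + l).-homog for mdeg.
Proof.
move=> /R_value_exists[v hv dv]; suff -> : Rvec k l = v by [].
apply/mpolyP => t; rewrite /Rvec raddf_sum /=.
under eq_bigr => m _ do rewrite mcoeffZ mcoeffX (frac_valueE (hv m)).
have [tu|tu] := boolP (t \in msupp (u k l)).
  rewrite (bigD1_seq t) ?msupp_uniq //= eqxx mulr1 big1 ?addr0 // => m /negbTE ->.
  by rewrite mulr0.
rewrite big_seq big1; last first.
  by move=> m mv; case: eqP mv => [->|_ _]; rewrite ?(negbTE tu) // !mulr0.
apply: frac_value_inj (hv t); rewrite (memN_msupp_eq0 tu); exact: frac_value0.
Qed.

Lemma Rvec_homog k l : (k + l <= N)%N -> Rvec k l \is (k + l).-homog for mdeg.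
Proof. by case/Rvec_spec. Qed.

Lemma Rvec0 : Rvec 0 0 = 'X_[0%MM].
Proof.
have [//|h _] := @Rvec_spec 0 0; apply: vec_value_inj h _.
case: hR => _ _ h0; have -> : u 0 0 = 'X_[0%MM].
  rewrite -[RHS]h0 /u; congr (R 'X_[_]).
  by apply/mnmP => i; rewrite !(mnmDE, mulmnE, mnm0E) !muln0.
move=> t; rewrite !mcoeffX; exact: frac_value_nat.
Qed.

Lemma Rvec_f_sum k l : (k + l < N)%N ->
  Rvec k.+1 l + Rvec k l.+1 = f_sum i1 i2 (Rvec k l).
Proof.
move=> kl; apply: (@vec_value_inj (f_sum i1 i2 (u k l))).
  rewrite -R_f_sum; apply: vec_valueD; first by case: (@Rvec_spec k.+1 l).
  by case: (@Rvec_spec k l.+1); rewrite ?addnS.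
by apply: vec_value_f_sum; case: (@Rvec_spec k l) => //; apply: ltnW.
Qed.

Lemma Rvec_f_in k l : (k + l < N)%N ->
  l%:R *: Rvec k.+1 l + (L1 - k%:R - c) *: Rvec k l.+1 = f_out L2 c i1 i2 (Rvec k l).
Proof.
move=> kl; apply: (@vec_value_inj (f_out l2 z i1 i2 (u k l))).
  rewrite -R_f_in; apply: vec_valueD; apply: vec_valueZ.
  - exact: frac_value_nat.
  - by case: (@Rvec_spec k.+1 l).
  - exact: frac_value_den.
  by case: (@Rvec_spec k l.+1); rewrite ?addnS.
by apply: vec_value_f_out; case: (@Rvec_spec k l) => //; apply: ltnW.
Qed.

End Evaluation.

HB.instance Definition _ (K : fieldType) (n : nat) (R : tensor2_end K) (i j : 'I_n) (c : K) :=
  GRing.Linear.copy (R_at R i j c) (ext_basis (fun q =>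
    let u := R 'X_[U_(ord0) *+ q i + U_(ord_max) *+ q j] in
    \sum_(t <- msupp u)
      frac_eval u@_t c *:
        'X_[[multinom (if k == i then t ord0
                       else if k == j then t ord_max else q k) | k < n]])).

(** * The R-matrix on two of n tensor factors *)

Section Embedding.
Variables (E : comNzRingType) (n : nat) (i j : 'I_n).
Hypothesis ij : i != j.

Definition put2 (q : 'X_{1..n}) (t : 'X_{1..2}) : 'X_{1..n} :=
  [multinom (if k == i then t ord0 else if k == j then t ord_max else q k) | k < n].

(** [q] matters only through its entries outside i and j, the spectator factors; hence the same
    embedding serves after raising [q] at i or j. *)
Definition embed2 (q : 'X_{1..n}) : {mpoly E[2]} -> {mpoly E[n]} :=
  lin_ext (fun t => 'X_[put2 q t]).
HB.instance Definition _ q := GRing.Linear.copy (embed2 q) (lin_ext (fun t => 'X_[put2 q t])).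

Lemma embed2X q t : embed2 q 'X_[t] = 'X_[put2 q t].
Proof. exact: lin_extX. Qed.

Lemma put2E q t k :
  put2 q t k = if k == i then t ord0 else if k == j then t ord_max else q k.
Proof. exact: mnmE. Qed.

Lemma put2_1 q t : put2 q (t + U_(ord0)) = (put2 q t + U_(i))%MM.
Proof.
apply/mnmP => k; rewrite mnmDE !put2E mnm1E (eq_sym i).
case: (k =P i) => [_|_]; first by rewrite mnmDE mnm1E.
by case: (k =P j) => [_|_]; rewrite ?mnmDE ?mnm1E ?addn0.
Qed.

Lemma put2_2 q t : put2 q (t + U_(ord_max)) = (put2 q t + U_(j))%MM.
Proof.
apply/mnmP => k; rewrite mnmDE !put2E mnm1E (eq_sym j).
case: (k =P i) => [->|_]; first by rewrite (negbTE ij) mnmDE mnm1E.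
by case: (k =P j) => [_|_]; rewrite ?mnmDE ?mnm1E ?addn0.
Qed.

Lemma put2i q t : put2 q t i = t ord0.
Proof. by rewrite mnmE eqxx. Qed.

Lemma put2j q t : put2 q t j = t ord_max.
Proof. by rewrite mnmE eq_sym (negbTE ij) eqxx. Qed.

Lemma put2_eq (q q' : 'X_{1..n}) : (forall k, k != i -> k != j -> q k = q' k) -> put2 q =1 put2 q'.
Proof.
by move=> qq' t; apply/mnmP => k; rewrite !mnmE; case: eqP => // /eqP ki; case: eqP => // /eqP kj; rewrite qq'.
Qed.

Lemma mdeg_put2 q t : (mdeg (put2 q t) + q i + q j = mdeg t + mdeg q)%N.
Proof.
have ji : j != i by rewrite eq_sym.
have D (m : 'X_{1..n}) :
    mdeg m = (m i + (m j + \sum_(k < n | (k != i) && (k != j)) m k))%N.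
  by rewrite mdegE (bigD1 i) //= (bigD1 j).
rewrite !D put2i put2j mdegE big_ord_recl big_ord1.
rewrite (eq_bigr q); last by move=> k /andP[ki kj]; rewrite put2E (negbTE ki) (negbTE kj).
rewrite (_ : lift _ _ = ord_max); last exact: val_inj.
move: (\sum_(k < n | _) q k)%N => s; lia.
Qed.

Lemma embed2_f_sum q v : embed2 q (f_sum ord0 ord_max v) = f_sum i j (embed2 q v).
Proof.
apply: (@mpoly_linear_ext _ _ _ (embed2 q \o f_sum ord0 ord_max) (f_sum i j \o embed2 q)) => t _ /=.
by rewrite embed2X !f_sumX linearD /= !embed2X put2_1 put2_2.
Qed.

Lemma embed2_f_out L c q v :
  embed2 q (f_out L c ord0 ord_max v) = f_out L c i j (embed2 q v).
Proof.
apply: (@mpoly_linear_ext _ _ _ (embed2 q \o f_out L c ord0 ord_max) (f_out L c i j \o embed2 q)) => t _ /=.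
by rewrite embed2X !f_outX linearD !(linearZZ (embed2 q)) /= !embed2X put2_1 put2_2 put2i put2j.
Qed.

Lemma embed2_homog q v d : v \is d.-homog for mdeg ->
  embed2 q v \is (d + (mdeg q - q i - q j)).-homog for mdeg.
Proof.
move=> /dhomogP hv; rewrite /embed2 /lin_ext big_seq; apply: rpred_sum => t tv.
apply: rpredZ; rewrite dhomogX /=.
have := mdeg_put2 q t; rewrite (hv _ tv) => E1.
have : (q i + q j <= mdeg q)%N.
  by rewrite mdegE (bigD1 i) //= (bigD1 j) 1?eq_sym //=; lia.
by lia.
Qed.

End Embedding.

Section SiteOperators.
Variables (K : fieldType) (n : nat) (i j : 'I_n) (Li Lj c : K) (R : tensor2_end K).
Hypotheses (ij : i != j) (hR : is_Rmatrix Li Lj R).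
Variable N : nat.
Hypothesis hc : forall b : nat, (b < N)%N -> Li - b%:R - c != 0.
Implicit Types (v : {mpoly K[n]}) (q : 'X_{1..n}).

Lemma R_atX q : R_at R i j c 'X_[q] = embed2 i j q (Rvec c R (q i) (q j)).
Proof.
rewrite [LHS]ext_basisX /Rvec [embed2 _ _ _ _]linear_sum /=; apply: eq_bigr => t _.
by rewrite (linearZZ (embed2 i j q)) /= embed2X.
Qed.

Lemma leq_mdeg2 q : (q i + q j <= mdeg q)%N.
Proof. by rewrite mdegE (bigD1 i) //= (bigD1 j) 1?eq_sym //=; lia. Qed.

Lemma R_at_homog d v : (d <= N)%N ->
  v \is d.-homog for mdeg -> R_at R i j c v \is d.-homog for mdeg.
Proof.
move=> dN; apply: dhomog_ext_basis => q qd.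
suff : R_at R i j c 'X_[q] \is d.-homog for mdeg by rewrite [R_at _ _ _ _ _]ext_basisX.
rewrite R_atX.
have le := leq_mdeg2 q.
have -> : d = (q i + q j + (mdeg q - q i - q j))%N by lia.
by apply: embed2_homog => //; apply: (Rvec_homog hR hc); lia.
Qed.

Lemma R_at_vac q : q i = 0%N -> q j = 0%N -> R_at R i j c 'X_[q] = 'X_[q].
Proof.
move=> qi qj; rewrite R_atX qi qj (Rvec0 hR hc) embed2X; congr 'X_[_].
by apply/mnmP => k; rewrite mnmE !mnm0E; case: eqP => [->//|_]; case: eqP => [->|].
Qed.

Lemma embed2_shift q l : l \in [:: i; j] -> embed2 i j (q + U_(l))%MM =1 @embed2 K n i j q.
Proof.
move=> lij v; rewrite /embed2 /lin_ext; apply: eq_bigr => t _; congr (_ *: 'X_[_]).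
apply: put2_eq => k ki kj; rewrite mnmDE mnm1E.
by move: lij; rewrite !inE => /orP[]/eqP ->; rewrite eq_sym ?(negbTE ki) ?(negbTE kj) addn0.
Qed.

Lemma R_at_f_sum d v : (d < N)%N -> v \is d.-homog for mdeg ->
  R_at R i j c (f_sum i j v) = f_sum i j (R_at R i j c v).
Proof.
move=> dN /dhomogP hv.
apply: (@mpoly_linear_ext _ _ _ (R_at R i j c \o f_sum i j) (f_sum i j \o R_at R i j c)) => q /hv qd /=.
have le := leq_mdeg2 q.
rewrite f_sumX linearD /= !R_atX !embed2_shift ?inE ?eqxx ?orbT //.
rewrite !mnmDE !mnm1E !eqxx (negbTE ij) eq_sym (negbTE ij) !addn0 !addn1.
rewrite -[LHS]linearD /= (Rvec_f_sum hR hc) ?embed2_f_sum //.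
by rewrite qd in le; lia.
Qed.

Lemma R_at_f_in d v : (d < N)%N -> v \is d.-homog for mdeg ->
  R_at R i j c (f_in Li c i j v) = f_out Lj c i j (R_at R i j c v).
Proof.
move=> dN /dhomogP hv.
apply: (@mpoly_linear_ext _ _ _ (R_at R i j c \o f_in Li c i j) (f_out Lj c i j \o R_at R i j c)) => q /hv qd /=.
have le := leq_mdeg2 q.
rewrite f_inX linearD !(linearZZ (R_at R i j c)) /= !R_atX !embed2_shift ?inE ?eqxx ?orbT //.
rewrite !mnmDE !mnm1E !eqxx (negbTE ij) eq_sym (negbTE ij) !addn0 !addn1.
rewrite -!(linearZZ (embed2 i j q)) -[LHS]linearD /= (Rvec_f_in hR hc) ?embed2_f_out //.
by rewrite qd in le; lia.
Qed.

End SiteOperators.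

(** * Inversion of the R-matrix *)

Section Inversion.
Variables (K : fieldType) (n : nat).

Lemma f_sumC (i j : 'I_n) (v : {mpoly K[n]}) : f_sum i j v = f_sum j i v.
Proof. exact: addrC. Qed.

(** The output of R_ij(c) is, up to a multiple of [f_sum], the input of R_ji(-c). Hence the
    composite of the two commutes with [f_sum] and with [f_in]. *)
Lemma f_outE (i j : 'I_n) (L c : K) (v : {mpoly K[n]}) :
  f_out L c i j v = f_in L (- c) j i v - c *: f_sum i j v.
Proof.
rewrite /f_out /f_in /f_sum !(linearB (f_at _)) /= !(linearZZ (f_at _)) /=.
rewrite scaleNr opprK scalerDr opprD.
move: (f_at i _) (f_at j _) (c *: f_at i _) (c *: f_at j _) => A B X Y.
by rewrite [B + (A + X)]addrA [RHS]addrA addrK [B + A]addrC -addrA.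
Qed.

Variables (i j : 'I_n) (Li Lj c : K) (R S : tensor2_end K).
Hypotheses (ij : i != j) (hR : is_Rmatrix Li Lj R) (hS : is_Rmatrix Lj Li S).
Variable N : nat.
Hypothesis hc : forall b : nat, (b < N)%N -> Li - b%:R - c != 0.
Hypothesis hc' : forall b : nat, (b < N)%N -> Lj - b%:R - - c != 0.
Local Notation RR := (R_at R i j c).
Local Notation SS := (R_at S j i (- c)).

Lemma R_at_inv_f_sum d v : (d < N)%N -> v \is d.-homog for mdeg ->
  SS (RR (f_sum i j v)) = f_sum i j (SS (RR v)).
Proof.
have ji : j != i by rewrite eq_sym.
move=> dN dv; have dRv := R_at_homog ij hR hc (ltnW dN) dv.
rewrite (R_at_f_sum ij hR hc dN dv) f_sumC.
rewrite (R_at_f_sum ji hS hc' dN dRv); exact: f_sumC.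
Qed.

Lemma R_at_inv_f_in d v : (d < N)%N -> v \is d.-homog for mdeg ->
  SS (RR (f_in Li c i j v)) = f_in Li c i j (SS (RR v)).
Proof.
have ji : j != i by rewrite eq_sym.
move=> dN dv; have dRv := R_at_homog ij hR hc (ltnW dN) dv.
rewrite (R_at_f_in ij hR hc dN dv) f_outE f_sumC.
rewrite (linearB SS) /= (linearZZ SS) /=.
rewrite (R_at_f_in ji hS hc' dN dRv) (R_at_f_sum ji hS hc' dN dRv).
by rewrite f_outE opprK scaleNr opprK addrK.
Qed.

(** The composite fixes the vectors with q_i = q_j = 0 and commutes with [f_sum] and [f_in], which
    generate the other basis vectors from these while the denominators are nonzero. *)
Lemma R_at_invX q : (mdeg q <= N)%N -> SS (RR 'X_[q]) = 'X_[q].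
Proof.
have ji : j != i by rewrite eq_sym.
have [d] := ubnP (q i + q j); elim: d q => // d IH q; rewrite ltnS => qd qN.
have step q' : (mdeg q' < N)%N -> (q' i + q' j < d)%N ->
    SS (RR 'X_[q' + U_(j)]) = 'X_[q' + U_(j)].
  move=> q'N q'd; have E := IH q' q'd (ltnW q'N).
  have dX : ('X_[q'] : {mpoly K[n]}) \is (mdeg q').-homog for mdeg by rewrite dhomogX.
  have den : Li - (q' i + q' j)%:R - c != 0.
    by apply: hc; apply: leq_ltn_trans q'N; apply: leq_mdeg2.
  (* Eliminating the vector raised at i leaves the denominator of the recursion as coefficient. *)
  have XE : (Li - (q' i + q' j)%:R - c) *: 'X_[q' + U_(j)] =
      f_in Li c i j 'X_[q'] - (q' j)%:R *: f_sum i j 'X_[q'] :> {mpoly K[n]}.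
    rewrite f_inX f_sumX scalerDr opprD addrACA subrr add0r -scalerBl.
    by congr (_ *: _); rewrite natrD; ring.
  apply: (scalerI den); rewrite -(linearZZ SS) -(linearZZ RR) /= XE.
  rewrite (linearB RR) (linearB SS) /= (linearZZ RR) (linearZZ SS) /=.
  by rewrite (R_at_inv_f_sum q'N dX) (R_at_inv_f_in q'N dX) E.
have [qj|qj] := posnP (q j); last first.
  have qE : q = (q - U_(j) + U_(j))%MM.
    by rewrite submK //; apply/mnm_lepP => k; rewrite mnm1E; case: eqP => // <-.
  have dE : mdeg q = (mdeg (q - U_(j))).+1 by rewrite {1}qE mdegD mdeg1 addn1.
  rewrite qE; apply: step; first by rewrite -dE.
  rewrite !mnmBE !mnm1E eqxx (negbTE ji); lia.
have [qi|qi] := posnP (q i).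
  by rewrite (R_at_vac hR hc) // (R_at_vac hS hc').
have qE : q = (q - U_(i) + U_(i))%MM.
  by rewrite submK //; apply/mnm_lepP => k; rewrite mnm1E; case: eqP => // <-.
set q' := (q - U_(i))%MM in qE.
have dE : mdeg q = (mdeg q').+1 by rewrite {1}qE mdegD mdeg1 addn1.
have q'd : (q' i + q' j < d)%N.
  by rewrite !mnmBE !mnm1E eqxx (negbTE ij); lia.
have q'N : (mdeg q' < N)%N by rewrite -dE.
have XE : 'X_[q] = f_sum i j 'X_[q'] - 'X_[q' + U_(j)] :> {mpoly K[n]}.
  by rewrite f_sumX -qE addrK.
rewrite XE (linearB RR) (linearB SS) /= step //.
rewrite (@R_at_inv_f_sum (mdeg q')) ?dhomogX //.
by rewrite IH // ltnW.
Qed.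

Lemma R_at_inj d v : (d <= N)%N -> v \is d.-homog for mdeg -> RR v = 0 -> v = 0.
Proof.
move=> dN /dhomogP hv Rv0; transitivity (SS (RR v)).
  apply/esym; apply: (@mpoly_linear_ext _ _ _ (SS \o RR) idfun) => q /hv /= qd.
  by apply: R_at_invX; rewrite qd.
by rewrite Rv0 linear0.
Qed.

End Inversion.

(** * Exchange of adjacent tensor factors *)

Section TwoSiteExchange.
Variables (K : fieldType) (n : nat) (I : finType) (s : I -> K) (x L : 'I_n -> K).
Variables (i j : 'I_n) (R : tensor2_end K).
Hypotheses (injs : injective s) (ij : i != j) (hR : is_Rmatrix (L i) (L j) R).
Variable N : nat.
Hypothesis hc : forall b : nat, (b < N)%N -> L i - b%:R - (x i - x j) != 0.
Local Notation RR := (R_at R i j (x i - x j)).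

Lemma eq_two_site_sum (V : lmodType K) al be (B : {set I}) (e e' : nat -> nat -> V) :
  (forall k l, (k + l)%N = #|B| -> e k l = e' k l) ->
  two_site_sum s al be B e = two_site_sum s al be B e'.
Proof.
move=> ee'; apply: eq_bigr => A AB; congr (_ *: _); apply: ee'.
by rewrite cardsD (setIidPr AB) subnKC // subset_leq_card.
Qed.

Lemma two_site_sum_linear (V W : lmodType K) (f : {linear V -> W}) al be (B : {set I}) e :
  two_site_sum s al be B (fun k l => f (e k l)) = f (two_site_sum s al be B e).
Proof. by rewrite linear_sum; apply: eq_bigr => A _; rewrite linearZ. Qed.

(** The operator adding a variable [t] in the order with j first. [R] carries (t - x j) [f_sum] +
    [f_in], which adds [t] in the order with i first, to it. *)
Definition creation (t : K) (v : {mpoly K[n]}) : {mpoly K[n]} :=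
  (t - x j) *: f_sum i j v + f_out (L j) (x i - x j) i j v.

Lemma creation_is_linear t : linear (creation t).
Proof.
pose h : {linear {mpoly K[n]} -> {mpoly K[n]}} :=
  ((t - x j) \*: f_sum i j) \+ f_out (L j) (x i - x j) i j.
exact: (linearP h).
Qed.
HB.instance Definition _ t :=
  GRing.isLinear.Build K {mpoly K[n]} {mpoly K[n]} _ (creation t) (creation_is_linear t).

(** Induction on the number of variables: [two_site_sum_setU1] makes both sides the image under the
    same [creation] operator of the sums over one variable less. On the right j is the first site,
    hence the exchange of [k] and [l]. *)
Lemma R_two_site_sum (q0 : 'X_{1..n}) (B : {set I}) :
  q0 i = 0%N -> q0 j = 0%N -> (mdeg q0 + #|B| <= N)%N ->
  two_site_sum s (x j) (x i - L i) B (fun k l => RR 'X_[q0 + U_(i) *+ k + U_(j) *+ l]) =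
  two_site_sum s (x i) (x j - L j) B (fun k l => 'X_[q0 + U_(i) *+ l + U_(j) *+ k]).
Proof.
move=> q0i q0j; have ji : j != i by rewrite eq_sym.
have [d] := ubnP #|B|; elim: d B => // d IH B; rewrite ltnS => Bd BN.
have [->|/set0Pn[b bB]] := eqVneq B set0.
  rewrite /two_site_sum !(big_pred1 set0) => [|A|A]; try exact: subset0.
  rewrite !setDv !cards0 !mulm0n !addm0 (R_at_vac hR hc) //.
  by rewrite /two_site_term !setDv !big_set0.
have [B' bB' BE] : exists2 B' : {set I}, b \notin B' & B = b |: B'.
  by exists (B :\ b); rewrite ?setD1K // !inE eqxx.
rewrite {}BE {bB B} in Bd BN *; rewrite cardsU1 bB' add1n in Bd BN.
have {}IH := IH B' Bd ltac:(lia).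
rewrite !two_site_sum_setU1 //.
transitivity (creation (s b) (two_site_sum s (x j) (x i - L i) B'
   (fun k l => RR 'X_[q0 + U_(i) *+ k + U_(j) *+ l]))).
  rewrite -two_site_sum_linear; apply: eq_two_site_sum => k l kl.
  set q := (q0 + U_(i) *+ k + U_(j) *+ l)%MM.
  have -> : (q0 + U_(i) *+ k.+1 + U_(j) *+ l)%MM = (q + U_(i))%MM.
    by apply/mnmP => m; rewrite !(mnmDE, mulmnE) mulnS; lia.
  have -> : (q0 + U_(i) *+ k + U_(j) *+ l.+1)%MM = (q + U_(j))%MM.
    by apply/mnmP => m; rewrite !(mnmDE, mulmnE) mulnS; lia.
  have qi : q i = k by rewrite !(mnmDE, mulmnE, mnm1E) eqxx q0i (negbTE ji); lia.
  have qj : q j = l by rewrite !(mnmDE, mulmnE, mnm1E) eqxx q0j (negbTE ij); lia.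
  have qd : (mdeg q < N)%N.
    by rewrite /q !mdegD !mdegMn !mdeg1 !mul1n -addnA kl; lia.
  have dX : ('X_[q] : {mpoly K[n]}) \is (mdeg q).-homog for mdeg by rewrite dhomogX.
  rewrite /= /creation -(R_at_f_sum ij hR hc qd dX) -(R_at_f_in ij hR hc qd dX).
  rewrite f_sumX f_inX !(linearD RR) /= !(linearZZ RR) /= qi qj.
  rewrite scalerDr addrACA -!scalerDl; congr (_ *: _ + _ *: _); ring.
rewrite IH -two_site_sum_linear; apply: eq_two_site_sum => k l kl.
set q := (q0 + U_(i) *+ l + U_(j) *+ k)%MM.
have -> : (q0 + U_(i) *+ l.+1 + U_(j) *+ k)%MM = (q + U_(i))%MM.
  by apply/mnmP => m; rewrite !(mnmDE, mulmnE) mulnS; lia.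
have -> : (q0 + U_(i) *+ l + U_(j) *+ k.+1)%MM = (q + U_(j))%MM.
  by apply/mnmP => m; rewrite !(mnmDE, mulmnE) mulnS; lia.
have qi : q i = l by rewrite !(mnmDE, mulmnE, mnm1E) eqxx q0i (negbTE ji); lia.
have qj : q j = k by rewrite !(mnmDE, mulmnE, mnm1E) eqxx q0j (negbTE ij); lia.
rewrite /= /creation f_sumX f_outX qi qj scalerDr addrACA -!scalerDl addrC.
congr (_ *: _ + _ *: _); ring.
Qed.

End TwoSiteExchange.

(** * Weight functions as sums over maps to sites *)

Section WeightFunctions.
Variables (K : fieldType) (n : nat) (I : finType).

Definition site_factor (lt : rel 'I_n) (x L : 'I_n -> K) (y : K) (i k : 'I_n) : K :=
  if lt k i then y - x k + L k else if k == i then 1 else y - x k.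

(* Grouping the permutations of the weight function by the map g sending each
   variable to its site removes the factorials r_1! ... r_n!, so that this
   formula makes sense in characteristic p even when r >= p. The order lt is the
   order of the tensor factors. *)
Definition weight_term (lt : rel 'I_n) (s : I -> K) (x L : 'I_n -> K)
    (g : {ffun I -> 'I_n}) : K :=
  (\prod_v \prod_k site_factor lt x L (s v) (g v) k) *
  \prod_v \prod_w (if lt (g v) (g w) then pair_factor (s v) (s w) else 1).

Definition fiber_count (g : {ffun I -> 'I_n}) : 'X_{1..n} :=
  [multinom #|[set v | g v == k]| | k < n].

Definition weight_sum (lt : rel 'I_n) (s : I -> K) (x L : 'I_n -> K) : {mpoly K[n]} :=
  \sum_g weight_term lt s x L g *: 'X_[fiber_count g].

Lemma fiber_countE g : fiber_count g = (\sum_v U_(g v))%MM.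
Proof.
apply/mnmP => k; rewrite mnmE mnm_sumE.
under eq_bigr do rewrite mnm1E.
by rewrite -sum1_card -big_mkcond; apply: eq_bigl => v; rewrite inE.
Qed.

Lemma mdeg_fiber_count g : mdeg (fiber_count g) = #|I|.
Proof.
rewrite fiber_countE mdeg_sum -sum1_card; apply: eq_bigr => v _; exact: mdeg1.
Qed.

Lemma eq_weight_sum (lt lt' : rel 'I_n) s s' x x' L :
  (forall i j, lt i j = lt' i j) -> s =1 s' -> x =1 x' ->
  weight_sum lt s x L = weight_sum lt' s' x' L.
Proof.
move=> E Es Ex; apply: eq_bigr => g _; congr (_ *: _); congr (_ * _).
  by do 2!apply: eq_bigr => ? _; rewrite /site_factor E Ex Es.
by do 2!apply: eq_bigr => ? _; rewrite E !Es.
Qed.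

Lemma weight_sum_homog lt s x L : weight_sum lt s x L \is #|I|.-homog for mdeg.
Proof.
by apply: rpred_sum => g _; apply: rpredZ; rewrite dhomogX /= mdeg_fiber_count.
Qed.

Section Exchange.
Variables (lt lt' : rel 'I_n) (s : I -> K) (x L : 'I_n -> K) (i j : 'I_n).
Variable R : tensor2_end K.
Hypotheses (injs : injective s) (ij : i != j) (hR : is_Rmatrix (L i) (L j) R).
Hypothesis hc : forall b : nat, (b < #|I|)%N -> L i - b%:R - (x i - x j) != 0.
Hypotheses (lt_ij : lt i j) (lt_ji : lt j i = false).
Hypotheses (lt_ii : lt i i = false) (lt_jj : lt j j = false).
Hypotheses (lt'_ij : lt' i j = false) (lt'_ji : lt' j i).
Hypotheses (lt'_ii : lt' i i = false) (lt'_jj : lt' j j = false).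
Hypothesis lt_other : forall k l,
  ~~ ((k \in pred2 i j) && (l \in pred2 i j)) -> lt' k l = lt k l.
Hypothesis lt_adj : forall k, k \notin pred2 i j ->
  lt k j = lt k i /\ lt j k = lt i k.

(* The maps g are grouped by their merging of j into i; such a group is
   indexed by the subsets A of the fiber over i. *)
Definition merge_sites (g : {ffun I -> 'I_n}) : {ffun I -> 'I_n} :=
  [ffun v => if g v == j then i else g v].
Definition split_sites (g : {ffun I -> 'I_n}) (A : {set I}) : {ffun I -> 'I_n} :=
  [ffun v => if (g v == i) && (v \notin A) then j else g v].

Lemma sum_merge_sites (V : nmodType) (F : {ffun I -> 'I_n} -> V) :
  \sum_g F g =
  \sum_(g : {ffun I -> 'I_n} | [forall v, g v != j])
    \sum_(A : {set I} | A \subset [set v | g v == i]) F (split_sites g A).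
Proof.
have ji : j != i by rewrite eq_sym.
rewrite (partition_big merge_sites (fun g : {ffun I -> 'I_n} => [forall v, g v != j])) /=; last first.
  move=> g _; apply/forallP => v; rewrite ffunE; by case: ifP => // /negbT.
apply: eq_bigr => g /forallP gj.
rewrite (reindex_onto (split_sites g) (fun h => [set v | h v == i])) /=; last first.
  move=> h /eqP <-; apply/ffunP => v; rewrite !ffunE !inE.
  case: (h v =P j) => [->|/eqP hj]; first by rewrite eqxx ji.
  by case: eqP.
apply: eq_bigl => A; apply/idP/idP.
  move=> /andP[_ /eqP <-]; apply/subsetP => v; rewrite !inE !ffunE.
  by case: ifP => // _; rewrite (negbTE ji).
move=> /subsetP AB; apply/andP; split; apply/eqP.
  apply/ffunP => v; rewrite !ffunE; have := gj v.
  by case: (g v =P i) => [->|_] /=; case: ifP => // /eqP; rewrite ?eqxx //;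
     case: ifP => // _ -> //; rewrite eqxx.
apply/setP => v; rewrite !inE !ffunE.
case: (boolP (v \in A)) => [/AB|vA]; first by rewrite inE andbF.
by rewrite andbT; case: ifP => [_|->] //; rewrite (negbTE ji).
Qed.

Section Split.
Variable g : {ffun I -> 'I_n}.
Hypothesis gj : forall v, g v != j.
Local Notation B := [set v | g v == i].

Definition common_factor : K :=
  (\prod_v \prod_(k | ~~ ((v \in B) && (k \in pred2 i j)))
      site_factor lt x L (s v) (g v) k) *
  \prod_v \prod_w (if (v \in B) && (w \in B) then 1
                   else if lt (g v) (g w) then pair_factor (s v) (s w) else 1).

Lemma split_siteE (A : {set I}) v : A \subset B ->
  split_sites g A v = if v \in A then i else if v \in B then j else g v.
Proof.
move=> /subsetP AB; rewrite ffunE inE.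
case: (boolP (v \in A)) => [/AB|_]; first by rewrite inE andbF => /eqP.
by rewrite andbT.
Qed.

Lemma split_fiber_count (A : {set I}) : A \subset B ->
  fiber_count (split_sites g A) =
  ([multinom (if k == i then 0 else fiber_count g k)%N | k < n]
   + U_(i) *+ #|A| + U_(j) *+ #|B :\: A|)%MM.
Proof.
have ji : j != i by rewrite eq_sym.
move=> AB; apply/mnmP => k; rewrite !mnmDE !mulmnE !mnm1E !mnmE.
case: (k =P i) => [->|/eqP ki].
  rewrite eqxx (negbTE ji) mul0n addn0 mul1n; apply: eq_card => v.
  rewrite !inE split_siteE //; case: ifP => // _; first by rewrite eqxx.
  by case: ifP => [_|]; [rewrite (negbTE ji) | rewrite inE].
rewrite eq_sym (negbTE ki) mul0n addn0; case: (j =P k) => [<-|/eqP jk].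
  rewrite mul1n [X in (X + _)%N]eq_card0 ?add0n; last first.
    by move=> v; rewrite !inE (negbTE (gj v)).
  apply: eq_card => v; rewrite !inE split_siteE // inE.
  by case: ifP => _; [rewrite (negbTE ij) | case: ifP; rewrite ?eqxx ?(negbTE (gj v))].
rewrite mul0n addn0; apply: eq_card => v; rewrite !inE split_siteE // inE.
case: ifP => [/(subsetP AB)|_]; first by rewrite inE => /eqP ->.
by case: ifP => // /eqP ->; rewrite (negbTE jk) eq_sym (negbTE ki).
Qed.

(** Ensures that spectators and moved variables together stay within the degree bound. *)
Lemma merged_count_mdeg :
  (mdeg [multinom (if k == i then 0 else fiber_count g k)%N | k < n] + #|B| = #|I|)%N.
Proof.
rewrite -(mdeg_fiber_count g) !mdegE (bigD1 i) //= [in RHS](bigD1 i) //= !mnmE eqxx add0n addnC.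
by congr (_ + _)%N; apply: eq_bigr => k /negbTE ki; rewrite !mnmE ki.
Qed.

(* The orders lt and lt' give the same prefactor: i and j are adjacent in both,
   so a variable attached to another site cannot tell them apart. *)
Lemma prod_two_sites (mu : rel 'I_n) (al be : K -> K) (A : {set I}) :
  (forall k l, ~~ ((k \in pred2 i j) && (l \in pred2 i j)) -> mu k l = lt k l) ->
  (forall y, site_factor mu x L y i i * site_factor mu x L y i j = al y) ->
  (forall y, site_factor mu x L y j i * site_factor mu x L y j j = be y) ->
  A \subset B ->
  \prod_v \prod_k site_factor mu x L (s v) (split_sites g A v) k =
  (\prod_v \prod_(k | ~~ ((v \in B) && (k \in pred2 i j)))
      site_factor lt x L (s v) (g v) k) *
  ((\prod_(v in A) al (s v)) * \prod_(v in B :\: A) be (s v)).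
Proof.
move=> mu_lt hal hbe AB; have ji : j != i by rewrite eq_sym.
have -> : (\prod_(v in A) al (s v)) * \prod_(v in B :\: A) be (s v) =
  \prod_v (if v \in B then if v \in A then al (s v) else be (s v) else 1).
  rewrite -big_mkcond /= [RHS](bigID (fun v => v \in A)) /=; congr (_ * _).
    apply: eq_big => [v|v ->//]; case: (boolP (v \in A)) => [vA|]; last by rewrite andbF.
    by rewrite andbT (subsetP AB).
  apply: eq_big => [v|v]; first by rewrite !inE andbC.
  by rewrite inE => /andP[/negbTE ->].
rewrite -big_split; apply: eq_bigr => v _ /=.
rewrite split_siteE //.
case: (boolP (v \in B)) => vB; last first.
  have -> : (v \in A) = false by apply: contraNF vB; apply: (subsetP AB).
  rewrite mulr1; apply: eq_big => // k _; rewrite /site_factor mu_lt //.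
  by rewrite !inE negb_and in vB *; rewrite (negbTE vB) (negbTE (gj v)) orbT.
have gv : g v = i by move: vB; rewrite inE => /eqP.
rewrite (bigID (fun k => k \in pred2 i j)) /= mulrC; congr (_ * _).
  apply: eq_bigr => k kij; rewrite gv /site_factor.
  have := lt_adj kij; have : k \notin pred2 i j := kij.
  rewrite !inE negb_or => /andP[/negbTE ki /negbTE kj] [E1 E2].
  by case: (v \in A); rewrite mu_lt ?inE ?ki ?kj // ?E1.
rewrite (bigD1 i) ?inE ?eqxx //= (bigD1 j) ?inE ?eqxx ?orbT //=.
rewrite big1 => [|k]; last first.
  by rewrite !inE -andbA; case: eqP => //= _; case: eqP.
rewrite mulr1; case: ifP => _; [exact: hal | exact: hbe].
Qed.

(** [b] records whether i precedes j, so that one proof covers [lt] and [lt']. Pairs not both in [B]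
    see i and j alike, by adjacency. *)
Lemma prod_two_pairs (mu : rel 'I_n) (A : {set I}) (b : bool) :
  (forall k l, ~~ ((k \in pred2 i j) && (l \in pred2 i j)) -> mu k l = lt k l) ->
  mu i i = false -> mu j j = false -> mu i j = b -> mu j i = ~~ b ->
  A \subset B ->
  \prod_v \prod_w (if mu (split_sites g A v) (split_sites g A w)
                   then pair_factor (s v) (s w) else 1) =
  (\prod_v \prod_w (if (v \in B) && (w \in B) then 1
                   else if lt (g v) (g w) then pair_factor (s v) (s w) else 1))
  * \prod_(v in if b then A else B :\: A) \prod_(w in if b then B :\: A else A)
     pair_factor (s v) (s w).
Proof.
move=> mu_lt mii mjj mij mji AB; have ji : j != i by rewrite eq_sym.
rewrite [X in _ * X]big_mkcond -big_split; apply: eq_bigr => v _ /=.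
have -> : (if v \in (if b then A else B :\: A)
   then \prod_(w in if b then B :\: A else A) pair_factor (s v) (s w) else 1) =
   \prod_w (if (v \in (if b then A else B :\: A)) && (w \in (if b then B :\: A else A))
     then pair_factor (s v) (s w) else 1).
  by case: ifP => _; rewrite -?big_mkcond //= big1.
rewrite -big_split; apply: eq_bigr => w _ /=.
rewrite !split_siteE //.
have AB' u : u \notin B -> (u \in A) = false.
  by move=> uB; apply: contraNF uB; apply: (subsetP AB).
have outB u : u \notin B -> g u \notin pred2 i j.
  by rewrite !inE negb_or (gj u) andbT.
have inB u : u \in B -> g u = i by rewrite inE => /eqP.
have [vB|vB] := boolP (v \in B); have [wB|wB] := boolP (w \in B).
- rewrite mul1r; case: b mij mji => /= mij mji; rewrite ?in_setD ?vB ?wB;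
    by case: (v \in A); case: (w \in A); rewrite /= ?mii ?mjj ?mij ?mji.
- have -> : (w \in (if b then B :\: A else A)) = false.
    by case: (b); rewrite ?in_setD ?(negbTE wB) ?andbF ?AB'.
  rewrite ?andbF mulr1 (AB' w) // (inB v) //.
  have [E1 E2] := lt_adj (outB w wB).
  by case: (v \in A); rewrite mu_lt ?(negbTE (outB w wB)) ?andbF // ?E2.
- have -> : (v \in (if b then A else B :\: A)) = false.
    by case: (b); rewrite ?in_setD ?(negbTE vB) ?andbF ?AB'.
  rewrite mulr1 (AB' v) // (inB w) //.
  have [E1 E2] := lt_adj (outB v vB).
  by case: (w \in A); rewrite mu_lt ?(negbTE (outB v vB)) // ?E1.
have -> : (v \in (if b then A else B :\: A)) = false.
  by case: (b); rewrite ?in_setD ?(negbTE vB) ?andbF ?AB'.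
by rewrite mulr1 !AB' // mu_lt ?(negbTE (outB v vB)).
Qed.

Lemma split_weight_term (A : {set I}) : A \subset B ->
  weight_term lt s x L (split_sites g A) =
  common_factor * two_site_term s (x j) (x i - L i) B A.
Proof.
have ji : j != i by rewrite eq_sym.
move=> AB; rewrite /weight_term /common_factor /two_site_term.
rewrite (@prod_two_sites lt (fun y => y - x j) (fun y => y - (x i - L i))) //; first last.
- by move=> y; rewrite /site_factor lt_ij lt_jj eqxx mulr1; ring.
- by move=> y; rewrite /site_factor lt_ii eqxx lt_ji (negbTE ji) mul1r.
by rewrite (@prod_two_pairs lt A true) //=; ring.
Qed.

(** For [lt'] the first site is j, which carries the complement of [A]. *)
Lemma split_weight_term' (A : {set I}) : A \subset B ->
  weight_term lt' s x L (split_sites g A) =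
  common_factor * two_site_term s (x i) (x j - L j) B (B :\: A).
Proof.
have ji : j != i by rewrite eq_sym.
move=> AB; rewrite /weight_term /common_factor /two_site_term.
rewrite (@prod_two_sites lt' (fun y => y - (x j - L j)) (fun y => y - x i)) //; first last.
- by move=> y; rewrite /site_factor lt'_ij lt'_jj eqxx mulr1 (negbTE ij).
- by move=> y; rewrite /site_factor lt'_ii eqxx lt'_ji mul1r; ring.
rewrite (@prod_two_pairs lt' A false) //=.
by rewrite setDDr setDv set0U (setIidPr AB); ring.
Qed.

End Split.

(** In each group of maps with the same merging, the common factor is a scalar and the rest is a
    two-site sum, to which the exchange for two sites applies. *)
Lemma R_at_weight_sum :
  R_at R i j (x i - x j) (weight_sum lt s x L) = weight_sum lt' s x L.
Proof.
have ji : j != i by rewrite eq_sym.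
rewrite /weight_sum !sum_merge_sites [R_at _ _ _ _ _]linear_sum /=.
apply: eq_bigr => g /forallP gj.
set B := [set v | g v == i].
pose q0 := [multinom (if k == i then 0 else fiber_count g k)%N | k < n].
have q0i : q0 i = 0%N by rewrite mnmE eqxx.
have q0j : q0 j = 0%N.
  by rewrite !mnmE (negbTE ji) eq_card0 // => v; rewrite !inE (negbTE (gj v)).
rewrite [R_at _ _ _ _ _]linear_sum /=.
transitivity (common_factor g *: two_site_sum s (x j) (x i - L i) B
   (fun k l => R_at R i j (x i - x j) 'X_[q0 + U_(i) *+ k + U_(j) *+ l])).
  rewrite scaler_sumr; apply: eq_bigr => A AB.
  by rewrite [R_at _ _ _ _ _]linearZ /= split_weight_term // split_fiber_count // scalerA.
rewrite (R_two_site_sum injs ij hR hc) //; last by rewrite merged_count_mdeg.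
rewrite scaler_sumr (reindex_onto (fun A => B :\: A) (fun A => B :\: A)) /=; last first.
  by move=> A AB; rewrite setDDr setDv set0U (setIidPr AB).
apply: eq_big => [A|A /andP[_ /eqP AE]].
  rewrite subsetDl /=; apply/eqP/idP => [<-|AB]; first exact: subsetDl.
  by rewrite setDDr setDv set0U (setIidPr AB).
have AB : A \subset B by rewrite -AE subsetDl.
by rewrite split_weight_term' // split_fiber_count // scalerA AE.
Qed.

End Exchange.
End WeightFunctions.

(** A loop invariant [Q] indexed by all of 0, ..., n: the indices removed by the filter become idle
    steps, which keeps the position arithmetic uniform. *)
Lemma foldl_ord_filter (n : nat) (T : Type) (P : pred 'I_n) (f : T -> 'I_n -> T)
    (Q : nat -> T -> Prop) (v : T) :
  Q 0%N v ->
  (forall (j : 'I_n) w, Q j w -> Q j.+1 (if P j then f w j else w)) ->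
  Q n (foldl f v [seq j <- enum 'I_n | P j]).
Proof.
move=> Q0 QS; have H (b : nat) : (b <= n)%N ->
    Q b (foldl f v [seq j <- take b (enum 'I_n) | P j]).
  elim: b => [|b IH] bn; first by rewrite take0.
  pose j := Ordinal bn.
  rewrite (take_nth j) ?size_enum_ord // filter_rcons.
  rewrite [nth _ _ _](_ : _ = j); last by apply: val_inj; rewrite /= nth_enum_ord.
  by have := QS j _ (IH (ltnW bn)); case: (P j); rewrite ?foldl_rcons.
by have := H n (leqnn n); rewrite take_oversize // size_enum_ord.
Qed.

(* The natural order, with m moved just before the sites of index >= b. *)
Definition insert_lt (n : nat) (m : 'I_n) (b : nat) : rel 'I_n := fun i k =>
  if i == m then (k != m) && (b <= k)%N else if k == m then (i < b)%N else (i < k)%N.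

Lemma insert_ltE (n : nat) (m i k : 'I_n) : insert_lt m m i k = (i < k)%N.
Proof.
rewrite /insert_lt; case: eqP => [->|_]; last by case: eqP => [->|].
by rewrite -val_eqE /=; case: ltngtP.
Qed.

(** Positions m and m + 1 give the same order, since no other site lies between them; this is the
    idle step j = m of both products. *)
Lemma insert_ltS (n : nat) (m i k : 'I_n) : insert_lt m m.+1 i k = (i < k)%N.
Proof.
rewrite -(insert_ltE m) /insert_lt; case: eqP => [_|/eqP im].
  by rewrite -val_eqE /=; case: ltngtP.
by case: eqP => // _; rewrite ltnS leq_eqVlt val_eqE (negbTE im).
Qed.

(** * One qKZ step on combinations of weight functions *)

Section Transport.
Variables (K : fieldType) (n : nat) (I T : finType) (S : T -> I -> K) (L : 'I_n -> K).
Variables (R : K -> K -> tensor2_end K) (m : 'I_n).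
Hypothesis hR : forall L1 L2 : K, is_Rmatrix L1 L2 (R L1 L2).
Hypothesis injS : forall t, injective (S t).

Definition weight_comb (lt : rel 'I_n) (x : 'I_n -> K) (phi : T -> K) : {mpoly K[n]} :=
  \sum_t phi t *: weight_sum lt (S t) x L.

Lemma eq_weight_comb (lt lt' : rel 'I_n) x x' phi phi' :
  (forall i j, lt i j = lt' i j) -> x =1 x' -> phi =1 phi' ->
  weight_comb lt x phi = weight_comb lt' x' phi'.
Proof.
move=> E Ex Ep; apply: eq_bigr => t _; rewrite Ep; congr (_ *: _).
exact: eq_weight_sum.
Qed.

Lemma weight_comb_homog lt x phi : weight_comb lt x phi \is #|I|.-homog for mdeg.
Proof. by apply: rpred_sum => t _; apply: rpredZ; apply: weight_sum_homog. Qed.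

Lemma R_at_insert (x : 'I_n -> K) (phi : T -> K) (j : 'I_n) : j != m ->
  (forall b : nat, (b < #|I|)%N -> L m - b%:R - (x m - x j) != 0) ->
  R_at (R (L m) (L j)) m j (x m - x j) (weight_comb (insert_lt m j) x phi) =
  weight_comb (insert_lt m j.+1) x phi.
Proof.
move=> jm hc; have mj : m != j by rewrite eq_sym.
rewrite [R_at _ _ _ _ _]linear_sum /=; apply: eq_bigr => t _.
rewrite [R_at _ _ _ _ _]linearZ /=; congr (_ *: _).
have vneq (k l : 'I_n) : k != l -> (k == l :> nat) = false.
  by rewrite -val_eqE => /negbTE.
apply: R_at_weight_sum => //; rewrite /insert_lt ?eqxx ?(negbTE jm) ?(negbTE mj) ?ltnn //=.
- move=> k l; rewrite !inE negb_and !negb_or.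
  case: (k =P m) => [->|/eqP km]; case: (l =P m) => [->|/eqP lm] //=.
    by move=> lj; have := vneq _ _ lj; case: ltngtP.
  by rewrite orbF => kj; have := vneq _ _ kj; rewrite ltnS; case: ltngtP.
move=> k; rewrite !inE negb_or => /andP[/negbTE -> kj]; split=> //.
by have := vneq _ _ kj; case: ltngtP.
Qed.

Section Step.
Variables (a kappa : K) (x x' : 'I_n -> K) (phi phi' : T -> K).
Hypothesis x'E : forall i, x' i = x i + (if i == m then a else 0).
Hypothesis hc : forall j, j != m -> forall b : nat, (b < #|I|)%N ->
  L m - b%:R - (x m - x j) != 0.
Hypothesis hc' : forall j, j != m -> forall b : nat, (b < #|I|)%N ->
  L m - b%:R - (x m - x j + a) != 0.
Hypothesis hkappa : kappa_h2 kappa m (weight_comb (insert_lt m n) x phi) =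
  weight_comb (insert_lt m 0) x' phi'.

Lemma qKZ_foldl_weight_comb :
  let v1 := foldl (fun w j => R_at (R (L m) (L j)) m j (x m - x j) w)
    (weight_comb (fun i k => (i < k)%N) x phi) [seq j : 'I_n <- enum 'I_n | (m < j)%N] in
  foldl (fun w j => R_at (R (L m) (L j)) m j (x m - x j + a) w) (kappa_h2 kappa m v1)
    [seq j : 'I_n <- enum 'I_n | (j < m)%N] =
  weight_comb (fun i k => (i < k)%N) x' phi'.
Proof.
move=> v1; have -> : v1 = weight_comb (insert_lt m n) x phi.
  (* The factor m stays in its place until the loop passes index m, hence the maximum; the second
     product symmetrically needs a minimum. *)
  pose Q b v := v = weight_comb (insert_lt m (maxn m b)) x phi.
  have -> : weight_comb (insert_lt m n) x phi = weight_comb (insert_lt m (maxn m n)) x phi.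
    by rewrite (maxn_idPr (ltnW (ltn_ord m))).
  apply: (foldl_ord_filter (Q := Q)); rewrite /Q.
    by rewrite maxn0; apply: eq_weight_comb => // i k; rewrite insert_ltE.
  move=> j w ->; case: (ltngtP m j) => mj.
  - rewrite (maxn_idPr (leqW (ltnW mj))).
    have jm : j != m by rewrite -val_eqE neq_ltn mj orbT.
    by apply: R_at_insert => // b bI; apply: hc.
  - by rewrite (maxn_idPl _).
  have -> : j = m by apply: val_inj.
  rewrite (maxn_idPr (leqnSn m)).
  by apply: eq_weight_comb => // i k; rewrite insert_ltE insert_ltS.
rewrite hkappa.
pose Q b v := v = weight_comb (insert_lt m (minn m b)) x' phi'.
have H : forall v, Q n v -> v = weight_comb (fun i k => (i < k)%N) x' phi'.
  move=> v ->; rewrite (minn_idPl (ltnW (ltn_ord m))).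
  by apply: eq_weight_comb => // i k; rewrite insert_ltE.
apply: H; apply: foldl_ord_filter; rewrite /Q; first by rewrite minn0.
move=> j w ->; case: (ltngtP j m) => mj.
- rewrite (minn_idPr mj).
  have jm : j != m by rewrite -val_eqE neq_ltn mj.
  (* The shift by [a] in the left R-matrices only records that x_m has already been raised. *)
  have cE : x m - x j + a = x' m - x' j by rewrite !x'E eqxx (negbTE jm); ring.
  by rewrite cE; apply: R_at_insert => // b bI; rewrite -cE; apply: hc'.
- by rewrite (minn_idPl _) // leqW // ltnW.
have -> : j = m by apply: val_inj.
by rewrite (minn_idPl (leqnSn m)).
Qed.

End Step.
End Transport.

(** * Ratios of the master function *)

Section MasterRatios.
Variables (K : fieldType) (n : nat) (I : finType) (a kappa : K) (x L : 'I_n -> K).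

Definition one_body (y : K) : K := kappa * \prod_i ((y - x i + L i) / (y - x i + a)).
Definition two_body (y : K) : K := ((y + a) * (y - 1)) / (y * (y + 1 + a)).
(* s_ratio is Phi_l; x_ratio is the ratio of the master function along the shift
   of x_m, so that the Phi_l and the x_ratio m form a flat rank-one connection. *)
Definition s_ratio (s : I -> K) (l : I) : K :=
  one_body (s l) * \prod_(j | j != l) two_body (s l - s j).
Definition x_ratio (m : 'I_n) (s : I -> K) : K :=
  \prod_v ((s v - x m) / (s v - x m - a + L m)).

(* The ratio of the master function along the shift of all the variables in A;
   the two-body factors inside A cancel. *)
Definition set_ratio (A : {set I}) (s : I -> K) : K :=
  \prod_(v in A) (one_body (s v) * \prod_(w in ~: A) two_body (s v - s w)).

Definition regular_at (s : I -> K) : Prop :=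
  [/\ forall k i, s k - x i + a != 0 /\ s k - x i + L i != 0,
      forall k j, k != j -> s k - s j != 0 /\ s k - s j + a != 0
    & forall k j, k != j -> s k - s j + 1 != 0 /\ s k - s j + 1 + a != 0].

Definition raise_at (A : {set I}) (s : I -> K) : I -> K :=
  fun v => s v + (if v \in A then a else 0).

(** With y = s_v - s_l, raising s_v by a turns s_l - s_v into -(y + a): this is the cancellation
    inside a set of raised variables. *)
Lemma two_body_antisym y : y != 0 -> y + a != 0 -> y - 1 != 0 -> y + 1 + a != 0 ->
  two_body y * two_body (- (y + a)) = 1.
Proof.
move=> y0 ya y1 y1a; rewrite /two_body; field.
rewrite oppr_eq0 ya y1a y0 /= andbT.
by rewrite (_ : - (y + a) + 1 + a = - (y - 1)) ?oppr_eq0 //; ring.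
Qed.

Lemma set_ratioU1 (A : {set I}) s l : regular_at s -> l \notin A ->
  set_ratio A s * s_ratio (raise_at A s) l = set_ratio (l |: A) s.
Proof.
move=> [_ r0 r1] lA; rewrite /set_ratio big_setU1 //= /s_ratio.
have lAC : l \in ~: A by rewrite inE.
have AE : ~: (l |: A) = ~: A :\ l.
  by apply/setP => k; rewrite !inE negb_or.
have -> : raise_at A s l = s l by rewrite /raise_at (negbTE lA) addr0.
have -> : \prod_(j | j != l) two_body (s l - raise_at A s j) =
   (\prod_(v in A) two_body (s l - s v - a)) * \prod_(w in ~: A :\ l) two_body (s l - s w).
  rewrite (bigID (fun j => j \in A)) /=; congr (_ * _).
    apply: eq_big => [j|j /andP[_ jA]]; last by rewrite /raise_at jA opprD addrA.
    by case: eqP => // ->; rewrite (negbTE lA).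
  apply: eq_big => [j|j /andP[_ jA]]; first by rewrite !inE.
  by rewrite /raise_at (negbTE jA) addr0.
rewrite AE.
have <- : (\prod_(v in A) (one_body (s v) * \prod_(w in ~: A) two_body (s v - s w)))
          * \prod_(v in A) two_body (s l - s v - a) =
  \prod_(v in A) (one_body (s v) * \prod_(w in ~: A :\ l) two_body (s v - s w)).
  rewrite -big_split; apply: eq_bigr => v vA /=.
  have vl : v != l by apply: contraNneq lA => <-.
  have lv : l != v by rewrite eq_sym.
  have [v0 va] := r0 _ _ vl; have [v1 v1a] := r1 _ _ vl; have [l1 _] := r1 _ _ lv.
  rewrite (big_setD1 l lAC) /= (_ : s l - s v - a = - (s v - s l + a)); last by ring.
  have y1 : s v - s l - 1 != 0.
    by rewrite (_ : s v - s l - 1 = - (s l - s v + 1)) ?oppr_eq0 //; ring.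
  have E := two_body_antisym v0 va y1 v1a.
  set Q := \prod_(_ in _) _; rewrite -[RHS]mulr1 -E; ring.
set P1 := \prod_(v in A) _; set P2 := \prod_(v in A) _; set Q := \prod_(_ in _) _.
ring.
Qed.

(** [lt1] has the variables in [A] first and [lt2] has them last. Only pairs crossing between [A]
    and its complement change, and the two-body factors convert one orientation into the other. *)
Lemma pair_site_prod (A : {set I}) (lt1 lt2 lt0 : rel I) (s s' : I -> K) :
  (forall v w, v \in A -> w \notin A ->
     two_body (s v - s w) * pair_factor (s' v) (s' w) = pair_factor (s w) (s v)) ->
  (forall v, v \notin A -> s' v = s v) ->
  (forall v w, lt1 v w = if v \in A then w \notin A else (w \notin A) && lt0 v w) ->
  (forall v w, lt2 v w = if v \in A then false else (w \in A) || lt0 v w) ->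
  (\prod_(v in A) \prod_(w in ~: A) two_body (s v - s w)) *
  \prod_v \prod_w (if lt1 v w then pair_factor (s' v) (s' w) else 1) =
  \prod_v \prod_w (if lt2 v w then pair_factor (s v) (s w) else 1).
Proof.
move=> E s'E H1 H2.
have [F0 F0E] : exists F0, F0 = fun v w => if (v \notin A) && (w \notin A) && lt0 v w
   then pair_factor (s v) (s w) else 1 by eexists.
transitivity ((\prod_v \prod_w (if (v \in A) && (w \notin A) then pair_factor (s w) (s v) else 1))
   * \prod_v \prod_w F0 v w).
  rewrite [X in X * _]big_mkcond -!big_split; apply: eq_bigr => v _ /=.
  have -> : (if v \in A then \prod_(w in ~: A) two_body (s v - s w) else 1) =
      \prod_w (if (v \in A) && (w \notin A) then two_body (s v - s w) else 1).
    case: ifP => _; last by rewrite big1.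
    by rewrite big_mkcond; apply: eq_bigr => w _; rewrite inE.
  rewrite -!big_split; apply: eq_bigr => w _ /=; rewrite F0E H1.
  case: (boolP (v \in A)) => vA; case: (boolP (w \in A)) => wA; rewrite /= ?mulr1 //.
    exact: E.
  by rewrite !mul1r !s'E.
(* The crossing pairs are transposed: [lt2] lists the element outside [A] first. *)
rewrite [X in X * _]exchange_big -!big_split; apply: eq_bigr => v _ /=.
rewrite -!big_split; apply: eq_bigr => w _ /=; rewrite F0E H2.
by case: (boolP (v \in A)) => vA; case: (boolP (w \in A)) => wA; rewrite /= ?mulr1 ?mul1r.
Qed.

(* Raising the variables attached to the site m turns the term with m first and
   x_m raised into the term with m last. *)
Lemma set_ratio_weight_term (m : 'I_n) (g : {ffun I -> 'I_n}) (s : I -> K) (x' : 'I_n -> K) :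
  regular_at s -> (forall k, s k - x m != 0) ->
  (forall k, s k - x m - a + L m != 0) ->
  (forall k i, s k - x i + a != 0) ->
  (forall i, x' i = x i + (if i == m then a else 0)) ->
  let A := [set v | g v == m] in
  set_ratio A s * x_ratio m (raise_at A s) *
    weight_term (insert_lt m 0) (raise_at A s) x' L g =
  kappa ^+ #|A| * weight_term (insert_lt m n) s x L g.
Proof.
move=> [r r0 r1] xm0 xma xa x'E A.
have mn (k : 'I_n) : (n <= k)%N = false by rewrite leqNgt ltn_ord.
have inA v : (v \in A) = (g v == m) by rewrite inE.
have notA v : v \notin A -> raise_at A s v = s v.
  by move=> vA; rewrite /raise_at (negbTE vA) addr0.
rewrite /set_ratio /x_ratio /weight_term big_split /=.
have -> : \prod_v \prod_w (if insert_lt m n (g v) (g w) then pair_factor (s v) (s w) else 1)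
   = (\prod_(v in A) \prod_(w in ~: A) two_body (s v - s w)) *
     \prod_v \prod_w (if insert_lt m 0 (g v) (g w)
        then pair_factor (raise_at A s v) (raise_at A s w) else 1).
  apply/esym/(pair_site_prod (lt0 := fun v w => (g v < g w)%N)) => //.
  - move=> v w vA wA; rewrite (notA w wA) /raise_at vA.
    have vw : v != w by apply: contraNneq wA => <-.
    have [v0 va] := r0 _ _ vw; have [v1 v1a] := r1 _ _ vw.
    rewrite /two_body /pair_factor; field.
    rewrite v0 v1a /= (_ : s v + a - s w = s v - s w + a) ?va; last by ring.
    by rewrite (_ : s w - s v = - (s v - s w)) ?oppr_eq0 ?v0 //; ring.
  - by move=> v w; rewrite /insert_lt !inA; case: eqP => _; rewrite ?andbT //; case: eqP.
  by move=> v w; rewrite /insert_lt !inA mn andbF; case: eqP => _ //; case: eqP => _ //=; rewrite ltn_ord.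
(* One variable at a time. Outside [A], [x_ratio] replaces the factor of a preceding site m by that
   of a following one; inside [A], it cancels the factor of m in [one_body] and leaves [kappa]. *)
have site v :
  (if v \in A then one_body (s v) else 1) *
  ((raise_at A s v - x m) / (raise_at A s v - x m - a + L m)) *
  \prod_k site_factor (insert_lt m 0) x' L (raise_at A s v) (g v) k =
  (if v \in A then kappa else 1) * \prod_k site_factor (insert_lt m n) x L (s v) (g v) k.
  case: (boolP (v \in A)) => vA; last first.
    rewrite notA // !mul1r [in LHS](bigD1 m) //= [in RHS](bigD1 m) //= mulrA.
    have gm : (g v == m) = false by rewrite -inA (negbTE vA).
    have mg : (m == g v) = false by rewrite eq_sym.
    congr (_ * _).
      rewrite /site_factor /insert_lt eqxx gm mn leq0n /= mg x'E eqxx.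
      rewrite (_ : s v - (x m + a) + L m = s v - x m - a + L m) ?divfK //; ring.
    apply: eq_bigr => k km; rewrite /site_factor /insert_lt (negbTE km) gm x'E (negbTE km) addr0.
    by [].
  have gv : g v = m by apply/eqP; rewrite -inA.
  have -> : \prod_k site_factor (insert_lt m 0) x' L (raise_at A s v) (g v) k =
      \prod_(k | k != m) (s v - x k + a).
    rewrite (bigD1 m) //= gv /site_factor {1}/insert_lt !eqxx /= mul1r.
    apply: eq_bigr => k km; rewrite /insert_lt (negbTE km) eqxx /= x'E (negbTE km) addr0.
    by rewrite /raise_at vA addrAC.
  have -> : \prod_k site_factor (insert_lt m n) x L (s v) (g v) k =
      \prod_(k | k != m) (s v - x k + L k).
    rewrite (bigD1 m) //= gv /site_factor {1}/insert_lt !eqxx /= mul1r.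
    by apply: eq_bigr => k km; rewrite /insert_lt (negbTE km) eqxx ltn_ord.
  have -> : \prod_(k | k != m) (s v - x k + L k) =
     (\prod_(k | k != m) ((s v - x k + L k) / (s v - x k + a))) *
      \prod_(k | k != m) (s v - x k + a).
    by rewrite -big_split; apply: eq_bigr => k _ /=; rewrite divfK.
  rewrite /one_body (bigD1 m) //= /raise_at vA.
  have -> : s v + a - x m - a + L m = s v - x m + L m by ring.
  set P := \prod_(_ | _) _; set Q := \prod_(_ | _) _.
  by have [ra rL] := r v m; field; rewrite ra rL.
have E := @eq_bigr K 1 *%R I (index_enum I) predT _ _ (fun v _ => site v).
rewrite [LHS]big_split [RHS]big_split /= [X in X * _ = _]big_split -!big_mkcond /= prodr_const in E.
rewrite [RHS]mulrA -E; ring.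
Qed.

End MasterRatios.

(** * The prime subfield *)

Section Frobenius.
Variables (K : fieldType) (p : nat).
Hypothesis hp : p \in [pchar K].
Hypothesis hp2 : (2 < p)%N.

Lemma pchar_natr_inj (c d : nat) : (c < p)%N -> (d < p)%N ->
  c%:R = d%:R :> K -> c = d.
Proof.
wlog cd : c d / (c <= d)%N.
  by move=> H; case: (leqP c d) => [|/ltnW] cd cp dp E; [exact: H | exact/esym/H].
move=> cp dp E; have : (d - c)%:R == 0 :> K by rewrite natrB // E subrr.
rewrite -(dvdn_pcharf hp) => /dvdnP[k]; case: k => [|k]; lia.
Qed.

(** The p elements -d of the prime field are roots of the monic polynomial X^p - X, hence all its
    roots. *)
Lemma prod_pchar_shift (y : K) : \prod_(d < p) (y + d%:R) = y ^+ p - y.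
Proof.
pose rs : seq K := [seq - (nat_of_ord d)%:R | d <- enum 'I_p].
have szq : size ('X^p - 'X : {poly K}) = p.+1.
  by rewrite size_polyDl size_polyXn // size_polyN size_polyX; lia.
have := @all_roots_prod_XsubC K ('X^p - 'X) rs.
rewrite szq size_map size_enum_ord => /(_ erefl) H.
have {}H : 'X^p - 'X = \prod_(z <- rs) ('X - z%:P).
  rewrite H; first last.
  - rewrite uniq_rootsE map_inj_uniq ?enum_uniq // => c d /oppr_inj E.
    by apply: val_inj; apply: pchar_natr_inj E.
  - apply/allP => _ /mapP[c _ ->]; rewrite rootE !hornerE.
    by rewrite -(pFrobenius_autE hp) rmorphN rmorph_nat subrr.
  rewrite lead_coefDl ?size_polyXn ?size_polyN ?size_polyX ?lead_coefXn ?scale1r //; lia.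
have := congr1 (fun q => q.[y]) H; rewrite !hornerE => ->.
rewrite horner_prod big_map big_enum; apply: eq_bigr => d _.
by rewrite !hornerE opprK.
Qed.

(** The origin of [h_p]: it is the product over the orbit of y under shifts by a. *)
Lemma prod_h_p (a y : K) : a != 0 -> \prod_(d < p) (y + a * d%:R) = h_p p a y.
Proof.
move=> a0; have p0 : (0 < p)%N by lia.
transitivity (\prod_(d < p) (a * (y / a + d%:R))).
  by apply: eq_bigr => d _; field.
rewrite big_split prodr_const card_ord /= prod_pchar_shift /h_p.
rewrite mulrBr -exprMn mulrCA divff // mulr1 -{2}(prednK p0) exprS; congr (_ - _).
by field.
Qed.

(** For odd p, [h_p] is unchanged when a becomes -a. *)
Lemma prod_h_pN (a y : K) : a != 0 -> \prod_(d < p) (y - a * d%:R) = h_p p a y.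
Proof.
move=> a0; rewrite -[RHS](_ : h_p p (- a) y = _).
  rewrite -prod_h_p ?oppr_eq0 //; apply: eq_bigr => d _; by rewrite mulNr.
rewrite /h_p exprNn -signr_odd.
have -> : odd p.-1 = false.
  have /even_prime := pcharf_prime hp; case; lia.
by rewrite mul1r.
Qed.

Lemma h_pD a : {morph h_p p a : y z / (y + z : K)}.
Proof.
move=> y z; rewrite /h_p -!(pFrobenius_autE hp) rmorphD /=; ring.
Qed.

Lemma h_pN a : {morph h_p p a : y / (- y : K)}.
Proof.
move=> y; have := h_pD a (- y) y; rewrite addNr {1}/h_p expr0n mulr0 subr0.
have -> : (p == 0)%N = false by lia.
by move=> E; apply/eqP; rewrite -addr_eq0 -E.
Qed.

Lemma h_pB a : {morph h_p p a : y z / (y - z : K)}.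
Proof. by move=> y z; rewrite h_pD h_pN. Qed.

(** With additivity, this makes [h_p] constant along each orbit of shifts by a. *)
Lemma h_p_lattice a (c : int) : h_p p a (c%:~R * a : K) = 0.
Proof.
have ap : a ^+ p = a ^+ p.-1 * a by rewrite -exprSr prednK //; lia.
rewrite /h_p exprMn ap -(pFrobenius_autE hp) rmorph_int; ring.
Qed.

(** Since -1 = p - 1 in K, nondegeneracy for natural c extends to integer c, so shifts in both
    directions are covered. *)
Lemma pchar_intr_natr (c : int) : exists k : nat, c%:~R = k%:R :> K.
Proof.
case: c => k; first by exists k.
exists (p.-1 * k.+1)%N; rewrite NegzE mulrNz natrM.
have -> : (p.-1%:R : K) = -1.
  apply/eqP; rewrite -addr_eq0 natr1 prednK ?(pcharf0 hp) //; lia.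
by rewrite mulN1r.
Qed.

End Frobenius.

Section Nondegenerate.
Variables (K : fieldType) (n r : nat) (a : K) (L : 'I_n -> K).

Definition orbit_regular (s : 'I_r -> K) (x : 'I_n -> K) : Prop :=
  forall c : int,
  [/\ forall k i, s k - x i + c%:~R * a != 0,
      forall k i, s k - x i + L i + c%:~R * a != 0,
      forall k j, k != j -> s k - s j + c%:~R * a != 0,
      forall k j, k != j -> s k - s j + 1 + c%:~R * a != 0
    & forall i m, i != m -> forall b : nat, (b < r)%N ->
        x i - x m - L i + b%:R + c%:~R * a != 0].

Definition lattice_close (T : Type) (u v : T -> K) : Prop :=
  forall t, exists c : int, u t = v t + c%:~R * a.

Lemma orbit_regular_shift s x s' x' : orbit_regular s x ->
  lattice_close s' s -> lattice_close x' x -> orbit_regular s' x'.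
Proof.
move=> h hs hx c; split.
- move=> k i; have [u ->] := hs k; have [v ->] := hx i.
  have [+ _ _ _ _] := h (u - v + c) => /(_ k i); apply: contra_neq => <-.
  by rewrite !rmorphD rmorphN /=; ring.
- move=> k i; have [u ->] := hs k; have [v ->] := hx i.
  have [_ + _ _ _] := h (u - v + c) => /(_ k i); apply: contra_neq => <-.
  by rewrite !rmorphD rmorphN /=; ring.
- move=> k j kj; have [u ->] := hs k; have [v ->] := hs j.
  have [_ _ + _ _] := h (u - v + c) => /(_ k j kj); apply: contra_neq => <-.
  by rewrite !rmorphD rmorphN /=; ring.
- move=> k j kj; have [u ->] := hs k; have [v ->] := hs j.
  have [_ _ _ + _] := h (u - v + c) => /(_ k j kj); apply: contra_neq => <-.
  by rewrite !rmorphD rmorphN /=; ring.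
move=> i m im b br; have [u ->] := hx i; have [v ->] := hx m.
have [_ _ _ _ +] := h (u - v + c) => /(_ i m im b br); apply: contra_neq => <-.
by rewrite !rmorphD rmorphN /=; ring.
Qed.

Lemma orbit_regular_at s x : orbit_regular s x -> regular_at a x L s.
Proof.
move=> h; have [h1 _ h3 h4 _] := h 1; have [_ g2 g3 g4 _] := h 0.
split=> [k i|k j kj|k j kj].
- by have := h1 k i; have := g2 k i; rewrite mul0r mul1r addr0.
- by have := h3 k j kj; have := g3 k j kj; rewrite mul0r mul1r addr0.
by have := h4 k j kj; have := g4 k j kj; rewrite mul0r mul1r addr0.
Qed.

End Nondegenerate.

Section RatioExt.
Variables (K : fieldType) (n : nat) (I : finType) (a kappa : K) (x L : 'I_n -> K).

Lemma eq_s_ratio (s s' : I -> K) l :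
  s =1 s' -> s_ratio a kappa x L s l = s_ratio a kappa x L s' l.
Proof. by move=> E; rewrite /s_ratio E; congr (_ * _); apply: eq_bigr => j _; rewrite E. Qed.

Lemma eq_x_ratio m (s s' : I -> K) :
  s =1 s' -> x_ratio a x L m s = x_ratio a x L m s'.
Proof. by move=> E; apply: eq_bigr => v _; rewrite E. Qed.

Lemma set_ratio1 l (s : I -> K) :
  set_ratio a kappa x L [set l] s = s_ratio a kappa x L s l.
Proof.
rewrite /set_ratio big_set1; congr (_ * _).
by apply: eq_bigl => j; rewrite !inE.
Qed.

(** Both sides are the [set_ratio] of the pair {k, l}, which is symmetric. *)
Lemma s_ratio_comm (s : I -> K) k l : regular_at a x L s -> k != l ->
  s_ratio a kappa x L s l * s_ratio a kappa x L (raise_at a [set l] s) k =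
  s_ratio a kappa x L s k * s_ratio a kappa x L (raise_at a [set k] s) l.
Proof.
move=> rs kl; rewrite -!set_ratio1.
rewrite !(set_ratio1 _ (raise_at _ _ _)) !set_ratioU1 ?inE //; last by rewrite eq_sym.
by congr (set_ratio _ _ _ _ _ _); apply/setP => v; rewrite !inE orbC.
Qed.

End RatioExt.

(** * Flat sections over the periodic s-lattice *)

Section Sections.
Variables (K : fieldType) (p n r : nat) (a kappa : K) (L : 'I_n -> K).
Hypothesis hp : p \in [pchar K].
Variable s0 : 'I_r -> K.
Local Notation T := {ffun 'I_r -> 'I_p}.

Definition lattice_point (u : 'I_r -> nat) : 'I_r -> K := fun l => s0 l + a * (u l)%:R.
Definition cyclic_point (t : T) : 'I_r -> K := lattice_point (fun l => t l).

Definition cyclic_shift (A : {set 'I_r}) (t : T) : T :=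
  [ffun k => if k \in A then ordS (t k) else t k].

(** The wrap-around from p - 1 to 0 is invisible in K, so a cyclic shift of the index really raises
    the point by a. *)
Lemma natr_ordS (i : 'I_p) : (ordS i)%:R = i%:R + 1 :> K.
Proof.
have -> : (nat_of_ord (ordS i)) = (i.+1 %% p)%N by [].
by rewrite (GRing.natr_mod_pchar hp) natr1.
Qed.

Lemma cyclic_point_shift A t :
  cyclic_point (cyclic_shift A t) =1 raise_at a A (cyclic_point t).
Proof.
move=> l; rewrite /cyclic_point /lattice_point /raise_at ffunE.
by case: ifP => _; rewrite ?addr0 // natr_ordS mulrDr mulr1 addrA.
Qed.

Lemma cyclic_shift_bij A : bijective (cyclic_shift A).
Proof.
exists (fun t : T => [ffun k => if k \in A then ord_pred (t k) else t k] : T) => t;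
by apply/ffunP => k; rewrite !ffunE; case: (k \in A); rewrite ?ordSK ?ord_predK.
Qed.

Lemma cyclic_shiftU1 (A : {set 'I_r}) l t : l \notin A ->
  cyclic_shift (l |: A) t = cyclic_shift [set l] (cyclic_shift A t).
Proof.
move=> lA; apply/ffunP => k; rewrite !ffunE !inE.
by case: eqP => [->|//]; rewrite (negbTE lA).
Qed.

(* Periodicity in each direction is built into the index type. *)
Definition is_section (x : 'I_n -> K) (phi : T -> K) : Prop :=
  forall t l, phi (cyclic_shift [set l] t) =
              phi t * s_ratio a kappa x L (cyclic_point t) l.

Lemma section_set x phi (A : {set 'I_r}) t : (forall t, regular_at a x L (cyclic_point t)) ->
  is_section x phi ->
  phi (cyclic_shift A t) = phi t * set_ratio a kappa x L A (cyclic_point t).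
Proof.
move=> reg sec; have [d] := ubnP #|A|; elim: d A => // d IH A; rewrite ltnS => Ad.
have [->|/set0Pn[l lA]] := eqVneq A set0.
  rewrite /set_ratio big_set0 mulr1; congr phi; apply/ffunP => k.
  by rewrite ffunE inE.
have lA' : l \notin A :\ l by rewrite !inE eqxx.
rewrite -(setD1K lA) cyclic_shiftU1 // sec IH; last by rewrite (cardsD1 l) lA in Ad.
rewrite (eq_s_ratio _ _ _ _ _ (cyclic_point_shift _ _)) -mulrA.
by rewrite set_ratioU1.
Qed.

Section KappaStep.
Variables (x x' : 'I_n -> K) (m : 'I_n) (phi : T -> K).
Hypothesis nd : forall t, orbit_regular a L (cyclic_point t) x.
Hypothesis sec : is_section x phi.
Hypothesis x'E : forall i, x' i = x i + (if i == m then a else 0).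
Let phi' (t : T) := phi t * x_ratio a x L m (cyclic_point t).

(** For a fixed map g, the shift of the variables over m is a bijection of the periodic lattice; the
    section then produces [set_ratio], and the identity for a single weight term applies. *)
Lemma kappa_h2_weight_comb :
  kappa_h2 kappa m (weight_comb cyclic_point L (insert_lt m n) x phi) =
  weight_comb cyclic_point L (insert_lt m 0) x' phi'.
Proof.
have reg t : regular_at a x L (cyclic_point t) by apply: orbit_regular_at.
have kX q : kappa_h2 kappa m 'X_[q] = kappa ^+ q m *: 'X_[K, q] by apply: ext_basisX.
have klin (v w : {mpoly K[n]}) b : kappa_h2 kappa m (b *: v + w) =
   b *: kappa_h2 kappa m v + kappa_h2 kappa m w by apply: (linearP (ext_basis _)).
pose f : {linear {mpoly K[n]} -> {mpoly K[n]}} := ext_basis (fun q => kappa ^+ q m *: 'X_[q]).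
rewrite -[kappa_h2 _ _]/(f : _ -> _) /weight_comb /weight_sum.
under eq_bigr do rewrite scaler_sumr.
under [RHS]eq_bigr do rewrite scaler_sumr.
(* The map g becomes the outer index, so that the set of shifted variables may depend on it. *)
rewrite exchange_big [RHS]exchange_big linear_sum /=; apply: eq_bigr => g _.
under eq_bigr do rewrite scalerA.
under [RHS]eq_bigr do rewrite scalerA.
rewrite -!scaler_suml (linearZZ f) /= [f _]kX scalerA; congr (_ *: _).
pose A := [set v | g v == m].
have -> : fiber_count g m = #|A| by rewrite mnmE.
rewrite [RHS](reindex (cyclic_shift A)) /=; last exact/onW_bij/cyclic_shift_bij.
rewrite mulr_suml; apply: eq_bigr => t _.
rewrite /phi' (section_set _ _ reg sec).
rewrite (eq_x_ratio _ _ _ _ (cyclic_point_shift _ _)).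
have -> : weight_term (insert_lt m 0) (cyclic_point (cyclic_shift A t)) x' L g =
   weight_term (insert_lt m 0) (raise_at a A (cyclic_point t)) x' L g.
  congr (_ * _); do 2!apply: eq_bigr => ? _; by rewrite !cyclic_point_shift.
have [nd1 nd2 _ _ _] := nd t 0; have [nd3 _ _ _ _] := nd t 1.
have [_ nd4 _ _ _] := nd t (-1).
have := @set_ratio_weight_term _ _ _ a kappa x L m g (cyclic_point t) x' (reg t).
set W1 := weight_term _ _ _ _ _; set W2 := weight_term _ _ _ _ _.
rewrite -/A; set S := set_ratio _ _ _ _ _ _; set X := x_ratio _ _ _ _ _ => E.
transitivity (phi t * (S * X * W2)); last by ring.
rewrite E; first by ring.
- by move=> k; have := nd1 k m; rewrite mul0r addr0.
- by move=> k; have := nd4 k m; rewrite mulN1r addrAC.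
- by move=> k i; have := nd3 k i; rewrite mul1r.
exact: x'E.
Qed.

(** Flatness between an s-direction and an x-direction. Only the factors joining s_l and x_m differ
    on the two sides. *)
Lemma s_ratio_x_ratio t l :
  s_ratio a kappa x L (cyclic_point t) l *
    x_ratio a x L m (raise_at a [set l] (cyclic_point t)) =
  x_ratio a x L m (cyclic_point t) * s_ratio a kappa x' L (cyclic_point t) l.
Proof.
have [nd1 nd2 _ _ _] := nd t 0; have [nd3 _ _ _ _] := nd t 1.
have [_ nd4 _ _ _] := nd t (-1).
set s := cyclic_point t; rewrite /s_ratio.
set P := \prod_(j | j != l) two_body a (s l - s j).
rewrite [RHS]mulrA [LHS]mulrAC; congr (_ * _).
rewrite /x_ratio (bigD1 l) //= [in RHS](bigD1 l) //=.
rewrite [X in _ * (_ * X)](_ : _ = \prod_(i | i != l) ((s i - x m) / (s i - x m - a + L m))); last first.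
  by apply: eq_bigr => i il; rewrite /raise_at inE (negbTE il) addr0.
set Q := \prod_(i | i != l) _; rewrite mulrA [RHS]mulrAC; congr (_ * _).
rewrite /raise_at inE eqxx /one_body (bigD1 m) //= [in RHS](bigD1 m) //= x'E eqxx.
rewrite [X in _ = _ * (_ * (_ * X))](_ : _ = \prod_(i | i != m) ((s l - x i + L i) / (s l - x i + a))); last first.
  by apply: eq_bigr => i im; rewrite x'E (negbTE im) addr0.
set V := \prod_(i | i != m) _.
have e1 : s l + a - x m - a + L m = s l - x m + L m by ring.
have e2 : s l - (x m + a) + L m = s l - x m - a + L m by ring.
have e3 : s l - (x m + a) + a = s l - x m by ring.
rewrite e1 e2 e3; have := nd1 l m; have := nd2 l m; have := nd3 l m; have := nd4 l m.
rewrite -/s mul0r !addr0 mul1r mulN1r => h4 h3 h2 h1; field.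
by rewrite h1 h2 h3 addrAC h4.
Qed.

Lemma section_x_shift : is_section x' phi'.
Proof.
move=> t l; rewrite /phi' sec (eq_x_ratio _ _ _ _ (cyclic_point_shift _ _)).
by rewrite -[LHS]mulrA -[RHS]mulrA s_ratio_x_ratio.
Qed.

Lemma x_ratio_neq0 t : x_ratio a x L m (cyclic_point t) != 0.
Proof.
apply/prodf_neq0 => v _; have [h1 _ _ _ _] := nd t 0; have [_ h2 _ _ _] := nd t (-1).
have := h1 v m; have := h2 v m; rewrite mul0r addr0 mulN1r => g2 g1.
by rewrite mulf_neq0 // invr_eq0 addrAC.
Qed.

(** The step backwards, needed for negative coordinates; it divides by the nonzero [x_ratio]. *)
Lemma section_x_unshift : is_section x' phi' -> is_section x phi.
Proof.
move=> sec' t l; have := sec' t l.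
rewrite /phi' -[RHS]mulrA -s_ratio_x_ratio (eq_x_ratio _ _ _ _ (cyclic_point_shift _ _)).
rewrite [RHS]mulrA; apply: mulIf.
by rewrite -(eq_x_ratio _ _ _ _ (cyclic_point_shift _ _)) x_ratio_neq0.
Qed.

End KappaStep.
End Sections.

(** * The flat section along the s-lattice *)

Section PathWeight.
Variables (K : fieldType) (p n r : nat) (a kappa : K) (x L : 'I_n -> K).
Hypothesis hp : p \in [pchar K].
Hypothesis hp2 : (2 < p)%N.
Hypothesis a0 : a != 0.
Variable s0 : 'I_r -> K.
Local Notation pt := (lattice_point a s0).
Local Notation ratio := (s_ratio a kappa x L).
Hypothesis reg : forall u, regular_at a x L (pt u).

(** The points on the staircase path of the definition of J: coordinates before l are already at
    their final value, those after l still at 0. *)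
Definition path_step (u : 'I_r -> nat) (l : 'I_r) (d : nat) : 'I_r -> nat :=
  fun j => if (j < l)%N then u j else if j == l then d else 0%N.

(** [u] is not bounded by p, so that a whole period can be appended to a path. *)
Definition path_weight (u : 'I_r -> nat) : K :=
  \prod_l \prod_(d < u l) ratio (pt (path_step u l d)) l.

Lemma eq_pt u u' : u =1 u' -> pt u =1 pt u'.
Proof. by move=> E k; rewrite /lattice_point E. Qed.

Lemma eq_path_weight u u' : u =1 u' -> path_weight u = path_weight u'.
Proof.
move=> E; apply: eq_bigr => l _; rewrite E; apply: eq_bigr => d _.
by apply: eq_s_ratio; apply: eq_pt => j; rewrite /path_step E.
Qed.

Definition incr (l : 'I_r) (c : nat) (u : 'I_r -> nat) : 'I_r -> nat :=
  fun k => (u k + (if k == l then c else 0))%N.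

Lemma pt_incr l u : pt (incr l 1 u) =1 raise_at a [set l] (pt u).
Proof.
move=> k; rewrite /lattice_point /raise_at /incr inE.
by case: eqP => _; rewrite ?addr0 ?addn0 // natrD mulrDr mulr1 addrA.
Qed.

Lemma ratio_incr u k l : k != l ->
  ratio (pt u) l * ratio (pt (incr l 1 u)) k = ratio (pt u) k * ratio (pt (incr k 1 u)) l.
Proof.
move=> kl; rewrite !(eq_s_ratio _ _ _ _ _ (pt_incr _ _)).
exact: s_ratio_comm.
Qed.

(** A strip of D elementary squares, each commuting by [ratio_incr]: the step in direction l is
    pushed through row k of the path. *)
Lemma path_row_incr (l k : 'I_r) (u : 'I_r -> nat) (D : nat) : (l < k)%N ->
  ratio (pt (path_step u k 0)) l *
    \prod_(d < D) ratio (pt (path_step (incr l 1 u) k d)) k =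
  (\prod_(d < D) ratio (pt (path_step u k d)) k) * ratio (pt (path_step u k D)) l.
Proof.
move=> lk; have kl : k != l by rewrite -val_eqE neq_ltn lk orbT.
elim: D => [|D IH]; first by rewrite !big_ord0 mulr1 mul1r.
rewrite !big_ord_recr /= mulrA IH -[LHS]mulrA -[RHS]mulrA; congr (_ * _).
have E1 : pt (path_step (incr l 1 u) k D) =1 pt (incr l 1 (path_step u k D)).
  apply: eq_pt => j; rewrite /path_step /incr.
  case: (j =P l) => [->|_]; first by rewrite lk.
  by rewrite !addn0; case: ifP.
have E2 : pt (path_step u k D.+1) =1 pt (incr k 1 (path_step u k D)).
  apply: eq_pt => j; rewrite /path_step /incr.
  case: (j =P k) => [->|_]; first by rewrite ltnn addn1.
  by rewrite addn0.
rewrite (eq_s_ratio _ _ _ _ _ E1) (eq_s_ratio _ _ _ _ _ E2).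
exact: ratio_incr.
Qed.

(** Path independence on N^r, from flatness alone. The Bethe equations enter only with
    periodicity. *)
Lemma path_weight_incr (l : 'I_r) (u : 'I_r -> nat) :
  path_weight (incr l 1 u) = path_weight u * ratio (pt u) l.
Proof.
pose G u (k : 'I_r) := \prod_(d < u k) ratio (pt (path_step u k d)) k.
pose pre b u : 'I_r -> nat := fun j => if (j < b)%N then u j else 0%N.
(* Rows are added one by one: those before l are unaffected, row l gains its last factor, and this
   factor is then carried through the later rows. *)
have H (b : nat) : (b <= r)%N ->
   \prod_(k < r | (k < b)%N) G (incr l 1 u) k =
   (\prod_(k < r | (k < b)%N) G u k) * (if (l < b)%N then ratio (pt (pre b u)) l else 1).
  elim: b => [|b IH] br; first by rewrite !big_pred0 // mulr1.
  pose k := Ordinal br.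
  have split_prod F : \prod_(j < r | (j < b.+1)%N) F j = (\prod_(j < r | (j < b)%N) F j) * F k :> K.
    rewrite (bigD1 k) //= mulrC; congr (_ * _); apply: eq_bigl => j.
    by rewrite ltnS -val_eqE /=; case: ltngtP.
  have preS : pt (pre b.+1 u) =1 pt (path_step u k (u k)).
    apply: eq_pt => j; rewrite /pre /path_step -val_eqE /= ltnS leq_eqVlt.
    by case: (ltngtP j b) => //= jb; congr (u _); apply: val_inj.
  rewrite !split_prod IH ?(ltnW br) // (eq_s_ratio _ _ _ _ _ preS) ltnS.
  case: (ltngtP l b) => lb.
  - rewrite -[LHS]mulrA -[RHS]mulrA; congr (_ * _).
    have -> : ratio (pt (pre b u)) l = ratio (pt (path_step u k 0)) l.
      apply: eq_s_ratio; apply: eq_pt => j.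
      by rewrite /pre /path_step; case: ifP => // _; case: ifP.
    have kE : incr l 1 u k = u k.
      by rewrite /incr (_ : (k == l) = false) ?addn0 // -val_eqE /= gtn_eqF.
    by rewrite /G kE; apply: path_row_incr.
  - rewrite !mulr1; congr (_ * _); have kE : incr l 1 u k = u k.
      by rewrite /incr (_ : (k == l) = false) ?addn0 // -val_eqE /= ltn_eqF.
    rewrite /G kE; apply: eq_bigr => d _; apply: eq_s_ratio; apply: eq_pt => j.
    rewrite /path_step /incr /=; case: ifP => // jb.
    by rewrite (_ : (j == l) = false) ?addn0 // -val_eqE /= ltn_eqF // (ltn_trans jb).
  have kl : k = l by apply: val_inj.
  rewrite mulr1 -[RHS]mulrA; congr (_ * _); have lE : incr l 1 u l = (u l).+1 by rewrite /incr eqxx addn1.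
  rewrite kl /G lE big_ord_recr /=.
  have E d : pt (path_step (incr l 1 u) l d) =1 pt (path_step u l d).
    apply: eq_pt => j; rewrite /path_step /incr; case: ifP => // jl.
    by rewrite (_ : (j == l) = false) ?addn0 // -val_eqE /= ltn_eqF.
  by congr (_ * _); [apply: eq_bigr => d _|]; apply: eq_s_ratio.
have := H r (leqnn r); rewrite ltn_ord.
have E (F : 'I_r -> K) : \prod_(k < r | (k < r)%N) F k = \prod_k F k.
  by apply: eq_bigl => k; rewrite ltn_ord.
rewrite !E /path_weight => ->; congr (_ * _); apply: eq_s_ratio; apply: eq_pt => j.
by rewrite /pre ltn_ord.
Qed.

Lemma path_weight_incrn (l : 'I_r) (c : nat) (u : 'I_r -> nat) :
  path_weight (incr l c u) = path_weight u * \prod_(d < c) ratio (pt (incr l d u)) l.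
Proof.
elim: c => [|c IH].
  by rewrite big_ord0 mulr1; apply: eq_path_weight => k; rewrite /incr if_same addn0.
rewrite big_ord_recr mulrA -IH /= -path_weight_incr; apply: eq_path_weight => k.
by rewrite /incr; case: eqP => _; rewrite ?addn0 // -addnA addn1.
Qed.

Hypothesis bethe : forall l, kappa ^+ p
  * (\prod_(i < n) ((h_p p a (s0 l) - h_p p a (x i) + h_p p a (L i)) / (h_p p a (s0 l) - h_p p a (x i))))
  * (\prod_(j < r | j != l)
      ((h_p p a (s0 l) - h_p p a (s0 j) - h_p p a 1) / (h_p p a (s0 l) - h_p p a (s0 j) + h_p p a 1)))
  = 1.

Lemma h_p_pt u l : h_p p a (pt u l) = h_p p a (s0 l).
Proof.
rewrite /lattice_point (h_pD hp) (_ : a * _ = (u l)%:~R * a) ?(h_p_lattice hp hp2) ?addr0 //.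
by rewrite mulrC.
Qed.

(** Over a full period each linear factor becomes an [h_p], and the extra shifts by a disappear. In
    the two-body part (y + a) / y then cancels, leaving exactly the Bethe equation. *)
Lemma prod_ratio_row u l : \prod_(d < p) ratio (pt (incr l d u)) l = 1.
Proof.
have ptE d k : pt (incr l d u) k = pt u k + (if k == l then a * d%:R else 0).
  rewrite /lattice_point /incr natrD mulrDr addrA.
  by case: eqP => _ //; rewrite mulr0.
have hprod y : \prod_(d < p) (y + a * d%:R) = h_p p a y by apply: prod_h_p.
have hprod_a y : \prod_(d < p) (y + a * d%:R + a) = h_p p a y.
  under eq_bigr do rewrite addrAC.
  rewrite hprod (h_pD hp) (_ : h_p p a a = 0) ?addr0 //.
  by have := h_p_lattice hp hp2 a 1; rewrite mul1r.
rewrite -[RHS](bethe l) /s_ratio big_split /one_body big_split /= prodr_const card_ord.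
congr (_ * _ * _).
  rewrite exchange_big; apply: eq_bigr => i _ /=; rewrite prodf_div.
  congr (_ / _).
    transitivity (\prod_(d < p) (pt u l - x i + L i + a * d%:R)).
      by apply: eq_bigr => d _; rewrite ptE eqxx; ring.
    by rewrite hprod (h_pD hp a (pt u l - x i)) (h_pB hp hp2 a (pt u l)) h_p_pt.
  transitivity (\prod_(d < p) (pt u l - x i + a * d%:R + a)).
    by apply: eq_bigr => d _; rewrite ptE eqxx; ring.
  by rewrite hprod_a (h_pB hp hp2 a (pt u l)) h_p_pt.
rewrite exchange_big; apply: eq_bigr => j jl /=.
have pe d : pt (incr l d u) l - pt (incr l d u) j = (pt u l - pt u j) + a * d%:R.
  by rewrite !ptE eqxx (negbTE jl); ring.
under eq_bigr do rewrite pe.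
rewrite /two_body prodf_div !big_split /= hprod hprod_a.
transitivity (h_p p a (pt u l - pt u j) * h_p p a (pt u l - pt u j - 1) /
   (h_p p a (pt u l - pt u j) * h_p p a (pt u l - pt u j + 1))).
  congr (_ * _ / (_ * _)).
    by rewrite -hprod; apply: eq_bigr => d _; ring.
  by rewrite -hprod_a; apply: eq_bigr => d _; ring.
have h0 : h_p p a (pt u l - pt u j) != 0.
  rewrite -hprod; apply/prodf_neq0 => d _; rewrite -pe.
  by have [_ + _] := reg (incr l d u) => /(_ l j); rewrite eq_sym => /(_ jl)[].
by rewrite -mulf_div divff // mul1r (h_pD hp a _ 1) (h_pB hp hp2 a _ 1) (h_pB hp hp2 a (pt u l)) !h_p_pt.
Qed.

Lemma path_weight_section :
  is_section (p := p) a kappa L s0 x (fun t => path_weight (fun k => t k)).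
Proof.
move=> t l; rewrite -path_weight_incr.
set u0 : 'I_r -> nat := fun k => cyclic_shift [set l] t k.
have u0E k : u0 k = if k == l then ((t k).+1 %% p)%N else t k.
  by rewrite /u0 ffunE inE; case: eqP.
have [tl|tl] := ltnP (t l).+1 p.
  apply: eq_path_weight => k; rewrite /= u0E /incr.
  by case: eqP => [->|_]; rewrite ?addn0 // modn_small // addn1.
have tE : (t l).+1 = p by apply/eqP; rewrite eqn_leq tl andbT ltn_ord.
(* At the wrap-around the shifted index has l-th coordinate 0; appending a full period of weight 1
   brings it to p, one step beyond [t]. *)
transitivity (path_weight (incr l p u0)).
  by rewrite path_weight_incrn prod_ratio_row mulr1.
apply: eq_path_weight => k; rewrite /incr u0E.
by case: eqP => [->|//]; rewrite tE modnn add0n addn1.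
Qed.

End PathWeight.

(** * The p-curvature *)

(** [P] will be homogeneity of degree r, where injectivity of the R-matrices is known. *)
Lemma foldl_inj_in (T : Type) (U : eqType) (P : T -> Prop) (f : T -> U -> T) (l : seq U) v w :
  (forall u v, u \in l -> P v -> P (f v u)) ->
  (forall u v w, u \in l -> P v -> P w -> f v u = f w u -> v = w) ->
  P v -> P w -> foldl f v l = foldl f w l -> v = w.
Proof.
elim: l v w => // u l IH v w hP hf Pv Pw /= E.
apply: (hf u) => //; first by rewrite inE eqxx.
apply: IH E; try by [apply: hP; rewrite ?inE ?eqxx].
- by move=> u' v' ul; apply: hP; rewrite inE ul orbT.
- by move=> u' v' w' ul; apply: hf; rewrite inE ul orbT.
Qed.

Lemma foldl_pred (T : Type) (U : eqType) (P : T -> Prop) (f : T -> U -> T) (l : seq U) v :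
  (forall u v, u \in l -> P v -> P (f v u)) -> P v -> P (foldl f v l).
Proof.
elim: l v => // u l IH v hP Pv /=; apply: IH; last by apply: hP => //; rewrite inE eqxx.
by move=> u' v' ul; apply: hP; rewrite inE ul orbT.
Qed.

Section Curvature.
Variables (K : fieldType) (p n r : nat) (a kappa : K) (L : 'rV[K]_n).
Hypothesis hp : p \in [pchar K].
Hypothesis hp2 : (2 < p)%N.
Hypotheses (a0 : a != 0) (kappa0 : kappa != 0).
Variable R : K -> K -> tensor2_end K.
Hypothesis hR : forall L1 L2 : K, is_Rmatrix L1 L2 (R L1 L2).
Variable s0 : 'I_r -> K.
Local Notation T := {ffun 'I_r -> 'I_p}.
Local Notation pt := (@cyclic_point K p r a s0).
Local Notation J := (fun (x : 'rV[K]_n) => weight_comb pt (L 0) (fun i k => (i < k)%N) (x 0)).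
Local Notation Psi m x := (x_ratio a (x 0) (L 0) m).

Lemma x_ratio_step (x : 'rV[K]_n) (m : 'I_n) (b : K) i :
  (x + b *: delta_mx 0 m) 0 i = x 0 i + (if i == m then b else 0).
Proof. by rewrite !mxE eqxx /=; case: eqP => _; rewrite ?mulr1 ?mulr0. Qed.

Lemma lattice_close_pt t : lattice_close a (pt t) s0.
Proof. by move=> l; exists (t l); rewrite /cyclic_point /lattice_point mulrC. Qed.

Section Point.
Variable x : 'rV[K]_n.
Hypothesis nd : orbit_regular a (L 0) s0 (x 0).

Lemma orbit_regular_pt t : orbit_regular a (L 0) (pt t) (x 0).
Proof.
apply: orbit_regular_shift nd _ _; first exact: lattice_close_pt.
by move=> i; exists 0; rewrite mul0r addr0.
Qed.

Lemma orbit_regular_x (y : 'rV[K]_n) : lattice_close a (y 0) (x 0) -> orbit_regular a (L 0) s0 (y 0).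
Proof.
by move=> yx; apply: orbit_regular_shift nd _ yx => i; exists (0 : int); rewrite mul0r addr0.
Qed.

Lemma R_den_neq0 m j b (c : int) : j != m -> (b < r)%N ->
  L 0 m - b%:R - (x 0 m - x 0 j + c%:~R * a) != 0.
Proof.
move=> jm br; have [_ _ _ _ h] := nd c.
have := h m j _ b br; rewrite eq_sym => /(_ jm); apply: contraNneq => E.
rewrite -oppr_eq0 -E; apply/eqP; ring.
Qed.

(** The denominators of the inverse R-matrix, from nondegeneracy with j and m exchanged. *)
Lemma R_den_neq0' m j b (c : int) : j != m -> (b < r)%N ->
  L 0 j - b%:R - - (x 0 m - x 0 j + c%:~R * a) != 0.
Proof.
move=> jm br; have [_ _ _ _ h] := nd (- c).
have := h j m jm b br; apply: contraNneq => E.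
rewrite -oppr_eq0 -E rmorphN; apply/eqP; rewrite /=; ring.
Qed.

Lemma qKZ_weight_comb m phi : is_section (p := p) a kappa (L 0) s0 (x 0) phi ->
  qKZ a kappa L R m x (J x phi) =
  J (x + a *: delta_mx 0 m) (fun t => phi t * Psi m x (pt t)).
Proof.
move=> sec; apply: qKZ_foldl_weight_comb => //.
- move=> t k l E; have [_ _ + _ _] := orbit_regular_pt t 0 => /(_ k l).
  rewrite mul0r addr0 E subrr eqxx; case: eqP => // _ /(_ isT) //.
- by move=> i; rewrite x_ratio_step.
- move=> j jm b; rewrite card_ord => br.
  by have := R_den_neq0 0 jm br; rewrite mul0r addr0.
- move=> j jm b; rewrite card_ord => br.
  by have := R_den_neq0 1 jm br; rewrite mul1r.
apply: (kappa_h2_weight_comb hp) => //; first exact: orbit_regular_pt.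
by move=> i; rewrite x_ratio_step.
Qed.

Lemma section_next m phi : is_section (p := p) a kappa (L 0) s0 (x 0) phi ->
  is_section (p := p) a kappa (L 0) s0 ((x + a *: delta_mx 0 m) 0)
    (fun t => phi t * Psi m x (pt t)).
Proof.
move=> sec; apply: section_x_shift => //; first exact: orbit_regular_pt.
by move=> i; rewrite x_ratio_step.
Qed.

Lemma R_at_homog_inj m j (c : int) v w : j != m ->
  let RR := R_at (R (L 0 m) (L 0 j)) m j (x 0 m - x 0 j + c%:~R * a) in
  v \is r.-homog for mdeg ->
  RR v \is r.-homog for mdeg /\ (w \is r.-homog for mdeg -> RR v = RR w -> v = w).
Proof.
move=> jm RR dv; have mj : m != j by rewrite eq_sym.
have hc b : (b < r)%N -> _ := @R_den_neq0 m j b c jm.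
have hc' b : (b < r)%N -> _ := @R_den_neq0' m j b c jm.
split; first exact: (R_at_homog mj (hR _ _) hc (leqnn r)).
move=> dw E; apply/eqP; rewrite -subr_eq0; apply/eqP.
apply: (R_at_inj mj (hR _ _) (hR _ _) hc hc' (leqnn r)); first by rewrite rpredB.
by rewrite [R_at _ _ _ _ _]linearB /= -/(RR v) E subrr.
Qed.

(** Each R-matrix in the product is injective in degree r, and [kappa_h2] is diagonal with nonzero
    entries. This determines a parallel transport in the backward directions as well. *)
Lemma qKZ_inj m v w : v \is r.-homog for mdeg -> w \is r.-homog for mdeg ->
  qKZ a kappa L R m x v = qKZ a kappa L R m x w -> v = w.
Proof.
move=> dv dw; pose P (v : {mpoly K[n]}) := v \is r.-homog for mdeg : Prop.
have R0 (j : 'I_n) u u' : j != m ->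
  let RR := R_at (R (L 0 m) (L 0 j)) m j (x 0 m - x 0 j) in
  P u -> P (RR u) /\ (P u' -> RR u = RR u' -> u = u').
  by move=> jm /=; have := @R_at_homog_inj m j 0 u u' jm; rewrite mul0r addr0.
have R1 (j : 'I_n) u u' : j != m ->
  let RR := R_at (R (L 0 m) (L 0 j)) m j (x 0 m - x 0 j + a) in
  P u -> P (RR u) /\ (P u' -> RR u = RR u' -> u = u').
  by move=> jm /=; have := @R_at_homog_inj m j 1 u u' jm; rewrite mul1r.
have neq_gt (j : 'I_n) : j \in [seq j : 'I_n <- enum 'I_n | (m < j)%N] -> j != m.
  by rewrite mem_filter => /andP[mj _]; rewrite -val_eqE neq_ltn mj orbT.
have neq_lt (j : 'I_n) : j \in [seq j : 'I_n <- enum 'I_n | (j < m)%N] -> j != m.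
  by rewrite mem_filter => /andP[mj _]; rewrite -val_eqE neq_ltn mj.
have kP u : P u -> P (kappa_h2 kappa m u).
  by apply: dhomog_ext_basis => q qd; apply: rpredZ; rewrite dhomogX /= qd.
have v1P u : P u -> P (foldl (fun w j => R_at (R (L 0 m) (L 0 j)) m j (x 0 m - x 0 j) w)
    u [seq j : 'I_n <- enum 'I_n | (m < j)%N]).
  by apply: foldl_pred => j u' /neq_gt jm Pu'; case: (R0 j u' u' jm Pu').
have inj2 u u' : P u -> P u' ->
  foldl (fun w j => R_at (R (L 0 m) (L 0 j)) m j (x 0 m - x 0 j + a) w) u
    [seq j : 'I_n <- enum 'I_n | (j < m)%N] =
  foldl (fun w j => R_at (R (L 0 m) (L 0 j)) m j (x 0 m - x 0 j + a) w) u'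
    [seq j : 'I_n <- enum 'I_n | (j < m)%N] -> u = u'.
  move=> Pu Pu'; apply: (foldl_inj_in (P := P)) => // [j z /neq_lt jm Pz|j z z' /neq_lt jm Pz Pz' E].
    by case: (R1 j z z jm Pz).
  by have [_ H] := R1 j z z' jm Pz; exact: H Pz' E.
have inj1 u u' : P u -> P u' ->
  foldl (fun w j => R_at (R (L 0 m) (L 0 j)) m j (x 0 m - x 0 j) w) u
    [seq j : 'I_n <- enum 'I_n | (m < j)%N] =
  foldl (fun w j => R_at (R (L 0 m) (L 0 j)) m j (x 0 m - x 0 j) w) u'
    [seq j : 'I_n <- enum 'I_n | (m < j)%N] -> u = u'.
  move=> Pu Pu'; apply: (foldl_inj_in (P := P)) => // [j z /neq_gt jm Pz|j z z' /neq_gt jm Pz Pz' E].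
    by case: (R0 j z z jm Pz).
  by have [_ H] := R0 j z z' jm Pz; exact: H Pz' E.
rewrite /qKZ => /(inj2 _ _ (kP _ (v1P _ dv)) (kP _ (v1P _ dw))) E.
apply: (inj1 _ _ dv dw).
apply/mpolyP => q; have := congr1 (mcoeff q) E; rewrite !mcoeff_diag.
by apply: mulIf; rewrite expf_neq0.
Qed.

End Point.

Lemma p_curvature_weight_comb (x : 'rV[K]_n) m phi :
  orbit_regular a (L 0) s0 (x 0) ->
  is_section (p := p) a kappa (L 0) s0 (x 0) phi ->
  p_curvature p a kappa L R m x (J x phi) =
  curv_eigenvalue p a L (\row_k s0 k) x m *: J x phi.
Proof.
move=> nd sec.
pose xc (c : nat) := x + (a * c%:R) *: delta_mx 0 m.
pose phic (c : nat) (t : T) := phi t * \prod_(d < c) Psi m (xc d) (pt t).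
have x0E c : lattice_close a (xc c 0) (x 0).
  move=> i; rewrite x_ratio_step; case: eqP => _; last by exists 0; rewrite mul0r.
  by exists c; rewrite mulrC.
have xS c : xc c.+1 = xc c + a *: delta_mx 0 m.
  by rewrite /xc -addrA -scalerDl -natr1 mulrDr mulr1.
have secc c : is_section (p := p) a kappa (L 0) s0 (xc c 0) (phic c).
  elim: c => [|c IH].
    move=> t l; rewrite /phic !big_ord0 !mulr1 sec.
    by rewrite /xc mulr0 scale0r addr0.
  have := section_next (orbit_regular_x nd (x0E c)) m IH; rewrite -xS.
  by move=> H t l; have := H t l; rewrite /phic !big_ord_recr /= !mulrA.
have step c : foldl (fun w c => qKZ a kappa L R m (x + (a * c%:R) *: delta_mx 0 m) w)
    (J x phi) (iota 0 c) = J (xc c) (phic c).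
  elim: c => [|c IH].
    apply: eq_weight_comb => // [i|t]; first by rewrite /xc mulr0 scale0r addr0.
    by rewrite /phic big_ord0 mulr1.
  have iS : iota 0 c.+1 = iota 0 c ++ [:: c] by rewrite -addn1 iotaD.
  rewrite iS foldl_cat IH /= -/(xc c).
  rewrite (qKZ_weight_comb (orbit_regular_x nd (x0E c)) m (secc c)) xS.
  by apply: eq_weight_comb => // t; rewrite /phic big_ord_recr /= mulrA.
rewrite /p_curvature step scaler_sumr; apply: eq_bigr => t _.
rewrite scalerA; congr (_ *: _); last first.
  (* The total shift a * p vanishes in K. *)
  by apply: eq_weight_sum => // i; rewrite /xc (pcharf0 hp) mulr0 scale0r addr0.
rewrite /phic mulrC; congr (_ * _); rewrite exchange_big /=.
apply: eq_bigr => l _; rewrite mxE prodf_div.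
(* This makes the accumulated factor independent of [t], so it leaves the sum as a scalar. *)
have hpt : h_p p a (pt t l) = h_p p a (s0 l) by apply: h_p_pt.
have xcm (d : nat) : xc d 0 m = x 0 m + a * d%:R by rewrite x_ratio_step eqxx.
congr (_ / _).
  transitivity (\prod_(d < p) (pt t l - x 0 m - a * d%:R)).
    by apply: eq_bigr => d _; rewrite xcm; ring.
  by rewrite (prod_h_pN hp hp2) // (h_pB hp hp2 a (pt t l)) hpt.
transitivity (\prod_(d < p) (pt t l - x 0 m + L 0 m - a - a * d%:R)).
  by apply: eq_bigr => d _; rewrite xcm; ring.
rewrite (prod_h_pN hp hp2) // (h_pB hp hp2 a _ a) (h_pD hp a (pt t l - x 0 m)).
rewrite (h_pB hp hp2 a (pt t l)) hpt (_ : h_p p a a = 0) ?subr0 //.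
by have := h_p_lattice hp hp2 a 1; rewrite mul1r.
Qed.

End Curvature.

(** * Symmetrization *)

Section Symmetrization.
Variables (E : fieldType) (n : nat) (f : 'I_n -> E -> E).

(** [weight_term] for the natural order, with [f i] standing for all the linear factors of a
    variable at site i. *)
Definition attach_term (I : finType) (s : I -> E) (g : {ffun I -> 'I_n}) : E :=
  (\prod_j f (g j) (s j)) *
  \prod_j \prod_k (if (g j < g k)%N then pair_factor (s j) (s k) else 1).

Definition perm_term r (s : 'I_r -> E) (b : {ffun 'I_r -> 'I_n}) (sigma : 'S_r) : E :=
  (\prod_j f (b j) (s (sigma j))) *
  \prod_(j < r) \prod_(k < r | (j < k)%N) pair_factor (s (sigma j)) (s (sigma k)).

Definition drop_at r (T : Type) (l : 'I_r.+1) (g : {ffun 'I_r.+1 -> T}) : {ffun 'I_r -> T} :=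
  [ffun k => g (lift l k)].

Definition insert_at r (T : Type) (l : 'I_r.+1) (i : T) (g : {ffun 'I_r -> T}) : {ffun 'I_r.+1 -> T} :=
  [ffun k => if unlift l k is Some k' then g k' else i].

Lemma insert_atK r (T : Type) (l : 'I_r.+1) (i : T) (g : {ffun 'I_r -> T}) :
  drop_at l (insert_at l i g) = g.
Proof. by apply/ffunP => k; rewrite !ffunE liftK. Qed.

Lemma drop_atK r (T : Type) (l : 'I_r.+1) (g : {ffun 'I_r.+1 -> T}) :
  insert_at l (g l) (drop_at l g) = g.
Proof. by apply/ffunP => k; rewrite !ffunE; case: unliftP => [k' ->|->//]; rewrite ffunE. Qed.

Lemma fiber_count_drop r (l : 'I_r.+1) (g : {ffun 'I_r.+1 -> 'I_n}) :
  fiber_count g = (U_(g l) + fiber_count (drop_at l g))%MM.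
Proof.
rewrite !fiber_countE (bigD1_ord l) //=; congr (_ + _)%MM.
by apply: eq_bigr => k _; rewrite ffunE.
Qed.

(** A variable at a minimal site is never the second member of a contributing pair. *)
Lemma attach_term_drop r (l : 'I_r.+1) (s : 'I_r.+1 -> E) (g : {ffun 'I_r.+1 -> 'I_n}) :
  (forall k, g l <= g k)%N ->
  attach_term s g = f (g l) (s l) * attach_term (s \o lift l) (drop_at l g) *
   \prod_k (if (g l < g (lift l k))%N then pair_factor (s l) (s (lift l k)) else 1).
Proof.
move=> gl; rewrite /attach_term !(bigD1_ord l (P := predT)) //= ltnn mul1r.
have -> : \prod_(i < r) \prod_(k < r.+1) (if (g (lift l i) < g k)%N
     then pair_factor (s (lift l i)) (s k) else 1) =
   \prod_j \prod_k (if (drop_at l g j < drop_at l g k)%N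
       then pair_factor (s (lift l j)) (s (lift l k)) else 1).
  apply: eq_bigr => i _; rewrite (bigD1_ord l) //= ltnNge gl mul1r.
  by apply: eq_bigr => k _; rewrite !ffunE.
have -> : \prod_(i < r) f (g (lift l i)) (s (lift l i)) =
   \prod_j f (drop_at l g j) (s (lift l j)) by apply: eq_bigr => i _; rewrite ffunE.
ring.
Qed.

Lemma perm_term_lift r (s : 'I_r.+1 -> E) (b : {ffun 'I_r.+1 -> 'I_n}) l (sigma : 'S_r) :
  perm_term s b (lift_perm ord0 l sigma) =
  f (b ord0) (s l) * (\prod_k pair_factor (s l) (s (lift l k))) *
  perm_term (s \o lift l) (drop_at ord0 b) sigma.
Proof.
rewrite /perm_term !big_ord_recl /= lift_perm_id.
have -> : \prod_(i < r.+1 | (0 < i)%N) pair_factor (s l) (s (lift_perm ord0 l sigma i)) =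
   \prod_k pair_factor (s l) (s (lift l k)).
  rewrite big_mkcond big_ord_recl /= mul1r.
  rewrite [RHS](reindex_inj (@perm_inj _ sigma)) /=.
  by apply: eq_bigr => k _; rewrite lift_perm_lift.
have -> : \prod_(i < r) f (b (lift ord0 i)) (s (lift_perm ord0 l sigma (lift ord0 i))) =
   \prod_j f (drop_at ord0 b j) (s (lift l (sigma j))).
  by apply: eq_bigr => i _; rewrite lift_perm_lift ffunE.
rewrite -!mulrA; congr (_ * _); rewrite mulrCA; congr (_ * (_ * _)).
apply: eq_bigr => j _; rewrite big_mkcond big_ord_recl /= mul1r [RHS]big_mkcond /=.
by apply: eq_bigr => k _; rewrite !lift_perm_lift.
Qed.

Lemma sum_perm_lift r (F : 'S_r.+1 -> E) :
  \sum_sigma F sigma = \sum_l \sum_(sigma : 'S_r) F (lift_perm ord0 l sigma).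
Proof.
pose h (u : 'I_r.+1 * 'S_r) := lift_perm ord0 u.1 u.2.
have injh : injective h.
  move=> [l t] [l' t'] /permP eqh; have := eqh ord0; rewrite !lift_perm_id => /= ll'.
  rewrite {l}ll' in eqh *; congr (_, _); apply/permP => k.
  by have := eqh (lift ord0 k); rewrite !lift_perm_lift => /lift_inj.
have bijh : bijective h by apply: inj_card_bij injh _; rewrite card_prod !card_Sn card_ord factS.
by rewrite (reindex h) ?pair_bigA //; apply: onW_bij.
Qed.

(** Induction on the variable l in the first position, whose site is the smallest one. A map g gives
    pair factors only between different sites; the surplus factors between l and the variables at
    the same site, summed over l, give the multiplicity of that site, one factor of the
    factorial. *)
Lemma sum_perm_term r (s : 'I_r -> E) (b : {ffun 'I_r -> 'I_n}) :
  injective s -> (forall j k : 'I_r, (j <= k)%N -> (b j <= b k)%N) ->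
  \sum_sigma perm_term s b sigma =
  (\prod_i ((fiber_count b i)`!)%:R) *
  \sum_(g | fiber_count g == fiber_count b) attach_term s g.
Proof.
elim: r s b => [|r IH] s b injs mono.
  have q0 (g : {ffun 'I_0 -> 'I_n}) : fiber_count g = 0%MM.
    by rewrite fiber_countE big_ord0.
  rewrite (big_pred1 (1%g : 'S_0)) => [|g]; last first.
    by apply/esym/eqP/permP => -[].
  rewrite (big_pred1 b) => [|g]; last first.
    by rewrite !q0 eqxx; apply/esym/eqP/ffunP => -[].
  by rewrite /perm_term /attach_term !big_ord0 big1 ?mulr1 // => i _; rewrite q0 mnm0E.
set b0 := b ord0.
(* The identity [sum_prod_ratio_set] with e = 1 on the fiber over [b0]. *)
have sum_b0 (g : {ffun 'I_r.+1 -> 'I_n}) : fiber_count g == fiber_count b ->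
   \sum_(l | g l == b0) \prod_(k < r)
      (if g (lift l k) == b0 then pair_factor (s l) (s (lift l k)) else 1)
   = (fiber_count b b0)%:R.
  move=> /eqP <-; rewrite mnmE -(@sum_prod_ratio_set _ _ s 1) //.
  apply: eq_big => [l|l lb0]; first by rewrite inE.
  rewrite [RHS]big_mkcond (bigD1_ord l) //= in_setD1 eqxx. rewrite [RHS]mul1r; apply: eq_bigr => k _.
  rewrite !inE (eq_sym (lift l k) l) neq_lift /=; case: ifP => // _.
  by rewrite pair_factorE // (inj_eq injs) neq_lift.
have fact_b0 : \prod_i ((fiber_count b i)`!)%:R =
   (fiber_count b b0)%:R * \prod_i ((fiber_count (drop_at ord0 b) i)`!)%:R :> E.
  rewrite (bigD1 b0) //= [in RHS](bigD1 b0) //= mulrA; congr (_ * _).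
    by rewrite (fiber_count_drop ord0 b) mnmDE mnm1E eqxx add1n factS natrM.
  apply: eq_bigr => i ib0; rewrite (fiber_count_drop ord0 b) mnmDE mnm1E.
  by rewrite eq_sym (negbTE ib0) add0n.
(* Equal fiber counts mean that [g] uses only sites of [b], and [b] is increasing. *)
have ge_b0 (g : {ffun 'I_r.+1 -> 'I_n}) k : fiber_count g = fiber_count b -> (b0 <= g k)%N.
  move=> E1; have : (0 < fiber_count b (g k))%N.
    by rewrite -E1 mnmE; apply/card_gt0P; exists k; rewrite inE.
  by rewrite mnmE => /card_gt0P[j]; rewrite inE => /eqP <-; apply: mono.
have mono' (j k : 'I_r) : (j <= k)%N -> (drop_at ord0 b j <= drop_at ord0 b k)%N.
  by move=> jk; rewrite !ffunE; apply: mono; rewrite /= !/bump /= !add1n.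
rewrite sum_perm_lift fact_b0.
transitivity (\sum_l f b0 (s l) * (\prod_k pair_factor (s l) (s (lift l k))) *
   ((\prod_i ((fiber_count (drop_at ord0 b) i)`!)%:R) *
    \sum_(g | fiber_count g == fiber_count (drop_at ord0 b)) attach_term (s \o lift l) g)).
  apply: eq_bigr => l _; rewrite -IH //; last by move=> j k /injs /lift_inj.
  by rewrite mulr_sumr; apply: eq_bigr => sigma _; rewrite perm_term_lift.
transitivity (\prod_i ((fiber_count (drop_at ord0 b) i)`!)%:R *
   \sum_(g | fiber_count g == fiber_count b) \sum_(l | g l == b0)
     attach_term s g * \prod_(k < r)
      (if g (lift l k) == b0 then pair_factor (s l) (s (lift l k)) else 1)); last first.
  rewrite [X in _ = X * _]mulrC -mulrA; congr (_ * _); rewrite mulr_sumr; apply: eq_bigr => g gb.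
  by rewrite -mulr_sumr sum_b0 // mulrC.
rewrite (exchange_big_dep predT) //= mulr_sumr; apply: eq_bigr => l _.
rewrite mulrCA; congr (_ * _); rewrite mulr_sumr.
rewrite [RHS](reindex_onto (insert_at l b0) (drop_at l)) /=; last first.
  by move=> g /andP[_ /eqP <-]; rewrite drop_atK.
have ins0 g : insert_at l b0 g l = b0 by rewrite ffunE unlift_none.
have insS g k : insert_at l b0 g (lift l k) = g k by rewrite ffunE liftK.
apply: eq_big => [g|g /eqP gb].
  rewrite insert_atK eqxx andbT ins0 eqxx andbT.
  rewrite (fiber_count_drop l) insert_atK ins0 (fiber_count_drop ord0 b).
  by apply/eqP/eqP => [->//|/addmI].
have cg : fiber_count (insert_at l b0 g) = fiber_count b.
  by rewrite (fiber_count_drop l) insert_atK ins0 gb (fiber_count_drop ord0 b).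
rewrite (attach_term_drop (l := l)) => [|k]; last by rewrite ins0 ge_b0.
rewrite insert_atK ins0 -[RHS]mulrA -big_split /=.
rewrite [LHS]mulrAC; congr (_ * _).
apply: eq_bigr => k _; have := ge_b0 _ (lift l k) cg; rewrite insS -val_eqE.
by case: ltngtP => // _ _; rewrite ?mulr1 ?mul1r.
Qed.

End Symmetrization.

Section Blocks.
Variables (n r : nat) (q : 'X_{1..n}).
Hypothesis qr : mdeg q = r.

Definition partial_deg (m : nat) : nat := (\sum_(k < n | (k < m)%N) q k)%N.

Lemma partial_degS (i : 'I_n) : partial_deg i.+1 = (partial_deg i + q i)%N.
Proof.
rewrite /partial_deg (bigD1 i) //= addnC; congr (_ + _)%N; apply: eq_bigl => k.
by rewrite ltnS -val_eqE /=; case: ltngtP.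
Qed.

Lemma partial_deg_mono m m' : (m <= m')%N -> (partial_deg m <= partial_deg m')%N.
Proof.
move=> mm'; rewrite /partial_deg big_mkcond [leqRHS]big_mkcond; apply: leq_sum => k _.
by case: ifP => // km; rewrite (leq_trans km).
Qed.

Lemma partial_degn : partial_deg n = r.
Proof. by rewrite -qr mdegE; apply: eq_bigl => k; rewrite ltn_ord. Qed.

(** The site of position j comes from the least m with j < [partial_deg m]; minimality skips the
    empty blocks. *)
Lemma block_fun : exists b : {ffun 'I_r -> 'I_n},
  forall (j : 'I_r) (i : 'I_n), (partial_deg i <= j < partial_deg i.+1)%N = (b j == i).
Proof.
suff H (j : 'I_r) : exists i : 'I_n, (partial_deg i <= j < partial_deg i.+1)%N.
  exists [ffun j => xchoose (H j)] => j i; rewrite ffunE.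
  have /andP[] := xchooseP (H j); set i0 := xchoose _ => l1 l2.
  apply/idP/eqP => [/andP[l3 l4]|<-]; last by rewrite l1.
  apply: val_inj; case: (ltngtP i0 i) => // ii.
    by have := leq_trans l2 (leq_trans (partial_deg_mono ii) l3); rewrite ltnn.
  by have := leq_trans l4 (leq_trans (partial_deg_mono ii) l1); rewrite ltnn.
have ex : exists m, (j < partial_deg m)%N by exists n; rewrite partial_degn ltn_ord.
case: (ex_minnP ex) => -[|m] jm min.
  by move: jm; rewrite /partial_deg big_pred0.
have mn : (m < n)%N by apply: min; rewrite partial_degn ltn_ord.
exists (Ordinal mn); rewrite /= jm andbT leqNgt; apply/negP => /min; by rewrite ltnn.
Qed.

Lemma block_fun_mono (b : {ffun 'I_r -> 'I_n}) :
  (forall (j : 'I_r) (i : 'I_n), (partial_deg i <= j < partial_deg i.+1)%N = (b j == i)) ->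
  forall j k : 'I_r, (j <= k)%N -> (b j <= b k)%N.
Proof.
move=> bE j k jk; rewrite leqNgt; apply/negP => bkj.
have /andP[l1 _] : (partial_deg (b j) <= j < partial_deg (b j).+1)%N by rewrite bE.
have /andP[_ l2] : (partial_deg (b k) <= k < partial_deg (b k).+1)%N by rewrite bE.
have := leq_trans l2 (leq_trans (partial_deg_mono bkj) (leq_trans l1 jk)).
by rewrite ltnn.
Qed.

Lemma block_fun_count (b : {ffun 'I_r -> 'I_n}) :
  (forall (j : 'I_r) (i : 'I_n), (partial_deg i <= j < partial_deg i.+1)%N = (b j == i)) ->
  fiber_count b = q.
Proof.
move=> bE; apply/mnmP => i; rewrite mnmE -sum1_card.
transitivity (\sum_(j < r | (partial_deg i <= j < partial_deg i.+1)%N) 1)%N.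
  by apply: eq_bigl => j; rewrite inE bE.
have le : (partial_deg i.+1 <= r)%N by rewrite -partial_degn partial_deg_mono.
transitivity (\sum_(partial_deg i <= j < partial_deg i.+1) 1)%N; last first.
  by rewrite sum_nat_const_nat muln1 partial_degS addKn.
rewrite [RHS](big_nat_widen _ _ r) // [RHS](big_nat_widenl _ 0) //= big_mkord.
by apply: eq_bigl => j; rewrite andbC.
Qed.

End Blocks.

(** Characteristic 0 serves to cancel the factorials; the right side makes sense over any field. *)
Lemma weight_coef_sum (E : fieldType) (n r : nat) (s : 'I_r -> E) (x L : 'I_n -> E)
    (q : 'X_{1..n}) :
  mdeg q = r -> injective s -> (forall m, (0 < m)%N -> m%:R != 0 :> E) ->
  weight_coef s x L q =
  \sum_(g : {ffun 'I_r -> 'I_n} | fiber_count g == q)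
    weight_term (fun i k : 'I_n => (i < k)%N) s x L g.
Proof.
move=> qr injs char0.
pose f (i : 'I_n) (y : E) := (\prod_(k < n | (k < i)%N) (y - x k + L k))
          * \prod_(k < n | (i < k)%N) (y - x k).
have [b bE] := block_fun qr.
have bq := block_fun_count qr bE.
have N0 : \prod_i ((q i)`!)%:R != 0 :> E.
  by apply/prodf_neq0 => i _; apply: char0; apply: fact_gt0.
rewrite /weight_coef; apply: (mulfI N0); rewrite mulVKf //.
transitivity (\sum_sigma perm_term f s b sigma).
  apply: eq_bigr => sigma _; congr (_ * _).
  rewrite (exchange_big_dep predT) //=; apply: eq_bigr => j _.
  rewrite (big_pred1 (b j)) // => i /=.
  by have := bE j i; rewrite /partial_deg => ->; rewrite eq_sym.
rewrite (sum_perm_term f injs (block_fun_mono bE)) bq; congr (_ * _).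
apply: eq_bigr => g _; congr (_ * _); apply: eq_bigr => j _.
rewrite /f big_mkcond [X in _ * X]big_mkcond -big_split; apply: eq_bigr => k _ /=.
by rewrite /site_factor -val_eqE /=; case: ltngtP; rewrite ?mulr1 ?mul1r.
Qed.

(** * Weight polynomials: from rational functions over Q to K *)

Section Numerators.
Variables (n r : nat) (A : comNzRingType).
Implicit Types (s : 'I_r -> A) (x L : 'I_n -> A) (g : {ffun 'I_r -> 'I_n}).

(** [weight_term] times the product of s_j - s_k over all ordered pairs, which clears each pair
    factor separately. Without division, it commutes with ring morphisms. *)
Definition weight_numer s x L g : A :=
  (\prod_j \prod_(k < n) (if (k < g j)%N then s j - x k + L k
                          else if k == g j then 1 else s j - x k)) *
  \prod_j \prod_(k | k != j) (if (g j < g k)%N then s j - s k + 1 else s j - s k).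

Definition diff_prod s : A := \prod_j \prod_(k | k != j) (s j - s k).

End Numerators.

Lemma rmorph_weight_numer (n r : nat) (A B : comNzRingType) (f : {rmorphism A -> B})
  (s : 'I_r -> A) (x L : 'I_n -> A) g :
  f (weight_numer s x L g) = weight_numer (f \o s) (f \o x) (f \o L) g.
Proof.
rewrite rmorphM !rmorph_prod; congr (_ * _); apply: eq_bigr => j _;
  rewrite rmorph_prod; apply: eq_bigr => k _ /=.
  by case: ifP => _; [|case: ifP => _]; rewrite ?(rmorphD, rmorphN, rmorph1).
by case: ifP => _; rewrite !(rmorphD, rmorphN, rmorph1).
Qed.

Lemma rmorph_diff_prod (r : nat) (A B : comNzRingType) (f : {rmorphism A -> B})
  (s : 'I_r -> A) : f (diff_prod s) = diff_prod (f \o s).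
Proof.
rewrite rmorph_prod; apply: eq_bigr => j _; rewrite rmorph_prod.
by apply: eq_bigr => k _; rewrite rmorphB.
Qed.

Lemma eq_weight_numer (n r : nat) (A : comNzRingType) (s s' : 'I_r -> A)
   (x x' L L' : 'I_n -> A) g : s =1 s' -> x =1 x' -> L =1 L' ->
  weight_numer s x L g = weight_numer s' x' L' g.
Proof.
move=> Es Ex EL; congr (_ * _); apply: eq_bigr => j _; apply: eq_bigr => k _.
  by rewrite Es Ex EL.
by rewrite !Es.
Qed.

Lemma weight_term_numer (E : fieldType) (n r : nat) (s : 'I_r -> E) (x L : 'I_n -> E) g :
  injective s ->
  weight_term (fun i k : 'I_n => (i < k)%N) s x L g * diff_prod s = weight_numer s x L g.
Proof.
move=> injs; rewrite -mulrA -big_split /=; congr (_ * _).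
apply: eq_bigr => j _; rewrite (bigID (fun k => k == j)) /= big_pred1_eq ltnn mul1r -big_split.
apply: eq_bigr => k kj /=; case: ifP => _; last by rewrite mul1r.
by rewrite /pair_factor divfK // subr_eq0 (inj_eq injs) eq_sym.
Qed.

Lemma diff_prod_neq0 (E : fieldType) (r : nat) (s : 'I_r -> E) :
  injective s -> diff_prod s != 0.
Proof.
move=> injs; apply/prodf_neq0 => j _; apply/prodf_neq0 => k kj.
by rewrite subr_eq0 (inj_eq injs) eq_sym.
Qed.

Section Transport.
Variables (n r : nat) (W : 'X_{1..n} -> {mpoly int[r + (n + n)]}).
Hypothesis hW : is_weight_poly W.
Local Notation N := (r + (n + n))%N.

(** Integer polynomials embed into the fraction field over Q, where both sides agree by
    [weight_coef_sum]. *)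
Lemma weight_poly_numer (q : 'X_{1..n}) : mdeg q = r ->
  W q * diff_prod (fun j : 'I_r => 'X_(lshift (n + n) j)) =
  \sum_(g : {ffun 'I_r -> 'I_n} | fiber_count g == q)
    weight_numer (fun j : 'I_r => 'X_(lshift (n + n) j))
      (fun i : 'I_n => 'X_(rshift r (lshift n i)))
      (fun i : 'I_n => 'X_(rshift r (rshift n i))) g.
Proof.
move=> qr; pose F := {fraction {mpoly rat[N]}}.
pose phi : {rmorphism {mpoly int[N]} -> F} :=
  (@FracField.tofrac _) \o map_mpoly (intr : int -> rat).
have phi_inj : injective phi.
  move=> u v /eqP; rewrite /= tofrac_eq => /eqP E; apply/mpolyP => t.
  have := congr1 (mcoeff t) E; rewrite !mcoeff_map_mpoly; exact: intr_inj.
have phiX k : phi 'X_k = FracField.tofrac 'X_k.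
  rewrite /=; congr FracField.tofrac; apply/mpolyP => t.
  by rewrite mcoeff_map_mpoly !mcoeffX; case: (_ == _).
apply: phi_inj; rewrite rmorphM rmorph_diff_prod rmorph_sum /=.
rewrite hW //.
set s := fun j : 'I_r => FracField.tofrac 'X_(lshift (n + n) j).
have injs : injective s.
  move=> j k /eqP; rewrite tofrac_eq => /eqP /(congr1 (mcoeff U_(lshift (n + n) j))).
  rewrite !mcoeffXU eqxx; case: eqP => [/lshift_inj -> //|_ /eqP].
  by rewrite oner_eq0.
rewrite weight_coef_sum //; last first.
  move=> m m0; rewrite -(rmorph_nat (@FracField.tofrac {mpoly rat[N]})) tofrac_eq0.
  by rewrite -(rmorph_nat (@mpolyC N rat)) mpolyC_eq0 Num.Theory.pnatr_eq0 -lt0n.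
rewrite mulr_suml; apply: eq_bigr => g _.
have -> : diff_prod (phi \o (fun j : 'I_r => 'X_(lshift (n + n) j))) = diff_prod s.
  by apply: eq_bigr => j _; apply: eq_bigr => k _; rewrite /s -!phiX.
rewrite weight_term_numer // -[RHS]/(phi _) rmorph_weight_numer.
by apply: eq_weight_numer => i; rewrite ?/s -phiX.
Qed.

(** The integral identity is specialised to K and divided by the differences, nonzero at distinct
    points. *)
Lemma weight_poly_eval (K : fieldType) (L : 'rV[K]_n) (s : 'rV[K]_r) (x : 'rV[K]_n) q :
  injective (s 0) -> mdeg q = r ->
  mmap intr (fun k => row_mx s (row_mx x L) 0 k) (W q) =
  \sum_(g : {ffun 'I_r -> 'I_n} | fiber_count g == q)
    weight_term (fun i k : 'I_n => (i < k)%N) (s 0) (x 0) (L 0) g.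
Proof.
move=> injs qr; set h := fun k => _.
pose psi : {rmorphism {mpoly int[N]} -> K} := mmap intr h.
have psiX k : psi 'X_k = h k by rewrite /= mmapX mmap1U.
have hs j : h (lshift (n + n) j) = s 0 j by rewrite /h row_mxEl.
have hx i : h (rshift r (lshift n i)) = x 0 i by rewrite /h row_mxEr row_mxEl.
have hL i : h (rshift r (rshift n i)) = L 0 i by rewrite /h !row_mxEr.
apply: (mulIf (diff_prod_neq0 injs)); rewrite [RHS]mulr_suml.
under [RHS]eq_bigr do rewrite weight_term_numer //.
have := congr1 psi (weight_poly_numer qr).
rewrite rmorphM rmorph_diff_prod rmorph_sum /= => E.
transitivity (mmap intr h (W q) * diff_prod (psi \o (fun j : 'I_r => 'X_(lshift (n + n) j)))).
  congr (_ * _); apply: eq_bigr => j _; apply: eq_bigr => k _ /=.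
  by rewrite -!hs -!psiX.
rewrite E; apply: eq_bigr => g _; rewrite -[LHS]/(psi _) rmorph_weight_numer.
by apply: eq_weight_numer => i /=; rewrite -?hs -?hx -?hL -?psiX.
Qed.

Lemma weight_fun_sum (K : fieldType) (L : 'rV[K]_n) (s : 'rV[K]_r) (x : 'rV[K]_n) :
  injective (s 0) ->
  weight_fun W L s x = weight_sum (fun i k : 'I_n => (i < k)%N) (s 0) (x 0) (L 0).
Proof.
move=> injs; rewrite /weight_fun /weight_sum.
have deg (g : {ffun 'I_r -> 'I_n}) : (mdeg (fiber_count g) < r.+1)%N.
  by rewrite mdeg_fiber_count card_ord.
rewrite [RHS](partition_big (fun g => BMultinom (deg g))
  (fun q : 'X_{1..n < r.+1} => mdeg q == r)) /=; last first.
  by move=> g _; rewrite mdeg_fiber_count card_ord.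
apply: eq_bigr => q /eqP qr; rewrite weight_poly_eval // scaler_suml.
apply: eq_big => [g|g /eqP -> //]; by rewrite -val_eqE.
Qed.

End Transport.

(** * Parallel transport *)

Section IntProduct.
Variables (K : fieldType) (psi : int -> K).

(** Solves F(k + 1) = F(k) psi(k), F(0) = 1 on all of Z. [Negz c] is -(c + 1), so the inverse
    involves psi at -1, ..., -(c + 1). *)
Definition int_prod (k : int) : K :=
  match k with
  | Posz c => \prod_(d < c) psi d
  | Negz c => (\prod_(d < c.+1) psi (- (d.+1)%:Z))^-1
  end.

Lemma int_prodS (k : int) : (forall z, psi z != 0) -> int_prod (k + 1) = int_prod k * psi k.
Proof.
move=> psi0; case: k => [c|c].
  by rewrite -PoszD addn1 /= big_ord_recr.
have -> : Negz c + 1 = - c%:Z by rewrite NegzE; lia.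
rewrite /int_prod big_ord_recr /= -NegzE invfM divfK //.
case: c => [|c].
  by have -> : - 0%:Z = 0%:Z by []; rewrite !big_ord0 invr1.
by have -> : - (c.+1)%:Z = Negz c by rewrite NegzE.
Qed.

End IntProduct.

(** The equivalence allows steps in both directions, so every point of Z^n is reached from 0. *)
Lemma int_row_ind (n : nat) (P : 'rV[int]_n -> Prop) :
  P 0 -> (forall k m, P k <-> P (k + delta_mx 0 m)) -> forall k, P k.
Proof.
move=> P0 PS k; rewrite (row_sum_delta k).
have step m (z : int) k' : P k' -> P (z *: delta_mx 0 m + k').
  move=> Pk'; elim/int_ind: z => [|c IH|c IH]; first by rewrite scale0r add0r.
    have -> : c.+1%:Z = c%:Z + 1 by rewrite -addn1.
    by rewrite scalerDl scale1r addrAC -(PS _ m).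
  rewrite (PS _ m); have -> : - c.+1%:Z = - c%:Z - 1 by rewrite -addn1 PoszD opprD.
  by rewrite scalerBl scale1r addrAC subrK.
by apply: big_rec => // m k' _; apply: step.
Qed.

Lemma lattice_shiftE (K : fieldType) (n : nat) (a : K) (x : 'rV[K]_n) k i :
  lattice_shift a x k 0 i = x 0 i + a * (k 0 i)%:~R.
Proof. by rewrite !mxE. Qed.

Lemma lattice_shift0 (K : fieldType) (n : nat) (a : K) (x : 'rV[K]_n) :
  lattice_shift a x 0 = x.
Proof. by apply/rowP => i; rewrite lattice_shiftE mxE mulr0z mulr0 addr0. Qed.

Lemma lattice_shiftS (K : fieldType) (n : nat) (a : K) (x : 'rV[K]_n) k m :
  lattice_shift a x (k + delta_mx 0 m) = lattice_shift a x k + a *: delta_mx 0 m.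
Proof.
apply/rowP => i; rewrite x_ratio_step !lattice_shiftE !mxE eqxx /= rmorphD mulrDr addrA.
by case: eqP => _; rewrite ?mulr1 ?mulr0.
Qed.

Lemma orbit_regular_point (K : fieldType) (p n r : nat) (a : K) (L : 'rV[K]_n)
    (s : 'rV[K]_r) (x : 'rV[K]_n) : p \in [pchar K] -> (2 < p)%N ->
  nondegenerate_point a L s x -> orbit_regular a (L 0) (s 0) (x 0).
Proof.
by move=> hp hp2 nd c; have [k ->] := pchar_intr_natr hp hp2 c; apply: nd.
Qed.

Lemma Jvec_weight_comb (K : fieldType) (n r p : nat) (a kappa : K) (L : 'rV[K]_n)
    (W : 'X_{1..n} -> {mpoly int[r + (n + n)]}) (s : 'rV[K]_r) (x : 'rV[K]_n) :
  is_weight_poly W ->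
  (forall u, injective (lattice_point a (s 0) u)) ->
  Jvec p a kappa L W s x =
  weight_comb (@cyclic_point K p r a (s 0)) (L 0) (fun i k : 'I_n => (i < k)%N) (x 0)
    (fun t => path_weight a kappa (x 0) (L 0) (s 0) (fun k => t k)).
Proof.
move=> hW inj_pt; apply: eq_bigr => t _; congr (_ *: _).
  apply: eq_bigr => l _; apply: eq_bigr => d _; rewrite -[LHS]/(s_ratio a kappa (x 0) (L 0) (_ 0) l).
  apply: eq_s_ratio => j; rewrite !mxE summxE /lattice_point /path_step; congr (_ + _ * _).
  have [jl|jl] := ltnP j l.
    rewrite (bigD1 j) //= !mxE !eqxx /= mulr1 big1 => [|k /andP[_ kj]]; last first.
      by rewrite !mxE eq_sym (negbTE kj) mulr0.
    by rewrite addr0 (_ : (j == l) = false) ?mulr0 ?addr0 // -val_eqE /= ltn_eqF.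
  rewrite big1 ?add0r => [|k kl]; last first.
    rewrite !mxE (_ : (j == k) = false) ?mulr0 // -val_eqE /= gtn_eqF //.
    exact: leq_trans kl jl.
  by rewrite eqxx; case: eqP => _; rewrite ?mulr1 ?mulr0.
have ptE : (s + a *: \sum_(k < r) (t k)%:R *: delta_mx 0 k) 0 =1 cyclic_point a (s 0) t.
  move=> j; rewrite !mxE summxE /cyclic_point /lattice_point; congr (_ + _ * _).
  rewrite (bigD1 j) //= !mxE !eqxx /= mulr1 big1 ?addr0 // => k kj.
  by rewrite !mxE eq_sym (negbTE kj) mulr0.
rewrite (weight_fun_sum hW) => [|k l]; last by rewrite !ptE; apply: inj_pt.
exact: eq_weight_sum.
Qed.

Section Orbit.
Variables (K : fieldType) (p n r : nat) (a kappa : K) (L : 'rV[K]_n).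
Hypothesis hp : p \in [pchar K].
Hypothesis hp2 : (2 < p)%N.
Variables (s0 : 'I_r -> K) (x0 : 'rV[K]_n).
Hypothesis nd : orbit_regular a (L 0) s0 (x0 0).
Local Notation T := {ffun 'I_r -> 'I_p}.
Local Notation pt := (@cyclic_point K p r a s0).
Local Notation xk := (lattice_shift a x0).
Variable phi0 : T -> K.
Hypothesis sec0 : is_section a kappa (L 0) s0 (x0 0) phi0.

(** [x_ratio] for m reads only the coordinate m, so shifting all coordinates by z is harmless. Hence
    the x-directions are independent, and the section over Z^n is a plain product over m, with no
    path to choose. *)
Definition x_ratio_along (t : T) (m : 'I_n) (z : int) : K :=
  x_ratio a (fun i => x0 0 i + a * z%:~R) (L 0) m (pt t).

Definition orbit_section (k : 'rV[int]_n) (t : T) : K :=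
  phi0 t * \prod_m int_prod (x_ratio_along t m) (k 0 m).

Lemma orbit_regular_shiftx k : orbit_regular a (L 0) s0 (xk k 0).
Proof.
apply: (orbit_regular_x nd) => i; exists (k 0 i).
by rewrite lattice_shiftE mulrC.
Qed.

Lemma x_ratio_along_neq0 t m z : x_ratio_along t m z != 0.
Proof.
have ndz (u : T) := orbit_regular_pt (orbit_regular_shiftx (const_mx z)) u.
have := x_ratio_neq0 m ndz t; rewrite -/pt; apply: contra_neq => <-.
by apply: eq_bigr => v _; rewrite lattice_shiftE mxE.
Qed.

Lemma x_ratio_alongE t m (k : 'rV[int]_n) : x_ratio_along t m (k 0 m) = x_ratio a (xk k 0) (L 0) m (pt t).
Proof. by apply: eq_bigr => v _; rewrite lattice_shiftE. Qed.

Lemma orbit_section0 t : orbit_section 0 t = phi0 t.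
Proof. by rewrite /orbit_section big1 ?mulr1 // => m _; rewrite mxE /= big_ord0. Qed.

Lemma orbit_sectionS k m t :
  orbit_section (k + delta_mx 0 m) t =
  orbit_section k t * x_ratio a (xk k 0) (L 0) m (pt t).
Proof.
rewrite /orbit_section -mulrA; congr (_ * _).
rewrite (bigD1 m) //= [in RHS](bigD1 m) //= [RHS]mulrAC -x_ratio_alongE; congr (_ * _).
  by rewrite !mxE !eqxx int_prodS // => z; apply: x_ratio_along_neq0.
by apply: eq_bigr => i im; rewrite !mxE (negbTE im) andbF addr0.
Qed.

Lemma orbit_section_is_section k :
  is_section a kappa (L 0) s0 (xk k 0) (orbit_section k).
Proof.
pose P k := is_section a kappa (L 0) s0 (xk k 0) (orbit_section k).
suff : P k by []; apply: int_row_ind => {k} [|k m].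
  by move=> t l; rewrite lattice_shift0 !orbit_section0.
have ndk (u : T) := orbit_regular_pt (orbit_regular_shiftx k) u.
have xE i : xk (k + delta_mx 0 m) 0 i = xk k 0 i + (if i == m then a else 0).
  by rewrite lattice_shiftS x_ratio_step.
split => H.
  by move=> t l; rewrite !orbit_sectionS; apply: (section_x_shift hp ndk H xE).
by apply: (section_x_unshift hp ndk xE) => t l; rewrite -!orbit_sectionS; apply: H.
Qed.

End Orbit.

Theorem corollary6p3 (K : fieldType) (p : nat) (hp : p \in [pchar K])
    (hp2 : (2 < p)%N) (n r : nat) (hn : (1 <= n)%N) (hr : (1 <= r)%N)
    (a kappa : K) (ha : a != 0) (hkappa : kappa != 0) (Lambda : 'rV[K]_n)
    (R : K -> K -> tensor2_end K)
    (hR : forall L1 L2 : K, is_Rmatrix L1 L2 (R L1 L2))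
    (W : 'X_{1..n} -> {mpoly int[r + (n + n)]}) (hW : is_weight_poly W)
    (s0 : 'rV[K]_r) (x0 : 'rV[K]_n)
    (hnd : nondegenerate_point a Lambda s0 x0)
    (hBethe : Bethe_equations p a kappa Lambda s0 x0) :
  let J := Jvec p a kappa Lambda W s0 x0 in
  let Kcurv := p_curvature p a kappa Lambda R in
  let lam := curv_eigenvalue p a Lambda s0 x0 in
  (J != 0 -> forall m : 'I_n, Kcurv m x0 J = lam m *: J) /\
  exists I : 'rV[int]_n -> {mpoly K[n]},
    [/\ is_parallel_transport r a kappa Lambda R x0 J I,
        forall I' : 'rV[int]_n -> {mpoly K[n]},
          is_parallel_transport r a kappa Lambda R x0 J I' -> I' =1 I
      & (exists k : 'rV[int]_n, I k != 0) ->
        forall (k : 'rV[int]_n) (m : 'I_n),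
          Kcurv m (lattice_shift a x0 k) (I k) = lam m *: I k].
Proof.
move=> J Kcurv lam.
have nd := orbit_regular_point hp hp2 hnd.
have reg u : regular_at a (x0 0) (Lambda 0) (lattice_point a (s0 0) u).
  apply: orbit_regular_at; apply: (orbit_regular_shift nd) => i.
    by exists (u i); rewrite /lattice_point mulrC.
  by exists (0 : int); rewrite mul0r addr0.
have injpt u : injective (lattice_point a (s0 0) u).
  move=> k l E; have [_ + _] := reg u => /(_ k l).
  by case: eqP => // _ /(_ isT)[]; rewrite E subrr eqxx.
have sec0 := path_weight_section hp hp2 ha reg hBethe.
have JE : J = _ := Jvec_weight_comb p kappa Lambda x0 hW injpt.
set phi0 : {ffun 'I_r -> 'I_p} -> K := fun t => _ in sec0 JE.
pose I k := weight_comb (@cyclic_point K p r a (s0 0)) (Lambda 0)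
  (fun i k : 'I_n => (i < k)%N) (lattice_shift a x0 k 0) (orbit_section a Lambda (s0 0) x0 phi0 k).
have I0 : I 0 = J.
  by rewrite JE; apply: eq_weight_comb => // [i|t]; rewrite ?lattice_shift0 ?orbit_section0.
have Ihomog k : I k \is r.-homog for mdeg.
  by have := weight_comb_homog; rewrite -[in r.-homog](card_ord r); apply.
have ndk k := orbit_regular_shiftx nd k.
have seck k := orbit_section_is_section hp nd sec0 k.
have IS k m : I (k + delta_mx 0 m) = qKZ a kappa Lambda R m (lattice_shift a x0 k) (I k).
  rewrite (qKZ_weight_comb hp hR (ndk k) m (seck k)) /I -lattice_shiftS.
  by apply: eq_weight_comb => // t; rewrite (orbit_sectionS nd).
(* The eigenvalue at a shifted point is the one at [x0], as [h_p] is constant on the orbit. *)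
have Ieig k m : Kcurv m (lattice_shift a x0 k) (I k) = lam m *: I k.
  rewrite /Kcurv (p_curvature_weight_comb hp hp2 ha hR m (ndk k) (seck k)); congr (_ *: _).
  apply: eq_bigr => l _; rewrite mxE.
  suff -> : h_p p a (lattice_shift a x0 k 0 m) = h_p p a (x0 0 m) by [].
  by rewrite lattice_shiftE (h_pD hp) mulrC (h_p_lattice hp hp2) addr0.
split=> [_ m|]; first by have := Ieig 0 m; rewrite I0 lattice_shift0.
exists I; split=> // I' [I'homog I'0 I'S].
apply: (int_row_ind (P := fun k => I' k = I k)) => [|k m]; first by rewrite I'0 I0.
(* The forward step is immediate; the backward one is injectivity of the qKZ operator in degree
   r. *)
by rewrite I'S IS; split=> [->//|]; apply: (qKZ_inj hkappa hR (ndk k)).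
Qed.
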